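(* Let $\epsilon=(\epsilon_1,\epsilon_2,\epsilon_3)$ be $(-1,-1,-1)$ or $(-1,1,1)$, and let $(M,g,Q)$ be a connected $\epsilon$-quaternion Kähler manifold of dimension $4n\geqslant 8$ admitting a non-degenerate homogeneous $\epsilon$-quaternion Kähler structure of linear type $S$, with associated vector field $\xi$. Then $S\in\mathcal{QK}_3^{\epsilon}$ and $(M,g,Q)$ has constant $\epsilon$-quaternion sectional curvature $-4g(\xi,\xi)$.
   Context: Let $\epsilon=(\epsilon_1,\epsilon_2,\epsilon_3)\in\{(-1,-1,-1),(-1,1,1)\}$. An $\epsilon$-quaternion Hermitian structure on a pseudo-Riemannian manifold $(M,g)$ is a subbundle $Q\subset\mathfrak{so}(TM)$ (skew-symmetric endomorphisms) having local bases $J_1,J_2,J_3$ with $J_a^2=\epsilon_a\mathrm{Id}$ ($a=1,2,3$) and $J_1J_2=J_3$. $(M,g,Q)$ is $\epsilon$-quaternion Kähler if $(M,g)$ is strongly oriented (its orthonormal frame bundle is reduced to the identity component of the special orthogonal group of $g$) and $Q$ is parallel for the Levi-Civita connection $\nabla$. The case $(-1,-1,-1)$ is the pseudo-quaternion Kähler case and $(-1,1,1)$ the para-quaternion Kähler case. With $\omega_a=g(\cdot,J_a\cdot)$, the canonical $4$-form $\Omega=\sum_a-\epsilon_a\,\omega_a\wedge\omega_a$ is globally defined. A homogeneous $\epsilon$-quaternion Kähler structure is a tensor field $S$ of type $(1,2)$ such that $\widetilde\nabla=\nabla-S$ satisfies $\widetilde\nabla g=0$, $\widetilde\nabla R=0$,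 $\widetilde\nabla S=0$, $\widetilde\nabla\Omega=0$, where $R$ is the curvature tensor of $g$. It is of linear type (i.e. lies in the class $\mathcal{QK}^\epsilon_1\oplus\mathcal{QK}^\epsilon_2\oplus\mathcal{QK}^\epsilon_3$) if locally $$S_XY=g(X,Y)\xi-g(Y,\xi)X-\sum_{a=1}^3\epsilon_a\bigl(g(J_aY,\xi)J_aX-g(X,J_aY)J_a\xi\bigr)+\sum_{a=1}^3g(X,\zeta^a)J_aY$$ for some local vector fields $\xi,\zeta^1,\zeta^2,\zeta^3$. It is non-degenerate if $g(\xi,\xi)\neq0$. Write $S_{XYZ}=g(S_XY,Z)$. Then $S\in\mathcal{QK}^\epsilon_3$ means that at every point there is a covector $\theta$ with $$S_{XYZ}=g(X,Y)\theta(Z)-g(X,Z)\theta(Y)-\sum_{a=1}^3\epsilon_a\bigl(g(X,J_aY)\theta(J_aZ)-g(X,J_aZ)\theta(J_aY)\bigr).$$ $(M,g,Q)$ has constant $\epsilon$-quaternion sectional curvature $c$ ($c$ a real constant) if $R=\frac c4R^0$, where $$R^0_{XYZW}=g(X,Z)g(Y,W)-g(Y,Z)g(X,W)-\sum_a\epsilon_a\bigl\{g(J_aX,Z)g(J_aY,W)-g(J_aY,Z)g(J_aX,W)+2g(X,J_aY)g(Z,J_aW)\bigr\},$$ and the curvature convention is $R_{XYZW}=g(R_{XY}Z,W)$ with $R_{XY}Z=\nabla_{[X,Y]}Z-\nabla_X\nabla_YZ+\nabla_Y\nabla_XZ$. *)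

(* Defs.v *)
(* Smooth manifolds are topological spaces with a smooth atlas.  A tensor field
   on a manifold M is the family of its local expressions, one per chart, as
   functions of the coordinates; the expressions in two charts are related by
   the Jacobian matrix of the coordinate change.  Tangent vectors are columns
   in the coordinate basis and an endomorphism of a tangent space is the matrix
   acting on columns, so that composition of endomorphisms is [*m]. *)

From mathcomp Require Import all_boot all_order all_algebra.
From mathcomp Require Import all_classical all_reals all_analysis.

Set Implicit Arguments.
Unset Strict Implicit.
Unset Printing Implicit Defensive.

Import Order.TTheory GRing.Theory Num.Theory.
Import numFieldNormedType.Exports.

Local Open Scope classical_set_scope.
Local Open Scope ring_scope.

Section Smooth.
Context {R : realType} {m : nat} {W : normedModType R}.

Definition ebase (i : 'I_m) : 'cV[R]_m := delta_mx i 0.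

(* Only meant for D open: the partial derivatives at a point of D then depend
   only on the values of f on D. *)
Fixpoint Ck (k : nat) (D : set 'cV[R]_m) (f : 'cV[R]_m -> W) : Prop :=
  (forall x, D x -> {for x, continuous f}) /\
  (if k is k'.+1 then
     forall i, (forall x, D x -> derivable f x (ebase i)) /\
               Ck k' D (fun x => 'D_(ebase i) f x)
   else True).

Definition smooth_on (D : set 'cV[R]_m) (f : 'cV[R]_m -> W) : Prop :=
  forall k, Ck k D f.

End Smooth.

Record smoothManifold (R : realType) (m : nat) := SmoothManifold {
  mpoint :> topologicalType;
  mchart : Type;
  chdom : mchart -> set mpoint;
  chran : mchart -> set 'cV[R]_m;
  chmap : mchart -> mpoint -> 'cV[R]_m;
  chinv : mchart -> 'cV[R]_m -> mpoint;
  chdom_open : forall c, open (chdom c);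
  chran_open : forall c, open (chran c);
  chmap_ran : forall c p, chdom c p -> chran c (chmap c p);
  chinv_dom : forall c x, chran c x -> chdom c (chinv c x);
  chmapK : forall c p, chdom c p -> chinv c (chmap c p) = p;
  chinvK : forall c x, chran c x -> chmap c (chinv c x) = x;
  chmap_continuous : forall c p, chdom c p -> {for p, continuous (chmap c)};
  chinv_continuous : forall c x, chran c x -> {for x, continuous (chinv c)};
  chart_cover : forall p, exists c, chdom c p;
  chart_compat : forall c d,
    smooth_on [set x | chran c x /\ chdom d (chinv c x)]
              (fun x => chmap d (chinv c x));
  manifold_hausdorff : hausdorff_space mpoint;
  manifold_second_countable : @second_countable mpoint
}.

Section CoordinateChange.
Context {R : realType} {m : nat} {M : smoothManifold R m}.

Definition overlap (c d : mchart M) : set 'cV[R]_m :=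
  [set x | chran c x /\ chdom d (chinv c x)].

Definition trans (c d : mchart M) (x : 'cV[R]_m) : 'cV[R]_m :=
  chmap d (chinv c x).

Definition jac (c d : mchart M) (x : 'cV[R]_m) : 'M[R]_m :=
  \matrix_(i, j) ('D_(ebase j) (trans c d) x) i 0.

End CoordinateChange.

(* Calculus in one coordinate domain.  G is the Gram matrix of the metric; a
   connection is given by its matrices Gam x u, so that the derivative along u
   of the constant (coordinate) vector field v is Gam x u *m v. *)
Section LocalCalculus.
Context {R : realType} {m : nat}.
Notation V := 'cV[R]_m.

Definition bform (A : 'M[R]_m) (u v : V) : R := (u^T *m A *m v) 0 0.

(* g(nabla_u e_j, e_k)
     = 1/2 (d_u g(e_j, e_k) + d_(e_j) g(u, e_k) - d_(e_k) g(u, e_j)) *)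
Definition levi_civita (G : V -> 'M[R]_m) (x u : V) : 'M[R]_m :=
  invmx (G x) *m
  \matrix_(k, j) (2^-1 *
    ('D_u (fun y => bform (G y) (ebase j) (ebase k)) x
     + 'D_(ebase j) (fun y => bform (G y) u (ebase k)) x
     - 'D_(ebase k) (fun y => bform (G y) u (ebase j)) x)).

Definition lie (X Y : V -> V) (x : V) : V := 'D_(X x) Y x - 'D_(Y x) X x.

Definition nabla (Gam : V -> V -> 'M[R]_m) (X Y : V -> V) (x : V) : V :=
  'D_(X x) Y x + Gam x (X x) *m Y x.

Definition curv (Gam : V -> V -> 'M[R]_m) (X Y Z : V -> V) (x : V) : V :=
  nabla Gam (lie X Y) Z x - nabla Gam X (nabla Gam Y Z) x
  + nabla Gam Y (nabla Gam X Z) x.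

(* R_{uvwz} at x; by tensoriality the vectors may be extended as constant
   fields. *)
Definition riem (G : V -> 'M[R]_m) (x u v w z : V) : R :=
  bform (G x) (curv (levi_civita G) (cst u) (cst v) (cst w) x) z.

Definition nabla_metric (Gam : V -> V -> 'M[R]_m) (G : V -> 'M[R]_m)
    (x u v w : V) : R :=
  'D_u (fun y => bform (G y) v w) x
  - bform (G x) (Gam x u *m v) w - bform (G x) v (Gam x u *m w).

Definition nabla_end (Gam : V -> V -> 'M[R]_m) (J : V -> 'M[R]_m)
    (x u : V) : 'M[R]_m :=
  'D_u J x + Gam x u *m J x - J x *m Gam x u.

(* A (1,2)-tensor T is given by the endomorphisms T x v = T_v. *)
Definition nabla_tensor12 (Gam : V -> V -> 'M[R]_m) (T : V -> V -> 'M[R]_m)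
    (x u v : V) : 'M[R]_m :=
  nabla_end Gam (fun y => T y v) x u - T x (Gam x u *m v).

Definition nabla_tensor04 (Gam : V -> V -> 'M[R]_m)
    (T : V -> V -> V -> V -> V -> R) (x u v1 v2 v3 v4 : V) : R :=
  'D_u (fun y => T y v1 v2 v3 v4) x
  - T x (Gam x u *m v1) v2 v3 v4 - T x v1 (Gam x u *m v2) v3 v4
  - T x v1 v2 (Gam x u *m v3) v4 - T x v1 v2 v3 (Gam x u *m v4).

(* Exterior square of a 2-bform: the sum over (2,2)-shuffles. *)
Definition wedge_sq (w : V -> V -> R) (v1 v2 v3 v4 : V) : R :=
  2 * (w v1 v2 * w v3 v4 - w v1 v3 * w v2 v4 + w v1 v4 * w v2 v3).

Definition omega (G J : 'M[R]_m) (u v : V) : R := bform G u (J *m v).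

Definition Omega (eps : 'I_3 -> R) (G : V -> 'M[R]_m)
    (J : 'I_3 -> V -> 'M[R]_m) (x v1 v2 v3 v4 : V) : R :=
  \sum_a - eps a * wedge_sq (omega (G x) (J a x)) v1 v2 v3 v4.

Definition riem0 (eps : 'I_3 -> R) (G : 'M[R]_m) (J : 'I_3 -> 'M[R]_m)
    (X Y Z W : V) : R :=
  bform G X Z * bform G Y W - bform G Y Z * bform G X W
  - \sum_a eps a *
      (bform G (J a *m X) Z * bform G (J a *m Y) W
       - bform G (J a *m Y) Z * bform G (J a *m X) W
       + 2 * bform G X (J a *m Y) * bform G Z (J a *m W)).

End LocalCalculus.

Definition triple {R : realType} (a b c : R) : 'I_3 -> R :=
  fun i => nth 0 [:: a; b; c] i.

Definition i1 : 'I_3 := @Ordinal 3 0 isT.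
Definition i2 : 'I_3 := @Ordinal 3 1 isT.
Definition i3 : 'I_3 := @Ordinal 3 2 isT.

Section Structures.
Context {R : realType} {m : nat} {M : smoothManifold R m}.
Notation V := 'cV[R]_m.

Definition pseudo_riemannian (g : mchart M -> V -> 'M[R]_m) : Prop :=
  [/\ forall c, smooth_on (chran c) (g c),
      forall c x, chran c x -> (g c x)^T = g c x,
      forall c x, chran c x -> g c x \in unitmx
    & forall c d x, overlap c d x ->
        g c x = (jac c d x)^T *m g d (trans c d x) *m jac c d x].

Definition is_tensor12 (S : mchart M -> V -> V -> 'M[R]_m) : Prop :=
  [/\ forall c u, smooth_on (chran c) (fun x => S c x u),
      forall c x, chran c x -> forall (k : R) u v,
        S c x (k *: u + v) = k *: S c x u + S c x v
    & forall c d x, overlap c d x -> forall u,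
        S d (trans c d x) (jac c d x *m u) *m jac c d x
          = jac c d x *m S c x u].

Definition local_basis (eps : 'I_3 -> R) (g : mchart M -> V -> 'M[R]_m)
    (Q : mchart M -> V -> set 'M[R]_m) (c : mchart M) (U : set V)
    (J : 'I_3 -> V -> 'M[R]_m) : Prop :=
  [/\ open U, U `<=` chran c, forall a, smooth_on U (J a)
    & forall x, U x ->
      [/\ forall a u v,
            bform (g c x) (J a x *m u) v = - bform (g c x) u (J a x *m v),
          forall a, J a x *m J a x = (eps a)%:M,
          J i1 x *m J i2 x = J i3 x
        & Q c x = [set A | exists k : 'I_3 -> R, A = \sum_a k a *: J a x]]].

Definition quaternion_hermitian (eps : 'I_3 -> R)
    (g : mchart M -> V -> 'M[R]_m) (Q : mchart M -> V -> set 'M[R]_m) : Prop :=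
  (forall c d x, overlap c d x -> forall A,
     Q c x A <-> Q d (trans c d x) (jac c d x *m A *m invmx (jac c d x))) /\
  (forall c x, chran c x -> exists U J, local_basis eps g Q c U J /\ U x).

Definition parallel (g : mchart M -> V -> 'M[R]_m)
    (Q : mchart M -> V -> set 'M[R]_m) : Prop :=
  forall c (U : set V) (J : V -> 'M[R]_m),
    open U -> U `<=` chran c -> smooth_on U J ->
    (forall x, U x -> Q c x (J x)) ->
    forall x u, U x -> Q c x (nabla_end (levi_civita (g c)) J x u).

(* Diagonal matrix of a scalar product with s minus signs. *)
Definition signature_mx (s : nat) : 'M[R]_m :=
  diag_mx (\row_i (if (i < s)%N then -1 else 1)).

Definition special_orthogonal (s : nat) : set 'M[R]_m :=
  [set A | A^T *m signature_mx s *m A = signature_mx s /\ \det A = 1].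

Definition special_orthogonal0 (s : nat) : set 'M[R]_m :=
  connected_component (special_orthogonal s) 1%:M.

(* P is the reduction of the bundle of orthonormal frames: a frame is the
   matrix whose columns are its vectors, and the structure group acts by
   multiplication on the right. *)
Definition strongly_oriented (g : mchart M -> V -> 'M[R]_m) : Prop :=
  exists (s : nat) (P : mchart M -> V -> set 'M[R]_m),
  [/\ forall c x F, chran c x -> P c x F ->
        F^T *m g c x *m F = signature_mx s,
      forall c x F, chran c x -> P c x F ->
        P c x = [set F *m A | A in special_orthogonal0 s],
      forall c d x F, overlap c d x ->
        P c x F <-> P d (trans c d x) (jac c d x *m F)
    & forall c x, chran c x -> exists U (F : V -> 'M[R]_m),
        [/\ open U, U x, U `<=` chran c, smooth_on U F
          & forall y, U y -> P c y (F y)]].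

Definition quaternion_kahler (eps : 'I_3 -> R)
    (g : mchart M -> V -> 'M[R]_m) (Q : mchart M -> V -> set 'M[R]_m) : Prop :=
  [/\ quaternion_hermitian eps g Q, strongly_oriented g & parallel g Q].

Definition homogeneous_structure (eps : 'I_3 -> R)
    (g : mchart M -> V -> 'M[R]_m) (Q : mchart M -> V -> set 'M[R]_m)
    (S : mchart M -> V -> V -> 'M[R]_m) : Prop :=
  let Gam c x u := levi_civita (g c) x u - S c x u in
  [/\ is_tensor12 S,
      forall c x, chran c x -> forall u v w,
        nabla_metric (Gam c) (g c) x u v w = 0,
      forall c x, chran c x -> forall u v1 v2 v3 v4,
        nabla_tensor04 (Gam c) (riem (g c)) x u v1 v2 v3 v4 = 0,
      forall c x, chran c x -> forall u v,
        nabla_tensor12 (Gam c) (S c) x u v = 0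
    & forall c U J, local_basis eps g Q c U J ->
      forall x, U x -> forall u v1 v2 v3 v4,
        nabla_tensor04 (Gam c) (Omega eps (g c) J) x u v1 v2 v3 v4 = 0].

Definition linear_expression (eps : 'I_3 -> R)
    (g : mchart M -> V -> 'M[R]_m) (Q : mchart M -> V -> set 'M[R]_m)
    (S : mchart M -> V -> V -> 'M[R]_m) (c : mchart M) (U : set V)
    (J : 'I_3 -> V -> 'M[R]_m) (xi : V -> V) (zeta : 'I_3 -> V -> V) : Prop :=
  [/\ local_basis eps g Q c U J, smooth_on U xi,
      forall a, smooth_on U (zeta a)
    & forall x, U x -> forall X Y,
        S c x X *m Y =
          bform (g c x) X Y *: xi x - bform (g c x) Y (xi x) *: X
          - \sum_a eps a *:
              (bform (g c x) (J a x *m Y) (xi x) *: (J a x *m X)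
               - bform (g c x) X (J a x *m Y) *: (J a x *m xi x))
          + \sum_a bform (g c x) X (zeta a x) *: (J a x *m Y)].

Definition linear_type (eps : 'I_3 -> R)
    (g : mchart M -> V -> 'M[R]_m) (Q : mchart M -> V -> set 'M[R]_m)
    (S : mchart M -> V -> V -> 'M[R]_m) : Prop :=
  forall c x, chran c x ->
    exists U J xi zeta, linear_expression eps g Q S c U J xi zeta /\ U x.

Definition nondegenerate_structure (eps : 'I_3 -> R)
    (g : mchart M -> V -> 'M[R]_m) (Q : mchart M -> V -> set 'M[R]_m)
    (S : mchart M -> V -> V -> 'M[R]_m) : Prop :=
  forall c U J xi zeta, linear_expression eps g Q S c U J xi zeta ->
    forall x, U x -> bform (g c x) (xi x) (xi x) != 0.

Definition in_QK3 (eps : 'I_3 -> R)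
    (g : mchart M -> V -> 'M[R]_m) (Q : mchart M -> V -> set 'M[R]_m)
    (S : mchart M -> V -> V -> 'M[R]_m) : Prop :=
  forall c U J, local_basis eps g Q c U J -> forall x, U x ->
  exists theta : 'rV[R]_m,
    let th (Z : V) := (theta *m Z) 0 0 in
    let b := bform (g c x) in
    forall X Y Z,
      b (S c x X *m Y) Z =
        b X Y * th Z - b X Z * th Y
        - \sum_a eps a * (b X (J a x *m Y) * th (J a x *m Z)
                          - b X (J a x *m Z) * th (J a x *m Y)).

Definition constant_curvature (eps : 'I_3 -> R)
    (g : mchart M -> V -> 'M[R]_m) (Q : mchart M -> V -> set 'M[R]_m)
    (k : R) : Prop :=
  forall c U J, local_basis eps g Q c U J -> forall x, U x ->
  forall X Y Z W,
    riem (g c) x X Y Z W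
      = k / 4 * riem0 eps (g c x) (fun a => J a x) X Y Z W.

End Structures.

(* Main.v *)
(* Write nabla~ = nabla - S, N = g(xi, xi) and H xi = span(xi, J_a xi).
   Testing nabla~ S = 0 on vectors Y orthogonal to X and QX gives
   nabla~ xi = 0.  Hence N is locally constant, and, as nabla~ S = 0,
     R_{XY} xi = - [S_X, S_Y] xi + S_{S_X Y - S_Y X} xi,
   which involves no derivative of the zeta^a.  The pair symmetry of R and
   [R_{XY}, Q] <= Q then force zeta^a to vanish, first on xi, then on J_b xi,
   then on the orthogonal of H xi, and R_{XY} xi = - N R^0_{XY} xi follows.
   The tensor D = R + N R^0 satisfies D_{XY} xi = 0; by the first Bianchi
   identity and n >= 2 it vanishes as soon as one argument lies in H xi.  Since
   nabla~ R = 0, the second Bianchi identity says that the cyclic sum of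
   (S_W . D)_{XY} over W, X, Y is zero; at W = xi it reads 2 N D = 0.
   Finally S determines xi, so N is a function on M, constant by
   connectedness. *)

From HB Require Import structures.
Require Import Defs.
From mathcomp Require Import all_boot all_order all_algebra.
From mathcomp Require Import all_classical all_reals all_analysis.
From mathcomp Require Import ring lra.

Set Implicit Arguments.
Unset Strict Implicit.
Unset Printing Implicit Defensive.

Import Order.TTheory GRing.Theory Num.Theory.
Import numFieldNormedType.Exports.

Local Open Scope classical_set_scope.
Local Open Scope ring_scope.

(** * Pointwise algebra *)

(** Two obstacles shape the argument. The metric may be indefinite, so every test vector must be
    non-null: all divisions are by $N$ or by $g(u,u)$ for one vector [u] orthogonal to $H\xi$. Such
    a [u] exists because $n \ge 2$ leaves room outside $H\xi$ and $N \neq 0$ makes the complement of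
    $H\xi$ non-degenerate. Moreover the basis $J_a$ may rotate inside $Q$ under nabla~ and nothing
    is known about the derivatives of the $\zeta^a$; identities are therefore differentiated only
    where such derivatives meet a vanishing factor or cancel. For this reason pointwise algebra,
    with an abstract curvature tensor and $S$ given by its formula, is separated from the calculus
    in one chart that feeds it. The factor $2N$ comes from $S_\xi = 0$ and $S_X \xi = -N X$ modulo
    $Q\xi$: two of the three cyclic terms contribute $N D$ each. The convention $R = (c/4) R^0$
    turns $R = -N R^0$ into $c = -4N$. The conclusions concern every adapted basis of $Q$, whereas
    the linear expression comes with one of its own; a change-of-basis invariance bridges the
    two. *)

Section LinearTypeAlgebra.
Context {F : realFieldType} {V : lmodType F}.
Variables (g : V -> V -> F) (e : F) (j1 j2 j3 : V -> V).

(* In both signatures eps_1 = -1 and eps_2 = eps_3; e is this common value. *)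
Record quaternionic_space : Prop := QuaternionicSpace {
  qs_he : e = 1 \/ e = -1;
  qs_gC : forall x y, g x y = g y x;
  qs_gDl : forall x y z, g (x + y) z = g x z + g y z;
  qs_gZl : forall k x z, g (k *: x) z = k * g x z;
  qs_gnd : forall x y, (forall z, g x z = g y z) -> x = y;
  qs_j1l : forall k x y, j1 (k *: x + y) = k *: j1 x + j1 y;
  qs_j2l : forall k x y, j2 (k *: x + y) = k *: j2 x + j2 y;
  qs_j3l : forall k x y, j3 (k *: x + y) = k *: j3 x + j3 y;
  qs_sk1 : forall x y, g (j1 x) y = - g x (j1 y);
  qs_sk2 : forall x y, g (j2 x) y = - g x (j2 y);
  qs_sk3 : forall x y, g (j3 x) y = - g x (j3 y);
  qs_j11 : forall x, j1 (j1 x) = - x;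
  qs_j22 : forall x, j2 (j2 x) = e *: x;
  qs_j33 : forall x, j3 (j3 x) = e *: x;
  qs_j12 : forall x, j1 (j2 x) = j3 x
}.
Hypothesis H : quaternionic_space.
Let he := qs_he H.
Let gC := qs_gC H.
Let gDl := qs_gDl H.
Let gZl := qs_gZl H.
Let gnd := qs_gnd H.
Let j1l := qs_j1l H.
Let j2l := qs_j2l H.
Let j3l := qs_j3l H.
Let sk1 := qs_sk1 H.
Let sk2 := qs_sk2 H.
Let sk3 := qs_sk3 H.
Let j11 := qs_j11 H.
Let j22 := qs_j22 H.
Let j33 := qs_j33 H.
Let j12 := qs_j12 H.

Lemma gDr x y z : g x (y + z) = g x y + g x z.
Proof. by rewrite gC gDl !(gC _ x). Qed.
Lemma gZr k x y : g x (k *: y) = k * g x y.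
Proof. by rewrite gC gZl gC. Qed.
Lemma gNl x y : g (- x) y = - g x y.
Proof. by rewrite -scaleN1r gZl mulN1r. Qed.
Lemma gNr x y : g x (- y) = - g x y.
Proof. by rewrite gC gNl gC. Qed.
Lemma g0l y : g 0 y = 0.
Proof. by rewrite -(scale0r 0) gZl mul0r. Qed.
Lemma g0r y : g y 0 = 0.
Proof. by rewrite gC g0l. Qed.

Definition gE := (gDl, gDr, gNl, gNr, gZl, gZr, g0l, g0r).

Lemma linear_ops (W : lmodType F) (f : V -> W) : (forall k x y, f (k *: x + y) = k *: f x + f y) ->
  [/\ forall x y, f (x + y) = f x + f y, forall k x, f (k *: x) = k *: f x,
      f 0 = 0 & forall x, f (- x) = - f x].
Proof.
move=> h; have f0 : f 0 = 0.
  by have := h (- 1) 0 0; rewrite scaler0 addr0 scaleN1r addNr.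
have fz k x : f (k *: x) = k *: f x by have := h k x 0; rewrite addr0 f0 addr0.
split=> // [x y|x]; first by have := h 1 x y; rewrite !scale1r.
by rewrite -scaleN1r fz scaleN1r.
Qed.

Lemma j1Z k x : j1 (k *: x) = k *: j1 x. Proof. by case: (linear_ops j1l). Qed.
Lemma j2Z k x : j2 (k *: x) = k *: j2 x. Proof. by case: (linear_ops j2l). Qed.
Lemma j3Z k x : j3 (k *: x) = k *: j3 x. Proof. by case: (linear_ops j3l). Qed.
Lemma j1N x : j1 (- x) = - j1 x. Proof. by case: (linear_ops j1l). Qed.
Lemma j2N x : j2 (- x) = - j2 x. Proof. by case: (linear_ops j2l). Qed.
Lemma j3N x : j3 (- x) = - j3 x. Proof. by case: (linear_ops j3l). Qed.
Lemma j1D x y : j1 (x + y) = j1 x + j1 y. Proof. by case: (linear_ops j1l). Qed.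
Lemma j2D x y : j2 (x + y) = j2 x + j2 y. Proof. by case: (linear_ops j2l). Qed.
Lemma j3D x y : j3 (x + y) = j3 x + j3 y. Proof. by case: (linear_ops j3l). Qed.
Definition jlE := (j1Z, j2Z, j3Z, j1N, j2N, j3N, j1D, j2D, j3D).

Let ee : e * e = 1.
Proof. by case: he => ->; ring. Qed.

Lemma j13 x : j1 (j3 x) = - j2 x.
Proof. by rewrite -j12 j11. Qed.
Lemma j32 x : j3 (j2 x) = e *: j1 x.
Proof. by rewrite -j12 j22 j1Z. Qed.
(** Anticommutation follows from the squares: applying $J_1$ to $(J_1J_2)^2 = J_3^2 = e$ gives
    $J_2J_1J_2 = -e J_1$, and $J_2$ is inverted by $J_2^2 = e = e^{-1}$. *)
Lemma j21 x : j2 (j1 x) = - j3 x.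
Proof.
have h y : j2 (j1 (j2 y)) = - (e *: j1 y).
  have : j1 (j2 (j1 (j2 y))) = e *: y by rewrite j12 j12 j33.
  by move/(congr1 j1); rewrite j11 j1Z => /eqP; rewrite eqr_oppLR => /eqP.
have := h (e *: j2 x); rewrite j2Z j22 scalerA ee scale1r j1Z j12 scalerA ee scale1r.
by [].
Qed.
Lemma j31 x : j3 (j1 x) = j2 x.
Proof. by rewrite -j12 j21 j1N j13 opprK. Qed.
Lemma j23 x : j2 (j3 x) = - (e *: j1 x).
Proof. by rewrite -[j3 x]opprK -j21 j2N j22. Qed.

Definition jE := (j11, j22, j33, j12, j13, j21, j23, j31, j32).

Lemma self1 x : g x (j1 x) = 0.
Proof. by have := sk1 x x; rewrite gC => h; lra. Qed.
Lemma self2 x : g x (j2 x) = 0.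
Proof. by have := sk2 x x; rewrite gC => h; lra. Qed.
Lemma self3 x : g x (j3 x) = 0.
Proof. by have := sk3 x x; rewrite gC => h; lra. Qed.

(** The $\zeta^a$ enter as functions rather than vectors, so that the reduced form of $S$ is
    obtained with constant zero functions. *)
Definition lin_str (xi : V) (z1 z2 z3 : V -> F) (x y : V) : V :=
  g x y *: xi - g y xi *: x
  - ((-1) *: (g (j1 y) xi *: j1 x - g x (j1 y) *: j1 xi)
     + e *: (g (j2 y) xi *: j2 x - g x (j2 y) *: j2 xi)
     + e *: (g (j3 y) xi *: j3 x - g x (j3 y) *: j3 xi))
  + (z1 x *: j1 y + z2 x *: j2 y + z3 x *: j3 y).

Definition R0 (x y z w : V) : F :=
  g x z * g y w - g y z * g x w
  - (- (g (j1 x) z * g (j1 y) w - g (j1 y) z * g (j1 x) w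
         + 2 * g x (j1 y) * g z (j1 w))
     + e * (g (j2 x) z * g (j2 y) w - g (j2 y) z * g (j2 x) w
         + 2 * g x (j2 y) * g z (j2 w))
     + e * (g (j3 x) z * g (j3 y) w - g (j3 y) z * g (j3 x) w
         + 2 * g x (j3 y) * g z (j3 w))).

Definition orth (xi y : V) : Prop :=
  [/\ g y xi = 0, g y (j1 xi) = 0, g y (j2 xi) = 0 & g y (j3 xi) = 0].

Lemma orth_j xi y : orth xi y -> [/\ orth xi (j1 y), orth xi (j2 y) & orth xi (j3 y)].
Proof.
case=> h0 h1 h2 h3.
by split; split; rewrite ?(sk1, sk2, sk3) ?jE ?gE ?(h0, h1, h2, h3) ?mulr0 ?oppr0.
Qed.

(** Every other term carries a factor $g(x,y)$, $g(x,J_ay)$ or $g(x,J_ax)$, all zero. This pairing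
    isolates $\xi$ from the $\zeta^a$. *)
Lemma lin_str_test xi z1 z2 z3 x y :
  orth x y -> g (lin_str xi z1 z2 z3 x y) x = - (g y xi * g x x).
Proof.
case=> h0 h1 h2 h3.
have [f0 f1 f2 f3] : [/\ g x y = 0, g x (j1 y) = 0, g x (j2 y) = 0 & g x (j3 y) = 0].
  by split; rewrite gC ?(sk1, sk2, sk3) ?(h0, h1, h2, h3) ?oppr0.
rewrite /lin_str !gE !(sk1, sk2, sk3) !(self1, self2, self3) f0 f1 f2 f3.
by rewrite h1 h2 h3; ring.
Qed.

Section Decomposition.
Variables (xi : V).
Hypothesis N0 : g xi xi != 0.

(** The vectors $\xi, J_a\xi$ are pairwise orthogonal and non-null, so $V$ is the sum of $H\xi$ and
    its orthogonal in any signature. *)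
Lemma orth_decomp (f : V -> F) :
  (forall k x y, f (k *: x + y) = k * f x + f y) ->
  f xi = 0 -> f (j1 xi) = 0 -> f (j2 xi) = 0 -> f (j3 xi) = 0 ->
  (forall y, orth xi y -> f y = 0) -> forall y, f y = 0.
Proof.
move=> fl f0 f1 f2 f3 fo y.
set n := g xi xi; have n0 : n != 0 by [].
(* The component of [y] orthogonal to $H\xi$. The norms of $\xi, J_1\xi$ are [n] and those of
   $J_2\xi, J_3\xi$ are $-en$, with $e^{-1} = e$; hence the signs. *)
pose p := - (g y xi / n) *: xi + (- (g y (j1 xi) / n) *: j1 xi
   + ((e * g y (j2 xi) / n) *: j2 xi + ((e * g y (j3 xi) / n) *: j3 xi + y))).
have fp : f p = f y by rewrite /p !fl f0 f1 f2 f3; ring.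
rewrite -fp; apply: fo.
split; rewrite /p !gDl !gZl ?sk1 ?sk2 ?sk3 ?jE ?gNr ?gZr ?self1 ?self2 ?self3 -/n;
  by case: he => ->; field.
Qed.
End Decomposition.

(* [R_xy, j] lies in the span of j1, j2, j3. *)
Definition normalizes (R : V -> V -> V -> V -> F) (j : V -> V) :=
  forall x y, exists m1 m2 m3, forall z w, R x y (j z) w + R x y z (j w)
    = m1 * g (j1 z) w + m2 * g (j2 z) w + m3 * g (j3 z) w.

Record quaternionic_curvature (R : V -> V -> V -> V -> F) : Prop := QuaternionicCurvature {
  qc_Rl : forall k x y z w t, R (k *: x + y) z w t = k * R x z w t + R y z w t;
  qc_R12 : forall x y z w, R x y z w = - R y x z w;
  qc_R34 : forall x y z w, R x y z w = - R x y w z;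
  qc_Rp : forall x y z w, R x y z w = R z w x y;
  qc_RB : forall x y z w, R x y z w + R y z x w + R z x y w = 0;
  qc_RQ1 : normalizes R j1;
  qc_RQ2 : normalizes R j2;
  qc_RQ3 : normalizes R j3
}.

Lemma R0l k x y z w t : R0 (k *: x + y) z w t = k * R0 x z w t + R0 y z w t.
Proof. by rewrite /R0 !(gE, jlE); ring. Qed.
Lemma R0_12 x y z w : R0 x y z w = - R0 y x z w.
Proof. by rewrite /R0 (gC y (j1 x)) (gC y (j2 x)) (gC y (j3 x)) !(sk1, sk2, sk3); ring. Qed.
Lemma R0_34 x y z w : R0 x y z w = - R0 x y w z.
Proof. by rewrite /R0 (gC w (j1 z)) (gC w (j2 z)) (gC w (j3 z)) !(sk1, sk2, sk3); ring. Qed.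
Lemma R0p x y z w : R0 x y z w = R0 z w x y.
Proof.
rewrite /R0 !(gC z, gC w) !(sk1, sk2, sk3).
rewrite ?(gC z (j1 _), gC z (j2 _), gC z (j3 _), gC w (j1 _), gC w (j2 _), gC w (j3 _)) ?(sk1,sk2,sk3).
ring.
Qed.
Lemma R0B x y z w : R0 x y z w + R0 y z x w + R0 z x y w = 0.
Proof.
rewrite /R0 !(sk1, sk2, sk3) !(gC y x, gC z x, gC z y).
have c1 a b : g a (j1 b) = - g b (j1 a) by rewrite gC sk1.
have c2 a b : g a (j2 b) = - g b (j2 a) by rewrite gC sk2.
have c3 a b : g a (j3 b) = - g b (j3 a) by rewrite gC sk3.
rewrite !(c1 y x, c1 z x, c1 z y, c2 y x, c2 z x, c2 z y, c3 y x, c3 z x, c3 z y).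
ring.
Qed.

(** Apart from the terms $2g(x,J_ay)g(z,J_aw)$, the endomorphism $R^0_{xy}$ commutes with $Q$. In
    those terms anticommutation doubles the commutator $[J_a,J_b]$, whence the coefficients $4 =
    2\cdot 2$. *)
Lemma R0_normalizes : [/\ normalizes R0 j1, normalizes R0 j2 & normalizes R0 j3].
Proof.
split=> x y.
- exists 0, (4 * e * g x (j3 y)), (- 4 * e * g x (j2 y)) => z w.
  by rewrite /R0 !(sk1, sk2, sk3) !jE !(gNl, gNr, gZl, gZr); case: he => ->; ring.
- exists (4 * g x (j3 y)), 0, (- 4 * g x (j1 y)) => z w.
  by rewrite /R0 !(sk1, sk2, sk3) !jE !(gNl, gNr, gZl, gZr); case: he => ->; ring.
- exists (- 4 * g x (j2 y)), (4 * g x (j1 y)), 0 => z w.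
  by rewrite /R0 !(sk1, sk2, sk3) !jE !(gNl, gNr, gZl, gZr); case: he => ->; ring.
Qed.

(** $R^0$ is built from $g$ and the $J_a$ alone, and [A], being skew and commuting with $Q$,
    annihilates them all. *)
Lemma R0_invariant (A : V -> V) : (forall x y, g (A x) y = - g x (A y)) ->
  (forall x, A (j1 x) = j1 (A x)) -> (forall x, A (j2 x) = j2 (A x)) ->
  (forall x, A (j3 x) = j3 (A x)) -> forall x y z w,
  R0 (A x) y z w + R0 x (A y) z w + R0 x y (A z) w + R0 x y z (A w) = 0.
Proof.
move=> skA A1 A2 A3 x y z w; rewrite /R0 -!A1 -!A2 -!A3 !skA.
ring.
Qed.

Section CurvatureAlgebra.
Variables (xi u : V) (R : V -> V -> V -> V -> F).
Hypothesis N0 : g xi xi != 0.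
Hypothesis uo : orth xi u.
Hypothesis u0 : g u u != 0.
Hypothesis HR : quaternionic_curvature R.
Let Rl := qc_Rl HR.
Let R12 := qc_R12 HR.
Let R34 := qc_R34 HR.
Let Rp := qc_Rp HR.
Let RB := qc_RB HR.
Let RQ1 := qc_RQ1 HR.
Let RQ2 := qc_RQ2 HR.
Let RQ3 := qc_RQ3 HR.

(** The defect $[R_{xy},J_a]\xi$ lies in $Q\xi$, to which [z] is orthogonal. *)
Lemma RQo x y z : orth xi z ->
  [/\ R x y (j1 xi) z = - R x y xi (j1 z), R x y (j2 xi) z = - R x y xi (j2 z)
    & R x y (j3 xi) z = - R x y xi (j3 z)].
Proof.
case=> h0 h1 h2 h3.
have f1 : g (j1 xi) z = 0 by rewrite gC.
have f2 : g (j2 xi) z = 0 by rewrite gC.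
have f3 : g (j3 xi) z = 0 by rewrite gC.
by split; [have [m1 [m2 [m3 h]]] := RQ1 x y | have [m1 [m2 [m3 h]]] := RQ2 x y
  | have [m1 [m2 [m3 h]]] := RQ3 x y]; apply/eqP; rewrite -addr_eq0 h f1 f2 f3 !mulr0 !addr0.
Qed.

(** * Vanishing of the forms zeta^a *)

Section ZetaVanishes.
Variables (z1 z2 z3 : V -> F).
Hypothesis z1l : forall k x y, z1 (k *: x + y) = k * z1 x + z1 y.
Hypothesis z2l : forall k x y, z2 (k *: x + y) = k * z2 x + z2 y.
Hypothesis z3l : forall k x y, z3 (k *: x + y) = k * z3 x + z3 y.
Variable S : V -> V -> V.
Hypothesis SE : forall x y, S x y = lin_str xi z1 z2 z3 x y.
Hypothesis Rxi : forall x y z,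
  R x y xi z = g (- S x (S y xi) + S y (S x xi) + S (S x y - S y x) xi) z.

Lemma linear_form_ops (f : V -> F) : (forall k x y, f (k *: x + y) = k * f x + f y) ->
  [/\ forall x y, f (x + y) = f x + f y, forall k x, f (k *: x) = k * f x,
      f 0 = 0 & forall x, f (- x) = - f x].
Proof.
move=> h; have f0 : f 0 = 0 by have := h 1 0 0; rewrite scaler0 addr0 => q; lra.
have fz k x : f (k *: x) = k * f x by have := h k x 0; rewrite addr0 f0 addr0.
split=> // [x y|x]; first by have := h 1 x y; rewrite scale1r mul1r.
by rewrite -scaleN1r fz mulN1r.
Qed.

Lemma g_lin_str x y w : g (S x y) w = g x y * g xi w - g y xi * g x w
  + (g y (j1 xi) * g x (j1 w) + g x (j1 y) * g xi (j1 w))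
  - e * (g y (j2 xi) * g x (j2 w) + g x (j2 y) * g xi (j2 w))
  - e * (g y (j3 xi) * g x (j3 w) + g x (j3 y) * g xi (j3 w))
  + (z1 x * g (j1 y) w + z2 x * g (j2 y) w + z3 x * g (j3 y) w).
Proof.
rewrite !SE /lin_str !gDl !gNl !gDl !gZl !gDl !gNl !gZl.
rewrite !(sk1 _ xi, sk2 _ xi, sk3 _ xi) !(sk1 x, sk2 x, sk3 x) !(sk1 xi, sk2 xi, sk3 xi).
ring.
Qed.

Lemma lin_str_skew x y z : g (S x y) z = - g y (S x z).
Proof.
rewrite (gC y) !g_lin_str (gC (j1 z)) (gC (j2 z)) (gC (j3 z)) !sk1 !sk2 !sk3.
rewrite -[g z xi]gC (gC z (j1 xi)) (gC z (j2 xi)) (gC z (j3 xi)) !sk1 !sk2 !sk3.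
rewrite -[g y xi]gC (gC y (j1 xi)) (gC y (j2 xi)) (gC y (j3 xi)) !sk1 !sk2 !sk3.
ring.
Qed.

Lemma lin_str_xi x : S x xi = g x xi *: xi - g xi xi *: x
  + (z1 x - g x (j1 xi)) *: j1 xi + (z2 x + e * g x (j2 xi)) *: j2 xi
  + (z3 x + e * g x (j3 xi)) *: j3 xi.
Proof.
apply: gnd => w; rewrite !SE /lin_str.
rewrite !gDl !gNl !gDl !gZl !gDl !gNl !gZl !sk1 !sk2 !sk3 !self1 !self2 !self3.
ring.
Qed.

Lemma lin_str_orth x z : orth xi z -> S x z = g x z *: xi - g x (j1 z) *: j1 xi
  + (e * g x (j2 z)) *: j2 xi + (e * g x (j3 z)) *: j3 xi
  + (z1 x *: j1 z + z2 x *: j2 z + z3 x *: j3 z).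
Proof.
case=> h0 h1 h2 h3; apply: gnd => w; rewrite !SE /lin_str.
rewrite !gDl !gNl !gDl !gZl !gDl !gNl !gZl !sk1 !sk2 !sk3 h0 h1 h2 h3.
ring.
Qed.

Lemma g_lin_str_xi x w : g (S x xi) w = g x xi * g xi w - g xi xi * g x w
  + (z1 x - g x (j1 xi)) * g (j1 xi) w + (z2 x + e * g x (j2 xi)) * g (j2 xi) w
  + (z3 x + e * g x (j3 xi)) * g (j3 xi) w.
Proof. by rewrite lin_str_xi !gDl gNl !gZl. Qed.

Lemma g_lin_str_xi_j x : [/\ g (S x xi) xi = 0,
  g (S x xi) (j1 xi) = g xi xi * (z1 x - 2 * g x (j1 xi)),
  g (S x xi) (j2 xi) = - (g xi xi * (e * z2 x + 2 * g x (j2 xi)))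
  & g (S x xi) (j3 xi) = - (g xi xi * (e * z3 x + 2 * g x (j3 xi)))].
Proof.
by split; rewrite g_lin_str_xi ?sk1 ?sk2 ?sk3 ?jE ?gNr ?gZr ?self1 ?self2 ?self3;
  case: he => ->; ring.
Qed.

Lemma g_lin_str_xi_orth x z : orth xi z -> g (S x xi) z = - (g xi xi * g x z).
Proof.
case=> h0 h1 h2 h3; rewrite g_lin_str_xi (gC xi z) (gC (j1 xi)) (gC (j2 xi)) (gC (j3 xi)).
rewrite h0 h1 h2 h3; ring.
Qed.

(** By skewness $S_x$ moves onto [z], where it takes values in $H\xi + Qz$; the pairings of $S_y\xi$
    with both summands are already known. *)
Lemma g_lin_str2 x y z : orth xi z -> g (S x (S y xi)) z = g xi xi *
  (- 2 * g y (j1 xi) * g x (j1 z) + z1 y * g x (j1 z)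
   + e * (2 * g y (j2 xi) * g x (j2 z)) + z2 y * g x (j2 z)
   + e * (2 * g y (j3 xi) * g x (j3 z)) + z3 y * g x (j3 z)
   + z1 x * g y (j1 z) + z2 x * g y (j2 z) + z3 x * g y (j3 z)).
Proof.
move=> zo; have [jo1 jo2 jo3] := orth_j zo; have [A0 A1 A2 A3] := g_lin_str_xi_j y.
rewrite lin_str_skew (lin_str_orth x zo) !gDr gNr !gZr A0 A1 A2 A3 !g_lin_str_xi_orth //.
by case: he => ->; ring.
Qed.

(** Products of two $\zeta$ occur only in the component of $R_{xy}\xi$ along $H\xi$, so testing
    against [z] leaves an expression linear in the $\zeta^a$. *)
Lemma R_xi_orth x y z : orth xi z -> R x y xi z =
  g xi xi * (g y xi * g x z - g x xi * g y z
    + ((z1 y - g y (j1 xi)) * g (j1 x) z - (z1 x - g x (j1 xi)) * g (j1 y) z)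
    + ((z2 y + e * g y (j2 xi)) * g (j2 x) z - (z2 x + e * g x (j2 xi)) * g (j2 y) z)
    + ((z3 y + e * g y (j3 xi)) * g (j3 x) z - (z3 x + e * g x (j3 xi)) * g (j3 y) z)).
Proof.
move=> zo; have [h0 h1 h2 h3] := zo; 
have k0 : g xi z = 0 by rewrite gC.
have k1 : g (j1 xi) z = 0 by rewrite gC.
have k2 : g (j2 xi) z = 0 by rewrite gC.
have k3 : g (j3 xi) z = 0 by rewrite gC.
rewrite Rxi !gDl gNl !g_lin_str2 //. rewrite g_lin_str_xi_orth //.
rewrite [g (_ - _) z]gDl gNl !g_lin_str.
have [[a0 _ _ _] [b0 _ _ _] [c0 _ _ _]] := orth_j zo.
rewrite k0 !sk1 !sk2 !sk3 !(gC xi, gC (j1 xi), gC (j2 xi), gC (j3 xi)) a0 b0 c0.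
ring.
Qed.

Lemma orth_g x : orth xi x -> [/\ g xi x = 0, g (j1 xi) x = 0, g (j2 xi) x = 0 & g (j3 xi) x = 0].
Proof. by case=> h0 h1 h2 h3; split; rewrite gC. Qed.

Lemma gJJ x : [/\ g (j1 x) (j1 x) = g x x, g (j2 x) (j2 x) = - (e * g x x)
  & g (j3 x) (j3 x) = - (e * g x x)].
Proof. by split; rewrite ?(sk1 x) ?(sk2 x) ?(sk3 x) ?jE ?gNr ?gZr ?opprK. Qed.

Let Nu0 : g xi xi * g u u != 0.
Proof. by rewrite mulf_neq0. Qed.

Lemma jself x : [/\ g (j1 x) x = 0, g (j2 x) x = 0 & g (j3 x) x = 0].
Proof. by split; rewrite gC ?self1 ?self2 ?self3. Qed.

Lemma R_Hxi_orth x y z : orth xi y -> orth xi z ->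
  g x y = 0 -> g (j1 x) z = 0 -> g (j2 x) z = 0 -> g (j3 x) z = 0 ->
  g x z = 0 ->
  R x y xi z = - (g xi xi * (g x xi * g y z + (z1 x - g x (j1 xi)) * g (j1 y) z
    + (z2 x + e * g x (j2 xi)) * g (j2 y) z + (z3 x + e * g x (j3 xi)) * g (j3 y) z)).
Proof.
move=> [h0 h1 h2 h3] zo _ k1 k2 k3 k0; rewrite R_xi_orth // h0 h1 h2 h3 k0 k1 k2 k3.
ring.
Qed.

Lemma R_xi_pair y z : orth xi y -> orth xi z -> R xi y xi z =
  - (g xi xi * (g xi xi * g y z + z1 xi * g (j1 y) z + z2 xi * g (j2 y) z + z3 xi * g (j3 y) z)).
Proof.
move=> yo zo; have [k0 k1 k2 k3] := orth_g zo; have [l0 _ _ _] := orth_g yo.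
by rewrite R_Hxi_orth // self1 self2 self3; ring.
Qed.

(** Pair symmetry makes $(y,z) \mapsto R(\xi,y,\xi,z)$ symmetric, while the $\zeta^a(\xi)$ enter it
    through the skew forms $g(J_ay,z)$. The pair $(J_au,u)$ isolates $\zeta^a(\xi)$. *)
Lemma zeta_xi : [/\ z1 xi = 0, z2 xi = 0 & z3 xi = 0].
Proof.
have [jo1 jo2 jo3] := orth_j uo; have [s1 s2 s3] := jself u; have [n1 n2 n3] := gJJ u.
have := Rp xi (j1 u) xi u; have := Rp xi (j2 u) xi u; have := Rp xi (j3 u) xi u.
rewrite !R_xi_pair // !(n1, n2, n3) s1 s2 s3 !(self1, self2, self3).
rewrite !(sk1, sk2, sk3) !jE !gNr !gZr !(self1, self2, self3) => E3 E2 E1.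
by split; apply: (mulfI Nu0); case: he E1 E2 E3 => -> E1 E2 E3; lra.
Qed.

(** At $x = \xi$ all terms without $\zeta$ cancel in pairs, and the $\zeta^a(\xi)$ are zero. *)
Lemma zeta_xi_str y : S xi y = 0.
Proof.
have [f1 f2 f3] := zeta_xi.
apply: gnd => w; rewrite g_lin_str f1 f2 f3 g0l (gC y) sk1 sk2 sk3.
by rewrite (gC y (j1 xi)) (gC y (j2 xi)) (gC y (j3 xi)) sk1 sk2 sk3; ring.
Qed.

(** Nine equations, one for each $\zeta^a(J_b\xi)$: exchanging the pairs and moving $J_b$ from $\xi$
    to [u] relates a component containing it to one in which only $\zeta^a(\xi) = 0$ could occur. *)
Lemma zeta_jxi :
  [/\ z1 (j1 xi) = 0, z2 (j1 xi) = 0 & z3 (j1 xi) = 0] /\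
  [/\ z1 (j2 xi) = 0, z2 (j2 xi) = 0 & z3 (j2 xi) = 0] /\
  [/\ z1 (j3 xi) = 0, z2 (j3 xi) = 0 & z3 (j3 xi) = 0].
Proof.
have [jo1 jo2 jo3] := orth_j uo; have [s1 s2 s3] := jself u; have [n1 n2 n3] := gJJ u.
have [f1 f2 f3] := zeta_xi.
(* At $w = J_au$ the left side is $N^2 g(J_au,J_bu)$, while on the right $\zeta^a(J_b\xi)$ is
   multiplied by the non-zero $N g(J_au,J_au)$. *)
have key w : orth xi w -> [/\ - R xi w xi (j1 u) = R (j1 xi) u xi w,
  - R xi w xi (j2 u) = R (j2 xi) u xi w & - R xi w xi (j3 u) = R (j3 xi) u xi w].
  by have [<- <- <-] := RQo xi w uo; split.
have og x : orth xi x -> [/\ g (j1 xi) x = 0, g (j2 xi) x = 0 & g (j3 xi) x = 0].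
  by case/orth_g.
have := And3 (key _ jo1) (key _ jo2) (key _ jo3).
have [k0 k1 k2 k3] := orth_g uo; have [a0 a1 a2 a3] := orth_g jo1.
have [b0 b1 b2 b3] := orth_g jo2; have [c0 c1 c2 c3] := orth_g jo3.
rewrite !R_xi_pair // !R_Hxi_orth // ?jE ?gNl ?gZl ?k0 ?k1 ?k2 ?k3 ?a0 ?a1 ?a2 ?a3 ?b0 ?b1 ?b2 ?b3 ?c0 ?c1 ?c2 ?c3 ?mulr0 ?oppr0 //.
rewrite f1 f2 f3 ?(sk1 xi, sk2 xi, sk3 xi) ?jE !gNr !gZr !(self1, self2, self3).
rewrite !(sk1, sk2, sk3) !jE !gNr !gZr !(self1, self2, self3).
move=> [[E1 E2 E3] [E4 E5 E6] [E7 E8 E9]].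
split; last split; split; apply: (mulfI Nu0);
  [move: (E1) | move: (E4) | move: (E7) | move: (E2) | move: (E5) | move: (E8)
  | move: (E3) | move: (E6) | move: (E9)] => {E1 E2 E3 E4 E5 E6 E7 E8 E9} E;
  by case: he E => -> E; lra.
Qed.

Lemma lin_str_lin x k y z : S x (k *: y + z) = k *: S x y + S x z.
Proof.
apply: gnd => w; rewrite gDl gZl !g_lin_str !(jlE, gE); ring.
Qed.

Lemma lin_str_linl k x y z : S (k *: x + y) z = k *: S x z + S y z.
Proof.
apply: gnd => w; rewrite gDl gZl !g_lin_str z1l z2l z3l !(jlE, gE); ring.
Qed.

(** Here $\zeta^a$ is evaluated at $S_y\xi$, which is $-Ny$ modulo $Q\xi$, where the $\zeta^a$
    already vanish; so $\zeta^a(S_y\xi) = -N\zeta^a(y)$. *)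
Lemma zeta_orth y : orth xi y -> [/\ z1 y = 0, z2 y = 0 & z3 y = 0].
Proof.
move=> yo; have [k0 k1 k2 k3] := orth_g yo; have [h0 h1 h2 h3] := yo.
have [f1 f2 f3] := zeta_xi.
have [[a1 a2 a3] [[b1 b2 b3] [c1 c2 c3]]] := zeta_jxi.
have [z1D z1Z z10 z1N] := linear_form_ops z1l.
have [z2D z2Z z20 z2N] := linear_form_ops z2l.
have [z3D z3Z z30 z3N] := linear_form_ops z3l.
pose zE := (z1D, z1Z, z1N, z2D, z2Z, z2N, z3D, z3Z, z3N).
have Sxixi : S xi xi = 0 by apply: zeta_xi_str.
have S0 : S y 0 = 0 by case: (linear_ops (lin_str_lin y)).
(* Since $S_\xi = 0$, the curvature formula collapses to $R_{\xi y}\xi = -S_{S_y\xi}\xi$; pair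
   symmetry then exchanges [b] and [y]. *)
have E b : - g (S (S y xi) xi) b = R xi b xi y.
  rewrite -Rp Rxi !gDl gNl zeta_xi_str g0l oppr0 add0r Sxixi S0 g0l zeta_xi_str.
  have [_ _ _ SN] := linear_ops (f := S^~ xi) (fun k x y => lin_str_linl k x y xi).
  by rewrite sub0r SN gNl add0r.
have Z1 : z1 (S y xi) = - (g xi xi * z1 y).
  by rewrite lin_str_xi !zE f1 a1 b1 c1 h0; ring.
have Z2 : z2 (S y xi) = - (g xi xi * z2 y).
  by rewrite lin_str_xi !zE f2 a2 b2 c2 h0; ring.
have Z3 : z3 (S y xi) = - (g xi xi * z3 y).
  by rewrite lin_str_xi !zE f3 a3 b3 c3 h0; ring.
(* At $b = J_a\xi$ the curvature side vanishes, as each of its terms pairs [y] with $H\xi$; the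
   other side is $3N^2\zeta^a(y)$ up to sign. *)
have := And3 (E (j1 xi)) (E (j2 xi)) (E (j3 xi)).
have [_ -> -> ->] := g_lin_str_xi_j (S y xi).
have [_ -> -> ->] := g_lin_str_xi_j y.
rewrite Z1 Z2 Z3 h1 h2 h3 !R_xi_orth //.
rewrite !jE !gNl !gZl ?k0 ?k1 ?k2 ?k3 f1 f2 f3 !(self1, self2, self3).
case=> E1 E2 E3.
have NN : g xi xi * g xi xi != 0 by rewrite mulf_neq0.
split; apply: (mulfI NN); [move: (E1) | move: (E2) | move: (E3)] => {E1 E2 E3 Z1 Z2 Z3} E;
  by case: he E => -> E; lra.
Qed.

Lemma zeta0 y : [/\ z1 y = 0, z2 y = 0 & z3 y = 0].
Proof.
have [f1 f2 f3] := zeta_xi.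
have [[a1 a2 a3] [[b1 b2 b3] [c1 c2 c3]]] := zeta_jxi.
by split; move: y; apply: (orth_decomp N0) => // y /zeta_orth [].
Qed.

Lemma R_xi x y z : R x y xi z = - (g xi xi * R0 x y xi z).
Proof.
have [f1 f2 f3] := zeta0 x; have [k1 k2 k3] := zeta0 y.
rewrite Rxi !gDl gNl.
rewrite (lin_str_skew _ (S y xi)) (lin_str_skew _ (S x xi)).
rewrite !g_lin_str_xi.
have zd a b : [/\ z1 (a - b) = 0, z2 (a - b) = 0 & z3 (a - b) = 0] by apply: zeta0.
have [-> -> ->] := zd (S x y) (S y x).
rewrite !(gDl (S x y)) !gNl !(gC _ (S _ _)) !g_lin_str f1 f2 f3 k1 k2 k3 !mul0r.
rewrite /R0 !(sk1, sk2, sk3) ?jE ?gNr ?gZr ?(self1 xi, self2 xi, self3 xi).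
have c1 a b : g a (j1 b) = - g b (j1 a) by rewrite gC sk1.
have c2 a b : g a (j2 b) = - g b (j2 a) by rewrite gC sk2.
have c3 a b : g a (j3 b) = - g b (j3 a) by rewrite gC sk3.
rewrite !(gC xi x, gC xi y, gC xi z, gC y x, c1 xi x, c1 xi y, c1 xi z, c1 y x,
  c2 xi x, c2 xi y, c2 xi z, c2 y x, c3 xi x, c3 xi y, c3 xi z, c3 y x).
by case: he => ->; ring.
Qed.

End ZetaVanishes.

(** * Curvature tensors annihilating xi (the tensor D, here called R) *)

Section Flat.
Hypothesis R_xi0 : forall x y z, R x y xi z = 0.
Variable S : V -> V -> V.
Hypothesis SE : forall x y, S x y = lin_str xi (fun=> 0) (fun=> 0) (fun=> 0) x y.
(* Minus the derivation S_w applied to the (0,4)-tensor R. *)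
Definition deriv_curv w x y z t := R (S w x) y z t + R x (S w y) z t + R x y (S w z) t + R x y z (S w t).
Hypothesis R_bianchi2 : forall w x y z t,
  deriv_curv w x y z t + deriv_curv x y w z t + deriv_curv y w x z t = 0.

Lemma R2l x k y z w t : R x (k *: y + z) w t = k * R x y w t + R x z w t.
Proof. by rewrite R12 Rl (R12 x y) (R12 x z); ring. Qed.
Lemma R3l x y k z w t : R x y (k *: z + w) t = k * R x y z t + R x y w t.
Proof. by rewrite Rp Rl (Rp x y z) (Rp x y w). Qed.
Lemma R4l x y z k w t : R x y z (k *: w + t) = k * R x y z w + R x y z t.
Proof. by rewrite R34 R3l (R34 x y z) (R34 x y z t); ring. Qed.

Definition imH (b : V) := [\/ b = j1 xi, b = j2 xi | b = j3 xi].

Lemma imH_decomp (f : V -> F) : (forall k x y, f (k *: x + y) = k * f x + f y) ->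
  f xi = 0 -> (forall b, imH b -> f b = 0) -> (forall y, orth xi y -> f y = 0) ->
  forall y, f y = 0.
Proof.
move=> fl f0 fb fo; apply: (orth_decomp N0) => //; apply: fb;
  by [constructor 1 | constructor 2 | constructor 3].
Qed.

Lemma R_orth_im x y b z : imH b -> orth xi z -> R x y b z = 0.
Proof.
move=> ib zo; have [h1 h2 h3] := RQo x y zo.
by case: ib => ->; rewrite ?h1 ?h2 ?h3 R_xi0 oppr0.
Qed.

(** For [w] in $H\xi$ the preceding facts suffice. For [w] orthogonal to it, the first Bianchi
    identity moves [b] or [c] to the third slot, where [R_orth_im] applies. *)
Lemma R_im_im_orth b c z w : imH b -> imH c -> orth xi z -> R b c z w = 0.
Proof.
move=> ib ic zo; move: w; apply: imH_decomp.
- by move=> k x y; rewrite R4l.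
- by rewrite R34 R_xi0 oppr0.
- by move=> d id; rewrite R34 R_orth_im ?oppr0.
- move=> w wo; have := RB b c z w.
  by rewrite (R_orth_im c z ib wo) (R_orth_im z b ic wo) !addr0.
Qed.

(** $R_{bc}$ kills the orthogonal of $H\xi$, hence so does $[R_{bc},J]$. An element of $Q$ killing
    the non-null vector [u] is zero because the $J_au$ are pairwise orthogonal and non-null. *)
Lemma normalizes0 j b c : normalizes R j -> (forall x, orth xi x -> orth xi (j x)) ->
  imH b -> imH c -> forall z w, R b c (j z) w + R b c z (j w) = 0.
Proof.
move=> /(_ b c) [m1 [m2 [m3 h]]] jo ib ic z w; rewrite h.
have [jo1 jo2 jo3] := orth_j uo; have [n1 n2 n3] := gJJ u.
have E v : m1 * g (j1 u) v + m2 * g (j2 u) v + m3 * g (j3 u) v = 0.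
  by rewrite -h (R_im_im_orth _ ib ic (jo _ uo)) (R_im_im_orth _ ib ic uo) addr0.
have [s1 s2 s3] : [/\ g (j2 u) (j1 u) = 0, g (j3 u) (j1 u) = 0 & g (j3 u) (j2 u) = 0].
  by split; rewrite ?sk2 ?sk3 !jE ?gNr ?gZr ?self1 ?self2 ?self3 ?mulr0 ?oppr0.
have := And3 (E (j1 u)) (E (j2 u)) (E (j3 u)).
rewrite (gC (j1 u) (j2 u)) (gC (j1 u) (j3 u)) (gC (j2 u) (j3 u)) n1 n2 n3 s1 s2 s3.
have e0 : e != 0 by case: he => ->; rewrite ?oppr_eq0 oner_eq0.
rewrite !mulr0 !addr0 !add0r !mulrN; case=> /eqP + /eqP + /eqP.
rewrite !oppr_eq0 !mulf_eq0 (negPf u0) (negPf e0) !orbF => /eqP-> /eqP-> /eqP->.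
by rewrite !mul0r !addr0.
Qed.

(** $R_{bc}$ now commutes with the $J_a$, so $R_{bc}J_a\xi = J_aR_{bc}\xi = 0$. *)
Lemma R_im_im b c d w : imH b -> imH c -> imH d -> R b c d w = 0.
Proof.
move=> ib ic id; have oj x : orth xi x -> _ := @orth_j xi x.
have h1 := normalizes0 RQ1 (fun x xo => let: And3 a _ _ := oj x xo in a) ib ic xi w.
have h2 := normalizes0 RQ2 (fun x xo => let: And3 _ a _ := oj x xo in a) ib ic xi w.
have h3 := normalizes0 RQ3 (fun x xo => let: And3 _ _ a := oj x xo in a) ib ic xi w.
by move: h1 h2 h3; rewrite !R_xi0 !addr0 => h1 h2 h3; case: id => ->.
Qed.

Lemma R_xi1 y z w : R xi y z w = 0.
Proof. by rewrite Rp R_xi0. Qed.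

Lemma R_im b y z w : imH b -> R b y z w = 0.
Proof.
move=> ib; move: y; apply: imH_decomp.
- by move=> k x y; rewrite R2l.
- by rewrite R12 R_xi1 oppr0.
- move=> c ic; move: z; apply: imH_decomp.
  + by move=> k x y; rewrite R3l.
  + by rewrite R_xi0.
  + by move=> d id; rewrite R_im_im.
  + by move=> z zo; rewrite R_im_im_orth.
- by move=> y yo; rewrite Rp R_orth_im.
Qed.

Lemma curvature_eq0 x y z t : R x y z t = 0.
Proof.
have S0 v : S xi v = 0.
  apply: gnd => w; rewrite (g_lin_str SE) g0l (gC v xi) (gC v (j1 xi)) (gC v (j2 xi)) (gC v (j3 xi)).
  by rewrite sk1 sk2 sk3; ring.
(* $S_v\xi$ equals $-Nv$ modulo $H\xi$, on which [R] vanishes. *)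
have Sxi v a b c : R (S v xi) a b c = - (g xi xi * R v a b c).
  have [RD RZ _ RN] := linear_form_ops (fun k x y => Rl k x y a b c).
  have [i1 i2 i3] : [/\ imH (j1 xi), imH (j2 xi) & imH (j3 xi)].
    by split; [constructor 1 | constructor 2 | constructor 3].
  rewrite (lin_str_xi SE) !RD RN !RZ R_xi1 (R_im _ _ _ i1) (R_im _ _ _ i2) (R_im _ _ _ i3).
  ring.
have R0 a b c : R 0 a b c = 0.
  by have [_ _ -> _] := linear_form_ops (fun k x y => Rl k x y a b c).
have Rx2 a b c : R a xi b c = 0 by rewrite R12 R_xi1 oppr0.
(* The first cyclic term vanishes with $S_\xi$. In the other two, every term keeping $\xi$ as an
   argument is zero, and the terms in $S_x\xi$ and $S_y\xi$ contribute $N R(x,y,z,t)$ each. *)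
have := R_bianchi2 xi x y z t.
have R03 a b c : R a b 0 c = 0 by rewrite Rp R0.
have R04 a b c : R a b c 0 = 0 by rewrite R34 R03 oppr0.
have R02 a b c : R a 0 b c = 0 by rewrite R12 R0 oppr0.
have Sxi2 v a b c : R a (S v xi) b c = g xi xi * R v a b c by rewrite R12 Sxi opprK.
rewrite /deriv_curv !S0 !R0 R02 R03 R04 !R_xi1 !Rx2 Sxi Sxi2 (R12 y x) => E.
by apply: (mulfI N0); move: E; lra.
Qed.
End Flat.
End CurvatureAlgebra.

(** * Pointwise conclusion: reduced form of S and curvature *)

Section LinearStructure.
Variables (xi u : V) (R : V -> V -> V -> V -> F).
Hypothesis N0 : g xi xi != 0.
Hypothesis uo : orth xi u.
Hypothesis u0 : g u u != 0.
Hypothesis HR : quaternionic_curvature R.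
Let Rl := qc_Rl HR.
Let R12 := qc_R12 HR.
Let R34 := qc_R34 HR.
Let Rp := qc_Rp HR.
Let RB := qc_RB HR.
Let RQ1 := qc_RQ1 HR.
Let RQ2 := qc_RQ2 HR.
Let RQ3 := qc_RQ3 HR.
Variables (z1 z2 z3 : V -> F) (S : V -> V -> V).
Hypothesis z1l : forall k x y, z1 (k *: x + y) = k * z1 x + z1 y.
Hypothesis z2l : forall k x y, z2 (k *: x + y) = k * z2 x + z2 y.
Hypothesis z3l : forall k x y, z3 (k *: x + y) = k * z3 x + z3 y.
Hypothesis SE : forall x y, S x y = lin_str xi z1 z2 z3 x y.
Hypothesis Rxi : forall x y z,
  R x y xi z = g (- S x (S y xi) + S y (S x xi) + S (S x y - S y x) xi) z.
Hypothesis R_bianchi2 : forall w x y z t,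
  deriv_curv R S w x y z t + deriv_curv R S x y w z t + deriv_curv R S y w x z t = 0.

Lemma normalizesD (R' : V -> V -> V -> V -> F) k j : normalizes R j -> normalizes R' j ->
  normalizes (fun x y z w => R x y z w + k * R' x y z w) j.
Proof.
move=> h h' x y; have [m1 [m2 [m3 h1]]] := h x y; have [n1 [n2 [n3 h2]]] := h' x y.
exists (m1 + k * n1), (m2 + k * n2), (m3 + k * n3) => z w.
have -> : R x y (j z) w + k * R' x y (j z) w + (R x y z (j w) + k * R' x y z (j w))
  = R x y (j z) w + R x y z (j w) + k * (R' x y (j z) w + R' x y z (j w)) by ring.
by rewrite h1 h2; ring.
Qed.

Lemma zeta_vanishes y : [/\ z1 y = 0, z2 y = 0 & z3 y = 0].
Proof. exact: (zeta0 N0 uo u0 HR z1l z2l z3l SE Rxi). Qed.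

Lemma lin_strE x y : S x y = lin_str xi (fun=> 0) (fun=> 0) (fun=> 0) x y.
Proof. by have [h1 h2 h3] := zeta_vanishes x; rewrite SE /lin_str h1 h2 h3. Qed.

Lemma lin_str_comm w x :
  [/\ S w (j1 x) = j1 (S w x), S w (j2 x) = j2 (S w x) & S w (j3 x) = j3 (S w x)].
Proof.
have c1 a b : g a (j1 b) = - g b (j1 a) by rewrite gC sk1.
have c2 a b : g a (j2 b) = - g b (j2 a) by rewrite gC sk2.
have c3 a b : g a (j3 b) = - g b (j3 a) by rewrite gC sk3.
split; apply: gnd => t; rewrite ?sk1 ?sk2 ?sk3 !(g_lin_str lin_strE) ?(sk1, sk2, sk3) ?jE ?gNr ?gZr;
  case: he => ->; ring.
Qed.

(** $R + N R^0$ inherits the curvature symmetries from both summands. It inherits the cyclic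
    identity too: once the $\zeta^a$ are gone, each $S_a$ is skew and commutes with $Q$, so it
    annihilates $R^0$. *)
Lemma curvature_lin_str x y z w : R x y z w = - (g xi xi * R0 x y z w).
Proof.
have [Q1 Q2 Q3] := R0_normalizes.
apply/eqP; rewrite -addr_eq0; apply/eqP.
have skS a : forall b c, g (S a b) c = - g b (S a c) by apply: (lin_str_skew SE).
have inv a b c d t : deriv_curv R0 S a b c d t = 0.
  by apply: R0_invariant => // v; case: (lin_str_comm a v).
have HD : quaternionic_curvature (fun x y z w => R x y z w + g xi xi * R0 x y z w).
  split; try exact: normalizesD.
  - by move=> k a b c d t; rewrite Rl R0l; ring.
  - by move=> a b c d; rewrite R12 R0_12; ring.
  - by move=> a b c d; rewrite R34 R0_34; ring.
  - by move=> a b c d; rewrite Rp R0p.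
  - move=> a b c d; have h1 := R0B a b c d; have h2 := RB a b c d.
    transitivity (R a b c d + R b c a d + R c a b d
      + g xi xi * (R0 a b c d + R0 b c a d + R0 c a b d)); first by ring.
    by rewrite h1 h2 mulr0 addr0.
apply: (curvature_eq0 N0 uo u0 HD _ lin_strE).
- move=> a b c; rewrite (R_xi N0 uo u0 HR z1l z2l z3l SE Rxi); ring.
- move=> a b c d t; rewrite -[RHS](R_bianchi2 a b c d t).
  transitivity (deriv_curv R S a b c d t + deriv_curv R S b c a d t + deriv_curv R S c a b d t
    + g xi xi * (deriv_curv R0 S a b c d t + deriv_curv R0 S b c a d t + deriv_curv R0 S c a b d t)).
    by rewrite /deriv_curv; ring.
  by rewrite !inv !addr0 mulr0 addr0.
Qed.
End LinearStructure.

(** * Non-null vectors in indefinite signature *)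

Section NonNull.

Lemma polarize x y : g x x = 0 -> g y y = 0 -> g (x + y) (x + y) = 0 -> g x y = 0.
Proof. by rewrite !gDl !gDr (gC y x) => -> -> h; lra. Qed.

Lemma exists_nonnull (P : V -> Prop) : (forall x y, P x -> P y -> P (x + y)) ->
  (exists x y, [/\ P x, P y & g x y != 0]) -> exists2 u, P u & g u u != 0.
Proof.
move=> PD [x [y [Px Py xy]]].
case: (eqVneq (g x x) 0) => [x0|]; last by exists x.
case: (eqVneq (g y y) 0) => [y0|]; last by exists y.
case: (eqVneq (g (x + y) (x + y)) 0) => [z0|]; last by exists (x + y) => //; apply: PD.
by rewrite polarize ?eqxx in xy.
Qed.

Lemma orthD xi x y : orth xi x -> orth xi y -> orth xi (x + y).
Proof.
by move=> [a0 a1 a2 a3] [b0 b1 b2 b3]; split; rewrite gDl ?a0 ?a1 ?a2 ?a3 ?b0 ?b1 ?b2 ?b3 addr0.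
Qed.

Lemma orth_sym x y : orth x y -> orth y x.
Proof.
case=> h0 h1 h2 h3; split; rewrite gC //; first by rewrite sk1 h1 oppr0.
- by rewrite sk2 h2 oppr0.
- by rewrite sk3 h3 oppr0.
Qed.

(** The orthogonal of $H\xi$ is non-degenerate because $N \neq 0$, so [w] has a non-zero product
    with some vector in it; by polarization one of the two or their sum is non-null. *)
Lemma exists_orth_nonnull xi w : g xi xi != 0 -> w <> 0 -> orth xi w ->
  exists2 u, orth xi u & g u u != 0.
Proof.
move=> N0 w0 wo; apply: exists_nonnull; first exact: orthD.
apply: contrapT => h; apply: w0; apply: gnd => z; rewrite g0l.
have [h0 h1 h2 h3] := wo.
move: z; apply: (orth_decomp N0) => // [k x y|y yo]; first by rewrite gDr gZr.
by apply/eqP; apply: contrapT => /negP wy; apply: h; exists w, y.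
Qed.

(** Two choices of [z] suffice: $z = x'$ reaches all of $Hx$, and $z = x$ reaches its orthogonal. *)
Lemma test_vector_zero x x' v : g x x != 0 -> orth x x' -> g x' x' != 0 ->
  (forall z y, g z z != 0 -> orth z y -> g y v = 0) -> v = 0.
Proof.
move=> x0 xo x'0 h; apply: gnd => z; rewrite g0l gC.
have [jo1 jo2 jo3] := orth_j (orth_sym xo).
move: z; apply: (orth_decomp x0) => [k a b|||||y yo].
- by rewrite gDl gZl.
- exact: h (orth_sym xo).
- exact: h jo1.
- exact: h jo2.
- exact: h jo3.
- exact: h yo.
Qed.
End NonNull.

(** Only the term $\sum_b \zeta^b(w)J_b$ of $S_w$ fails to commute with the $J_a$, and
    anticommutation produces the factor 2. *)
Lemma lin_str_commutator xi z1 z2 z3 (S : V -> V -> V)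
  (SE : forall x y, S x y = lin_str xi z1 z2 z3 x y) w x :
  [/\ S w (j1 x) - j1 (S w x) = (- 2 * z2 w) *: j3 x + (2 * z3 w) *: j2 x,
      S w (j2 x) - j2 (S w x) = (2 * z1 w) *: j3 x + (2 * e * z3 w) *: j1 x
    & S w (j3 x) - j3 (S w x) = (- 2 * z1 w) *: j2 x + (- 2 * e * z2 w) *: j1 x].
Proof.
have c1 a b : g a (j1 b) = - g b (j1 a) by rewrite gC sk1.
have c2 a b : g a (j2 b) = - g b (j2 a) by rewrite gC sk2.
have c3 a b : g a (j3 b) = - g b (j3 a) by rewrite gC sk3.
split; apply: gnd => t; rewrite !(gDl, gNl, gZl) ?sk1 ?sk2 ?sk3 !(g_lin_str SE) ?(sk1, sk2, sk3) ?jE ?gNr ?gZr;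
  case: he => ->; ring.
Qed.

End LinearTypeAlgebra.

(** * Directional derivatives and smooth functions *)

Section DirectionalDerivatives.
Context {R : realType} {V : normedModType R}.
Implicit Types (f : V -> R) (a b x y : V) (D : set V).

Lemma is_derive_line f y b (t : R) : derivable f (y + t *: b) b ->
  is_derive t 1 (fun s : R => f (y + s *: b)) ('D_b f (y + t *: b)).
Proof.
move=> df.
have E : (fun h : R => h^-1 *: (f (y + (h *: (1 : R) + t) *: b) - f (y + t *: b)))
   = (fun h : R => h^-1 *: (f (h *: b + (y + t *: b)) - f (y + t *: b))).
  apply/funext => h; congr (_ *: (f _ - _)).
  by rewrite scalerDl /= [h *: 1]mulr1 addrCA.
by split; [rewrite /derivable E | rewrite /derive E].
Qed.

Lemma MVT_dir f y b (h : R) :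
  (forall s : R, `|s| <= `|h| -> derivable f (y + s *: b) b) ->
  exists2 s : R, `|s| <= `|h| & f (y + h *: b) - f y = h * 'D_b f (y + s *: b).
Proof.
move=> df; pose F (s : R) := f (y + s *: b).
have dF (s : R) : `|s| <= `|h| -> is_derive s 1 F ('D_b f (y + s *: b)).
  by move=> sh; apply: is_derive_line; apply: df.
have cF (u v : R) : (forall s : R, s \in `[u, v] -> `|s| <= `|h|) -> {within `[u, v], continuous F}.
  move=> uv; apply: derivable_within_continuous => s /uv sh.
  by have [] := dF _ sh.
have F0 : f y = F 0 by rewrite /F scale0r addr0.
have [h0|h0] := leP 0 h.
  have hs (s : R) : s \in `[0, h] -> `|s| <= `|h|.
    by rewrite in_itv /= => /andP[s0 sh]; rewrite !ger0_norm.
  have [|s sh E] := MVT_segment h0 _ (cF _ _ hs) (df := fun s => 'D_b f (y + s *: b)).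
    by move=> s sh; apply: dF; apply: hs; apply: subset_itv_oo_cc sh.
  by exists s; [exact: hs | rewrite F0 -/(F h) E subr0 mulrC].
have hs (s : R) : s \in `[h, 0] -> `|s| <= `|h|.
  by rewrite in_itv /= => /andP[s0 sh]; rewrite !ler0_norm ?lerN2 // ltW.
have [|s sh E] := MVT_segment (ltW h0) _ (cF _ _ hs) (df := fun s => 'D_b f (y + s *: b)).
  by move=> s sh; apply: dF; apply: hs; apply: subset_itv_oo_cc sh.
by exists s; [exact: hs | rewrite F0 -/(F h) -opprB E sub0r mulrN opprK mulrC].
Qed.

Lemma derive_shift f c a x :
  (derivable (fun z => f (z + c)) x a <-> derivable f (x + c) a) /\
  'D_a (fun z => f (z + c)) x = 'D_a f (x + c).
Proof.
have E : (fun h : R => h^-1 *: (f (h *: a + x + c) - f (x + c)))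
   = (fun h : R => h^-1 *: (f (h *: a + (x + c)) - f (x + c))).
  by apply/funext => h; rewrite addrA.
by split; [rewrite /derivable E | rewrite /derive E].
Qed.

Lemma ball_dir x a b (d : R) : 0 < d -> exists2 r : R, 0 < r &
  forall s t : R, `|s| <= r -> `|t| <= r -> ball x d (x + s *: a + t *: b).
Proof.
move=> d0; pose K := `|a| + `|b| + 1.
have na := normr_ge0 a; have nb := normr_ge0 b.
have K0 : 0 < K by rewrite /K; lra.
exists (d / K / 2); first by rewrite !divr_gt0.
move=> s t sr tr; rewrite -ball_normE /ball_ /= -addrA opprD addrA subrr sub0r normrN.
apply: le_lt_trans (ler_normD _ _) _; rewrite !normrZ.
have E : d / K / 2 * K = d / 2 by field; rewrite gt_eqF.
have := ler_wpM2r na sr; have := ler_wpM2r nb tr.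
by move: E; rewrite /K; set r := _ / 2; nra.
Qed.

(** Directional derivatives need not be additive in the direction. Here the increment along $b$,
    taken from $x + ha$, is $h$ times a value of $D_bf$ near $x$ by the mean value theorem, and
    $D_bf$ is continuous at $x$. *)
Lemma is_deriveD_dir D f a b x : open D -> D x ->
  (forall y, D y -> derivable f y b) -> derivable f x a ->
  {for x, continuous (fun y => 'D_b f y)} ->
  is_derive x (a + b) f ('D_a f x + 'D_b f x).
Proof.
move=> oD Dx db da cb.
suff H : (fun h : R => h^-1 *: (f (h *: (a + b) + x) - f x)) @ 0^' --> 'D_a f x + 'D_b f x.
  by split; [apply/cvg_ex; exists ('D_a f x + 'D_b f x) | apply: cvg_lim].
apply/cvgrPdist_le => e e0.
have e2 : 0 < e / 2 by rewrite divr_gt0.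
have /cvgrPdist_le/(_ _ e2) Ha : (fun h : R => h^-1 *: (f (h *: a + x) - f x)) @ 0^' --> 'D_a f x.
  by [].
move/cvgrPdist_le : cb => /(_ _ e2) cb.
have /nbhs_ballP[d /= d0 Hd] : \forall y \near x, D y /\ `|'D_b f x - 'D_b f y| <= e / 2.
  by near=> y; split; near: y => //; exact: open_nbhs_nbhs.
have [r r0 Hr] := ball_dir x a b d0.
near=> h.
have hr : `|h| <= r by near: h; apply: dnbhs0_le.
have h0 : h != 0 by near: h; exact: nbhs_dnbhs_neq.
have inb s : `|s| <= `|h| -> ball x d (x + h *: a + s *: b).
  by move=> sh; apply: Hr => //; apply: le_trans hr.
have [|s sh E] := @MVT_dir f (x + h *: a) b h.
  by move=> s sh; apply: db; have [] := Hd _ (inb _ sh).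
have -> : f (h *: (a + b) + x) - f x
  = (f (h *: a + x) - f x) + h * 'D_b f (x + h *: a + s *: b).
  rewrite -E scalerDr (addrC (h *: a + h *: b)) addrA (addrC (h *: a)); ring.
rewrite scalerDr opprD addrACA (le_trans (ler_normD _ _)) // (splitr e) lerD //.
  by near: h.
rewrite [_ *: (h * _)]mulrA mulVf // mul1r.
by have [] := Hd _ (inb _ sh).
Unshelve. all: by end_near. Qed.

Lemma deriveZ_dir f (k : R) a x : derivable f x a ->
  is_derive x (k *: a) f (k * 'D_a f x).
Proof.
move=> da; have [->|k0] := eqVneq k 0.
  rewrite scale0r mul0r.
  have E : (fun h : R => h^-1 *: (f (h *: (0 : V) + x) - f x)) = cst 0.
    by apply/funext => h; rewrite scaler0 add0r subrr scaler0.
  by split; [rewrite /derivable E; apply: is_cvg_cst | rewrite /derive E lim_cst].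
suff H : (fun h : R => h^-1 *: (f (h *: (k *: a) + x) - f x)) @ 0^' --> k * 'D_a f x.
  by split; [apply/cvg_ex; exists (k * 'D_a f x) | apply: cvg_lim].
have E : (fun h : R => h^-1 *: (f (h *: (k *: a) + x) - f x))
   = (fun h : R => k *: (fun h : R => h^-1 *: (f (h *: a + x) - f x)) (k * h)).
  apply/funext => h /=; rewrite scalerA (mulrC h) !scalerA.
  by rewrite invfM mulrA mulfV // mul1r.
rewrite E; apply/cvgrPdist_le => e e0.
have k0' : 0 < `|k| by rewrite normr_gt0.
have /cvgrPdist_le/(_ (e / `|k|)) : (fun h : R => h^-1 *: (f (h *: a + x) - f x)) @ 0^' --> 'D_a f x.
  by [].
rewrite divr_gt0 // => /(_ isT)[d /= d0 Hd].
near=> h.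
have hd : `|h| < d / `|k| by near: h; apply: dnbhs0_lt; rewrite divr_gt0.
have h0 : h != 0 by near: h; exact: nbhs_dnbhs_neq.
rewrite -[k *: _]/(k * _) -mulrBr normrM mulrC -ler_pdivlMr //; apply: Hd => /=.
  by rewrite sub0r normrN normrM mulrC -ltr_pdivlMr.
by rewrite mulf_neq0.
Unshelve. all: by end_near. Qed.

Lemma Schwarz D f a b x : open D -> D x ->
  (forall y, D y -> derivable f y a) -> (forall y, D y -> derivable f y b) ->
  (forall y, D y -> derivable ('D_a f) y b) -> (forall y, D y -> derivable ('D_b f) y a) ->
  {for x, continuous (fun y => 'D_b ('D_a f) y)} ->
  {for x, continuous (fun y => 'D_a ('D_b f) y)} ->
  'D_b ('D_a f) x = 'D_a ('D_b f) x.
Proof.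
move=> oD Dx da db dab dba cab cba.
apply/eqP; rewrite -subr_eq0 -normr_le0; apply/ler_addgt0Pl => e e0; rewrite addr0.
have e2 : 0 < e / 2 by rewrite divr_gt0.
have {}cab : \forall y \near x, `|'D_b ('D_a f) x - 'D_b ('D_a f) y| <= e / 2.
  by move/cvgrPdist_le : cab; apply.
have {}cba : \forall y \near x, `|'D_a ('D_b f) x - 'D_a ('D_b f) y| <= e / 2.
  by move/cvgrPdist_le : cba; apply.
have oDx := open_nbhs_nbhs (conj oD Dx).
have /nbhs_ballP[d /= d0 Hd] : \forall y \near x, [/\ D y,
    `|'D_b ('D_a f) x - 'D_b ('D_a f) y| <= e / 2 & `|'D_a ('D_b f) x - 'D_a ('D_b f) y| <= e / 2].
  by apply: filterS3 oDx cab cba => y.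
have [h h0 Hr] := ball_dir x a b d0.
have inb s t : `|s| <= `|h| -> `|t| <= `|h| -> ball x d (x + s *: a + t *: b).
  by rewrite (gtr0_norm h0); apply: Hr.
have hh : `|h| <= `|h| by [].
have zh : `|0 : R| <= `|h| by rewrite normr0.
(* Both iterated derivatives are limits of the same second difference. *)
have key p q : (forall y, D y -> derivable f y p) -> (forall y, D y -> derivable ('D_p f) y q) ->
  (forall s t, `|s| <= `|h| -> `|t| <= `|h| -> ball x d (x + s *: p + t *: q)) ->
  exists2 z, ball x d z & f (x + h *: p + h *: q) - f (x + h *: p) - (f (x + h *: q) - f x)
    = h * h * 'D_q ('D_p f) z.
  move=> dp dq ib; pose F z := f (z + h *: q) - f z.
  have dF s : `|s| <= `|h| -> derivable F (x + s *: p) p /\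
     'D_p F (x + s *: p) = 'D_p f (x + s *: p + h *: q) - 'D_p f (x + s *: p).
    move=> sh; have [E1 E2] := derive_shift f (h *: q) p (x + s *: p).
    have d1 : derivable (fun z => f (z + h *: q)) (x + s *: p) p.
      by apply/E1; apply: dp; have [] := Hd _ (ib _ _ sh hh).
    have d2 : derivable f (x + s *: p) p.
      by apply: dp; have := Hd _ (ib _ _ sh zh); rewrite scale0r addr0 => -[].
    have -> : F = (fun z => f (z + h *: q)) - f by [].
    by split; [exact: derivableB d1 d2 | rewrite -E2; exact: deriveB d1 d2].
  have [|s sh E] := @MVT_dir F x p h; first by move=> s /dF[].
  have [|t th E2] := @MVT_dir ('D_p f) (x + s *: p) q h.
    by move=> t th; apply: dq; have [] := Hd _ (ib _ _ sh th).
  exists (x + s *: p + t *: q); first exact: ib.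
  have := E; have [_ ->] := dF _ sh; rewrite E2 /F => ->; ring.
have [z /Hd[_ z1 _] Ez] := key a b da dab inb.
have [|w /Hd[_ _ w1] Ew] := key b a db dba.
  by move=> s t sh th; rewrite -addrA (addrC (s *: b)) addrA; apply: inb.
have E0 : f (x + h *: a + h *: b) - f (x + h *: a) - (f (x + h *: b) - f x)
        = f (x + h *: b + h *: a) - f (x + h *: b) - (f (x + h *: a) - f x).
  rewrite [x + h *: b + h *: a]addrAC.
  move: (f _) (f _) (f _) (f _) => A B C E; ring.
have hh0 : h * h != 0 by rewrite mulf_neq0 // gt_eqF.
have Ezw := mulfI hh0 (etrans (esym Ez) (etrans E0 Ew)).
rewrite Ezw in z1.
have -> : e = e / 2 + e / 2 by exact: splitr.
apply: le_trans (ler_distD ('D_a ('D_b f) w) _ _) _.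
by apply: lerD; [exact: z1 | rewrite distrC; exact: w1].
Unshelve. all: by end_near. Qed.

End DirectionalDerivatives.

(** * Stability of C^k functions under algebraic operations *)

Section SmoothFunctions.
Context {R : realType} {m : nat}.
Notation V := 'cV[R]_m.
Variable D : set V.
Hypothesis oD : open D.

Lemma near_open (P : V -> Prop) x : (forall y, D y -> P y) -> D x -> \near x, P x.
Proof.
by move=> DP Dx; apply: filterS DP _; apply: open_nbhs_nbhs.
Qed.

Lemma Ck_ext {W : normedModType R} k (f h : V -> W) :
  (forall x, D x -> f x = h x) -> Ck k D f -> Ck k D h.
Proof.
elim: k f h => [|k IH] f h fh [cf df]; split=> //.
- move=> x Dx; have nfh : \near x, f x = h x by apply: near_open.
  rewrite /prop_for /continuous_at -(fh _ Dx); apply: cvg_trans (cf _ Dx).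
  exact: near_eq_cvg nfh.
- move=> x Dx; have nfh : \near x, f x = h x by apply: near_open.
  rewrite /prop_for /continuous_at -(fh _ Dx); apply: cvg_trans (cf _ Dx).
  exact: near_eq_cvg nfh.
move=> i; have [d1 d2] := df i; split.
  by move=> x Dx; apply: near_eq_derivable (d1 _ Dx); apply: near_open.
apply: IH d2 => x Dx; apply: near_eq_derive; exact: near_open.
Qed.

Lemma CkW {W : normedModType R} k (f : V -> W) : Ck k.+1 D f -> Ck k D f.
Proof.
elim: k f => [|k IH] f [cf df]; split=> // i.
by have [d1 d2] := df i; split=> //; apply: IH.
Qed.

Lemma Ck_cst {W : normedModType R} k (c : W) : Ck k D (fun=> c).
Proof.
elim: k c => [|k IH] c; split=> //; try by move=> x _; exact: (@cst_continuous _ _ c).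
move=> i; split; first by move=> x _; exact: (@derivable_cst _ _ _ c x).
have E x : D x -> (0 : W) = 'D_(ebase i) (fun=> c) x by move=> _; exact: (esym (@derive_cst _ _ _ c x (ebase i))).
exact: Ck_ext E (IH 0).
Qed.

Lemma CkD {W : normedModType R} k (f h : V -> W) :
  Ck k D f -> Ck k D h -> Ck k D (fun x => f x + h x).
Proof.
elim: k f h => [|k IH] f h [cf df] [ch dh]; split=> //.
- by move=> x Dx; exact: (continuousD (cf x Dx) (ch x Dx)).
- by move=> x Dx; exact: (continuousD (cf x Dx) (ch x Dx)).
move=> i; have [d1 d2] := df i; have [e1 e2] := dh i; split.
  by move=> x Dx; apply: derivableD; [exact: d1 | exact: e1].
apply: (Ck_ext _ (IH _ _ d2 e2)) => x Dx.
by rewrite (deriveD (d1 _ Dx) (e1 _ Dx)).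
Qed.

Lemma CkM k (f h : V -> R) : Ck k D f -> Ck k D h -> Ck k D (fun x => f x * h x).
Proof.
elim: k f h => [|k IH] f h.
  by move=> [cf _] [ch _]; split=> // x Dx; exact: (continuousM (cf x Dx) (ch x Dx)).
move=> kf kh; have wf := CkW kf; have wh := CkW kh; case: kf kh => [cf df] [ch dh].
split; first by move=> x Dx; exact: (continuousM (cf x Dx) (ch x Dx)).
move=> i; have [d1 d2] := df i; have [e1 e2] := dh i; split.
  by move=> x Dx; apply: derivableM; [exact: d1 | exact: e1].
apply: (Ck_ext _ (CkD (IH _ _ wf e2) (IH _ _ wh d2))) => x Dx.
by rewrite (deriveM (d1 _ Dx) (e1 _ Dx)).
Qed.

Lemma CkV k (f : V -> R) : (forall x, D x -> f x != 0) -> Ck k D f ->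
  Ck k D (fun x => (f x)^-1).
Proof.
move=> f0; elim: k => [|k IH].
  by move=> [cf _]; split=> // x Dx; exact: (continuousV (f0 x Dx) (cf x Dx)).
move=> kf; have wf := IH (CkW kf); case: kf => [cf df].
split; first by move=> x Dx; exact: (continuousV (f0 x Dx) (cf x Dx)).
move=> i; have [d1 d2] := df i; split.
  by move=> x Dx; apply: derivableV; [exact: f0 | exact: d1].
apply: (Ck_ext _ (CkM (CkM (Ck_cst k (-1 : R)) (CkM wf wf)) d2)) => x Dx.
rewrite deriveV //; [|exact: f0 | exact: d1].
by rewrite -[_ *: _]/(_ * _) mulN1r expr2 invfM.
Qed.

Lemma Ck_mxP {p q} k (A : V -> 'M[R]_(p, q)) :
  Ck k D A <-> forall i j, Ck k D (fun x => A x i j).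
Proof.
have cmx x (B : V -> 'M[R]_(p, q)) :
    {for x, continuous B} <-> forall i j, {for x, continuous (fun y => B y i j)}.
  split=> [cB i j|cB].
    by apply: (@continuous_comp _ _ _ B (fun M : 'M[R]_(p, q) => M i j)) => //; apply: coord_continuous.
  apply/(@cvgrPdist_le _ _ _ (nbhs x)) => e e0.
  have H : \forall y \near x, forall i : 'I_p * 'I_q, `|B x i.1 i.2 - B y i.1 i.2| <= e.
    apply: (@filter_forall _ _ (fun (i : 'I_p * 'I_q) y => `|B x i.1 i.2 - B y i.1 i.2| <= e) (nbhs x)) => i.
    by move/cvgrPdist_le : (cB i.1 i.2); apply.
  apply: (@filterS _ (nbhs x) _ _ _ _ H) => y Hy.
  rewrite /Num.Def.normr/= mx_normrE (bigmax_le _ (ltW e0))//= => i _.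
  by rewrite !mxE.
elim: k A => [|k IH] A; split.
- by move=> [cA _] i j; split=> // x /cA /cmx.
- by move=> cA; split=> // x Dx; apply/cmx => i j; have [h _] := cA i j; exact: h.
- move=> [cA dA] i j; split; first by move=> x /cA /cmx.
  move=> l; have [d1 d2] := dA l; split; first by move=> x /d1 /derivable_mxP.
  move/IH : d2 => /(_ i j); apply: Ck_ext => x Dx.
  by rewrite derive_mx ?mxE //; exact: d1.
- move=> cA; split.
    by move=> x Dx; apply/cmx => i j; have [h _] := cA i j; exact: h.
  move=> l; split.
    by move=> x Dx; apply/derivable_mxP => i j; have [_ /(_ l)[h _]] := cA i j; exact: h.
  apply/IH => i j; have [_ /(_ l)[d1 d2]] := cA i j.
  apply: Ck_ext d2 => x Dx; rewrite derive_mx ?mxE //; apply/derivable_mxP => i' j'.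
  by have [_ /(_ l)[h _]] := cA i' j'; exact: h.
Qed.

End SmoothFunctions.

(** * Smooth scalar functions and derivatives in arbitrary directions *)

Section SmoothScalars.
Context {R : realType} {m : nat}.
Notation V := 'cV[R]_m.
Variable D : set V.
Hypothesis oD : open D.
Implicit Types (f h : V -> R) (u v x : V).

Lemma smooth_ext {W : normedModType R} (f h : V -> W) : (forall x, D x -> f x = h x) ->
  smooth_on D f -> smooth_on D h.
Proof. by move=> fh sf k; apply: Ck_ext fh (sf k). Qed.
Lemma smooth_cst {W : normedModType R} (c : W) : smooth_on D (fun=> c).
Proof. by move=> k; apply: Ck_cst. Qed.
Lemma smoothD {W : normedModType R} (f h : V -> W) : smooth_on D f -> smooth_on D h ->
  smooth_on D (fun x => f x + h x).
Proof. by move=> sf sh k; apply: CkD. Qed.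
Lemma smoothM f h : smooth_on D f -> smooth_on D h -> smooth_on D (fun x => f x * h x).
Proof. by move=> sf sh k; apply: CkM. Qed.
Lemma smoothV f : (forall x, D x -> f x != 0) -> smooth_on D f -> smooth_on D (fun x => (f x)^-1).
Proof. by move=> f0 sf k; apply: CkV. Qed.
Lemma smoothZ k f : smooth_on D f -> smooth_on D (fun x => k * f x).
Proof. by move=> sf; apply: smoothM => //; apply: smooth_cst. Qed.
Lemma smoothN f : smooth_on D f -> smooth_on D (fun x => - f x).
Proof.
by move=> sf; apply: smooth_ext (smoothZ (-1) sf) => x _; rewrite mulN1r.
Qed.
Lemma smoothB f h : smooth_on D f -> smooth_on D h -> smooth_on D (fun x => f x - h x).
Proof. by move=> sf sh; apply: smoothD => //; apply: smoothN. Qed.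
Lemma smooth_sum (I : Type) (r : seq I) (P : pred I) (F : I -> V -> R) :
  (forall i, smooth_on D (F i)) -> smooth_on D (fun x => \sum_(i <- r | P i) F i x).
Proof.
move=> sF; elim: r => [|i r IH].
  by apply: smooth_ext (smooth_cst (0 : R)) => x _; rewrite big_nil.
case: (boolP (P i)) => Pi; last by apply: smooth_ext IH => x _; rewrite big_cons (negPf Pi).
by apply: smooth_ext (smoothD (sF i) IH) => x _; rewrite big_cons Pi.
Qed.
Lemma smooth_prod (I : Type) (r : seq I) (P : pred I) (F : I -> V -> R) :
  (forall i, smooth_on D (F i)) -> smooth_on D (fun x => \prod_(i <- r | P i) F i x).
Proof.
move=> sF; elim: r => [|i r IH].
  by apply: smooth_ext (smooth_cst (1 : R)) => x _; rewrite big_nil.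
case: (boolP (P i)) => Pi; last by apply: smooth_ext IH => x _; rewrite big_cons (negPf Pi).
by apply: smooth_ext (smoothM (sF i) IH) => x _; rewrite big_cons Pi.
Qed.

Lemma smooth_continuous {W : normedModType R} (f : V -> W) x :
  smooth_on D f -> D x -> {for x, continuous f}.
Proof. by move=> /(_ 0%N)[cf _] /cf. Qed.

(** Smoothness is defined by coordinate directions only. The directions with this property form a
    linear subspace containing the coordinate basis, hence all of them have it. *)
Let good f a := (forall x, D x -> derivable f x a) /\ smooth_on D ('D_a f).

Let goodD f a b : good f a -> good f b -> good f (a + b).
Proof.
move=> [da sa] [db sb].
have H x : D x -> is_derive x (a + b) f ('D_a f x + 'D_b f x).
  move=> Dx; apply: (is_deriveD_dir oD Dx db (da _ Dx)).
  exact: smooth_continuous sb Dx.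
split; first by move=> x /H [].
by apply: smooth_ext (smoothD sa sb) => x /H [_ ->].
Qed.

Let goodZ f k a : good f a -> good f (k *: a).
Proof.
move=> [da sa]; have H x : D x -> is_derive x (k *: a) f (k * 'D_a f x).
  by move=> Dx; apply: deriveZ_dir; exact: da.
split; first by move=> x /H [].
by apply: smooth_ext (smoothZ k sa) => x /H [_ ->].
Qed.

Let good_all f a : smooth_on D f -> good f a.
Proof.
move=> sf.
have ge i : good f (ebase i).
  split; first by move=> x Dx; have [_ /(_ i)[h _]] := sf 1%N; exact: h.
  by move=> k; have [_ /(_ i)[_ h]] := sf k.+1.
have g0 : good f 0.
  split; first by move=> x _; exact: derivable0.
  by apply: smooth_ext (smooth_cst (0 : R)) => x _; rewrite derive0.
have -> : a = \sum_i a i 0 *: ebase i.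
  apply/matrixP => i j; rewrite summxE (bigD1 i) //= big1 ?addr0.
    by rewrite !mxE (ord1 j) !eqxx mulr1.
  by move=> k ki; rewrite !mxE eq_sym (negPf ki) mulr0.
apply: (big_ind (good f)) => [|b c gb gc|i _].
- exact: g0.
- exact: goodD gb gc.
- exact: goodZ (ge i).
Qed.

Lemma smooth_derivable f x a : smooth_on D f -> D x -> derivable f x a.
Proof. by move=> sf Dx; have [h _] := good_all a sf; exact: h. Qed.

Lemma smooth_derive f a : smooth_on D f -> smooth_on D ('D_a f).
Proof. by move=> sf; have [_ h] := good_all a sf. Qed.

Lemma smooth_deriveD_dir f x a b : smooth_on D f -> D x ->
  'D_(a + b) f x = 'D_a f x + 'D_b f x.
Proof.
move=> sf Dx; have [db sb] := good_all b sf; have [da _] := good_all a sf.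
have [] // := is_deriveD_dir oD Dx db (da _ Dx).
exact: smooth_continuous sb Dx.
Qed.

Lemma smooth_deriveZ_dir f x k a : smooth_on D f -> D x -> 'D_(k *: a) f x = k * 'D_a f x.
Proof.
by move=> sf Dx; have [] := deriveZ_dir k (smooth_derivable (a := a) sf Dx).
Qed.

Lemma smooth_Schwarz f x a b : smooth_on D f -> D x -> 'D_b ('D_a f) x = 'D_a ('D_b f) x.
Proof.
move=> sf Dx; have sa := smooth_derive a sf; have sb := smooth_derive b sf.
apply: (Schwarz oD Dx).
- by move=> y; exact: smooth_derivable.
- by move=> y; exact: smooth_derivable.
- by move=> y; exact: smooth_derivable.
- by move=> y; exact: smooth_derivable.
- exact: smooth_continuous (smooth_derive b sa) Dx.
- exact: smooth_continuous (smooth_derive a sb) Dx.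
Qed.
End SmoothScalars.

(** * Smooth matrix-valued functions *)

Section SmoothMatrices.
Context {R : realType} {m : nat}.
Notation V := 'cV[R]_m.
Variable D : set V.
Hypothesis oD : open D.

Lemma smooth_mxP {p q} (A : V -> 'M[R]_(p, q)) :
  smooth_on D A <-> forall i j, smooth_on D (fun x => A x i j).
Proof.
split=> [sA i j k|sA k]; first by have /(Ck_mxP oD)/(_ i j) := sA k.
by apply/(Ck_mxP oD) => i j; exact: sA.
Qed.

Lemma smooth_mx_derivable {p q} (A : V -> 'M[R]_(p, q)) x a : smooth_on D A -> D x ->
  derivable A x a.
Proof.
move=> /smooth_mxP sA Dx; apply/derivable_mxP => i j; exact: smooth_derivable (sA i j) Dx.
Qed.

Lemma derive_mxE {p q} (A : V -> 'M[R]_(p, q)) x a i j : smooth_on D A -> D x ->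
  ('D_a A x) i j = 'D_a (fun y => A y i j) x.
Proof. by move=> sA Dx; rewrite derive_mx ?mxE //; exact: smooth_mx_derivable. Qed.

Lemma smooth_mx_derive {p q} (A : V -> 'M[R]_(p, q)) a :
  smooth_on D A -> smooth_on D ('D_a A).
Proof.
move=> sA; apply/smooth_mxP => i j; have /smooth_mxP/(_ i j) sij := sA.
by apply: (smooth_ext oD _ (smooth_derive oD a sij)) => // x Dx; rewrite derive_mxE.
Qed.

Lemma derive_mxD_dir {p q} (A : V -> 'M[R]_(p, q)) x a b : smooth_on D A -> D x ->
  'D_(a + b) A x = 'D_a A x + 'D_b A x.
Proof.
move=> sA Dx; apply/matrixP => i j; have /smooth_mxP/(_ i j) sij := sA.
by rewrite !mxE !derive_mxE // (smooth_deriveD_dir oD).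
Qed.

Lemma derive_mxZ_dir {p q} (A : V -> 'M[R]_(p, q)) x k a : smooth_on D A -> D x ->
  'D_(k *: a) A x = k *: 'D_a A x.
Proof.
move=> sA Dx; apply/matrixP => i j; have /smooth_mxP/(_ i j) sij := sA.
by rewrite !mxE !derive_mxE // (smooth_deriveZ_dir oD).
Qed.

Lemma derive_ext (f h : V -> R) x a : (forall y, D y -> f y = h y) -> D x ->
  'D_a f x = 'D_a h x.
Proof. by move=> AB Dx; apply: near_eq_derive; apply: (near_open oD). Qed.

Lemma mx_Schwarz {p q} (A : V -> 'M[R]_(p, q)) x a b : smooth_on D A -> D x ->
  'D_b ('D_a A) x = 'D_a ('D_b A) x.
Proof.
move=> sA Dx; have sa := smooth_mx_derive a sA; have sb := smooth_mx_derive b sA.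
apply/matrixP => i j; have /smooth_mxP/(_ i j) sij := sA.
have E c : forall y, D y -> ('D_c A y) i j = 'D_c (fun y => A y i j) y.
  by move=> y Dy; exact: derive_mxE sA Dy.
have E1 := etrans (derive_mxE b i j sa Dx) (derive_ext b (E a) Dx).
have E2 := etrans (derive_mxE a i j sb Dx) (derive_ext a (E b) Dx).
exact: etrans E1 (etrans (smooth_Schwarz oD _ _ sij Dx) (esym E2)).
Qed.

Lemma smooth_mulmx {p q r} (A : V -> 'M[R]_(p, q)) (B : V -> 'M[R]_(q, r)) :
  smooth_on D A -> smooth_on D B -> smooth_on D (fun x => A x *m B x).
Proof.
move=> /smooth_mxP sA /smooth_mxP sB; apply/smooth_mxP => i j.
apply: (smooth_ext oD _ (smooth_sum oD (index_enum 'I_q) predT (fun k => smoothM oD (sA i k) (sB k j)))) => // x Dx.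
by rewrite mxE.
Qed.

Lemma derive_mulmx {p q r} (A : V -> 'M[R]_(p, q)) (B : V -> 'M[R]_(q, r)) x a :
  smooth_on D A -> smooth_on D B -> D x ->
  'D_a (fun y => A y *m B y) x = 'D_a A x *m B x + A x *m 'D_a B x.
Proof.
move=> sA sB Dx; apply/matrixP => i j; rewrite derive_mxE //; last exact: smooth_mulmx.
have /smooth_mxP sA' := sA; have /smooth_mxP sB' := sB.
have E : (fun y => (A y *m B y) i j) = \sum_k (fun y => A y i k * B y k j).
  by apply/funext => y; rewrite mxE fct_sumE.
rewrite E derive_sum; last first.
  by move=> k; exact: derivableM (smooth_derivable (a := a) oD (sA' i k) Dx) (smooth_derivable (a := a) oD (sB' k j) Dx).
rewrite !mxE -big_split /=; apply: eq_bigr => k _; rewrite !derive_mxE //.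
have d1 := smooth_derivable (a := a) oD (sA' i k) Dx; have d2 := smooth_derivable (a := a) oD (sB' k j) Dx.
by rewrite (deriveM d1 d2) addrC; congr (_ + _); rewrite mulrC.
Qed.

Lemma smooth_mx_cst {p q} (A : 'M[R]_(p, q)) : smooth_on D (fun=> A).
Proof. exact: smooth_cst. Qed.

Lemma smooth_mxZ {p q} (f : V -> R) (A : V -> 'M[R]_(p, q)) :
  smooth_on D f -> smooth_on D A -> smooth_on D (fun x => f x *: A x).
Proof.
move=> sf /smooth_mxP sA; apply/smooth_mxP => i j.
by apply: (smooth_ext oD _ (smoothM oD sf (sA i j))) => // x Dx; rewrite mxE.
Qed.

Lemma smooth_mxN {p q} (A : V -> 'M[R]_(p, q)) : smooth_on D A -> smooth_on D (fun x => - A x).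
Proof.
move=> /smooth_mxP sA; apply/smooth_mxP => i j.
by apply: (smooth_ext oD _ (smoothN oD (sA i j))) => // x Dx; rewrite mxE.
Qed.

Lemma derive_mxD {p q} (A B : V -> 'M[R]_(p, q)) x a : smooth_on D A -> smooth_on D B -> D x ->
  'D_a (fun y => A y + B y) x = 'D_a A x + 'D_a B x.
Proof. by move=> sA sB Dx; apply: deriveD; exact: smooth_mx_derivable. Qed.

Lemma derive_mxN {p q} (A : V -> 'M[R]_(p, q)) x a : smooth_on D A -> D x ->
  'D_a (fun y => - A y) x = - 'D_a A x.
Proof. by move=> sA Dx; apply: deriveN; exact: smooth_mx_derivable. Qed.

Lemma smooth_det {p} (A : V -> 'M[R]_p) : smooth_on D A -> smooth_on D (fun x => \det (A x)).
Proof.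
move=> /smooth_mxP sA; rewrite /determinant; apply: smooth_sum => // s.
by apply: smoothZ => //; apply: smooth_prod.
Qed.

Lemma smooth_invmx (A : V -> 'M[R]_m) : (forall x, D x -> A x \in unitmx) ->
  smooth_on D A -> smooth_on D (fun x => invmx (A x)).
Proof.
move=> uA sA.
have sd : smooth_on D (fun x => (\det (A x))^-1).
  by apply: smoothV => //; [move=> x /uA; rewrite unitmxE unitfE | exact: smooth_det].
have sa : smooth_on D (fun x => \adj (A x)).
  apply/smooth_mxP => i j.
  have sc : smooth_on D (fun x => (-1) ^+ (j + i) * \det (row' j (col' i (A x)))).
    apply: smoothZ => //; apply: smooth_det; apply/smooth_mxP => k l.
    have /smooth_mxP/(_ (lift j k) (lift i l)) sjl := sA.
    by apply: (smooth_ext oD _ sjl) => y Dy; rewrite !mxE.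
  by apply: (smooth_ext oD _ sc) => // y Dy; rewrite !mxE.
by apply: (smooth_ext oD _ (smooth_mxZ sd sa)) => // x Dx; rewrite /invmx uA.
Qed.

End SmoothMatrices.

(* A locked copy of 'D_u f x: unification unfolds the limit in the original. *)
HB.lock Definition pder {R : realType} {m : nat} {W : normedModType R} (u : 'cV[R]_m)
  (f : 'cV[R]_m -> W) (x : 'cV[R]_m) : W := 'D_u f x.

Section PartialDerivatives.
Context {R : realType} {m : nat}.
Notation V := 'cV[R]_m.
Variable D : set V.
Hypothesis oD : open D.
Implicit Types (u v x : V).

Lemma pderE {W : normedModType R} u (f : V -> W) x : 'D_u f x = pder u f x.
Proof. by rewrite pder.unlock. Qed.

Lemma pder_ext {W : normedModType R} (f h : V -> W) u x : (forall y, D y -> f y = h y) -> D x ->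
  pder u f x = pder u h x.
Proof. by move=> fh Dx; rewrite pder.unlock; apply: near_eq_derive; apply: (near_open oD). Qed.

Lemma pder_cst {W : normedModType R} (c : W) u x : pder u (fun=> c) x = 0.
Proof. by rewrite pder.unlock; exact: derive_cst. Qed.

Lemma pderD {p q} (A B : V -> 'M[R]_(p, q)) u x : smooth_on D A -> smooth_on D B -> D x ->
  pder u (fun y => A y + B y) x = pder u A x + pder u B x.
Proof. by move=> sA sB Dx; rewrite pder.unlock; exact: (derive_mxD oD u sA sB Dx). Qed.

Lemma pderN {p q} (A : V -> 'M[R]_(p, q)) u x : smooth_on D A -> D x ->
  pder u (fun y => - A y) x = - pder u A x.
Proof. by move=> sA Dx; rewrite pder.unlock; exact: (derive_mxN oD u sA Dx). Qed.

Lemma pderM {p q r} (A : V -> 'M[R]_(p, q)) (B : V -> 'M[R]_(q, r)) u x :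
  smooth_on D A -> smooth_on D B -> D x ->
  pder u (fun y => A y *m B y) x = pder u A x *m B x + A x *m pder u B x.
Proof. by move=> sA sB Dx; rewrite pder.unlock; exact: (derive_mulmx oD u sA sB Dx). Qed.

Lemma pder_lin {p q} (A : V -> 'M[R]_(p, q)) k u v x : smooth_on D A -> D x ->
  pder (k *: u + v) A x = k *: pder u A x + pder v A x.
Proof.
move=> sA Dx; rewrite pder.unlock (derive_mxD_dir oD (k *: u) v sA Dx).
by rewrite (derive_mxZ_dir oD k u sA Dx).
Qed.

Lemma pder_mxE {p q} (A : V -> 'M[R]_(p, q)) u x i j : smooth_on D A -> D x ->
  (pder u A x) i j = pder u (fun y => A y i j) x.
Proof. by move=> sA Dx; rewrite pder.unlock; exact: (derive_mxE oD u i j sA Dx). Qed.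

Lemma smooth_pder {p q} (A : V -> 'M[R]_(p, q)) u : smooth_on D A -> smooth_on D (pder u A).
Proof. by move=> sA; rewrite pder.unlock; exact: smooth_mx_derive. Qed.

Lemma pderC {p q} (A : V -> 'M[R]_(p, q)) u v x : smooth_on D A -> D x ->
  pder v (pder u A) x = pder u (pder v A) x.
Proof. by move=> sA Dx; rewrite pder.unlock; exact: (mx_Schwarz oD u v sA Dx). Qed.

Lemma spderC (f : V -> R) u v x : smooth_on D f -> D x -> pder v (pder u f) x = pder u (pder v f) x.
Proof. by move=> sf Dx; rewrite pder.unlock; exact: (smooth_Schwarz oD u v sf Dx). Qed.

Lemma spderD (f h : V -> R) u x : smooth_on D f -> smooth_on D h -> D x ->
  pder u (fun y => f y + h y) x = pder u f x + pder u h x.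
Proof.
move=> sf sh Dx; rewrite pder.unlock.
exact: (deriveD (smooth_derivable (a := u) oD sf Dx) (smooth_derivable (a := u) oD sh Dx)).
Qed.

Lemma spderN (f : V -> R) u x : smooth_on D f -> D x ->
  pder u (fun y => - f y) x = - pder u f x.
Proof.
move=> sf Dx; rewrite pder.unlock; exact: (deriveN (smooth_derivable (a := u) oD sf Dx)).
Qed.

Lemma spderM (f h : V -> R) u x : smooth_on D f -> smooth_on D h -> D x ->
  pder u (fun y => f y * h y) x = pder u f x * h x + f x * pder u h x.
Proof.
move=> sf sh Dx; rewrite pder.unlock.
have := deriveM (smooth_derivable (a := u) oD sf Dx) (smooth_derivable (a := u) oD sh Dx).
by move=> ->; rewrite addrC; congr (_ + _); exact: mulrC.
Qed.

Lemma smooth_trmx {p q} (A : V -> 'M[R]_(p, q)) : smooth_on D A -> smooth_on D (fun y => (A y)^T).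
Proof.
move=> sA; apply/(smooth_mxP oD) => i j; have /(smooth_mxP oD)/(_ j i) s := sA.
by apply: (smooth_ext oD _ s) => y Dy; rewrite mxE.
Qed.

Lemma pder_trmx {p q} (A : V -> 'M[R]_(p, q)) u x : smooth_on D A -> D x ->
  pder u (fun y => (A y)^T) x = (pder u A x)^T.
Proof.
move=> sA Dx; have sT := smooth_trmx sA.
apply/matrixP => i j; rewrite (pder_mxE _ _ _ sT Dx) mxE (pder_mxE _ _ _ sA Dx).
by apply: (pder_ext _ _ Dx) => y Dy; rewrite mxE.
Qed.

End PartialDerivatives.

(** * The Levi-Civita connection *)

Section Bform.
Context {R : realType} {m : nat}.
Notation V := 'cV[R]_m.
Implicit Types (A B : 'M[R]_m) (u v w : V).

Lemma bformDl A u v w : bform A (u + v) w = bform A u w + bform A v w.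
Proof. by rewrite /bform linearD /= !mulmxDl mxE. Qed.
Lemma bformZl A k u w : bform A (k *: u) w = k * bform A u w.
Proof. by rewrite /bform linearZ /= -!scalemxAl mxE. Qed.
Lemma bformDr A u v w : bform A u (v + w) = bform A u v + bform A u w.
Proof. by rewrite /bform !mulmxDr mxE. Qed.
Lemma bformZr A k u w : bform A u (k *: w) = k * bform A u w.
Proof. by rewrite /bform -!scalemxAr mxE. Qed.
Lemma bformPl A k u v w : bform A (k *: u + v) w = k * bform A u w + bform A v w.
Proof. by rewrite bformDl bformZl. Qed.
Lemma bformPr A k u v w : bform A u (k *: v + w) = k * bform A u v + bform A u w.
Proof. by rewrite bformDr bformZr. Qed.
Lemma bformNl A u w : bform A (- u) w = - bform A u w.
Proof. by rewrite -scaleN1r bformZl mulN1r. Qed.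
Lemma bformNr A u w : bform A u (- w) = - bform A u w.
Proof. by rewrite -scaleN1r bformZr mulN1r. Qed.
Lemma bform0l A w : bform A 0 w = 0.
Proof. by rewrite -(scale0r 0) bformZl mul0r. Qed.
Lemma bform0r A w : bform A w 0 = 0.
Proof. by rewrite -(scale0r 0) bformZr mul0r. Qed.
Lemma bformC A u v : A^T = A -> bform A u v = bform A v u.
Proof.
move=> sA; have E : (u^T *m A *m v)^T = v^T *m A *m u.
  by rewrite !trmx_mul sA trmxK mulmxA.
by rewrite /bform -E [RHS]mxE.
Qed.
Lemma bform_mulmx A B u v : bform A (B *m u) v = bform (B^T *m A) u v.
Proof. by rewrite /bform trmx_mul !mulmxA. Qed.
Lemma bformD_mx A B u v : bform (A + B) u v = bform A u v + bform B u v.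
Proof. by rewrite /bform mulmxDr mulmxDl mxE. Qed.
Lemma bformZ_mx k A u v : bform (k *: A) u v = k * bform A u v.
Proof. by rewrite /bform -scalemxAr -scalemxAl mxE. Qed.
Lemma bform_ebase A i j : bform A (ebase i) (ebase j) = A i j.
Proof.
rewrite /bform /ebase trmx_delta -rowE mxE (bigD1 j) //= big1 ?addr0.
  by rewrite !mxE !eqxx mulr1.
by move=> k kj; rewrite !mxE (negPf kj) mulr0.
Qed.

Lemma ebase_decomp u : u = \sum_i u i 0 *: ebase i.
Proof.
apply/matrixP => i j; rewrite summxE (bigD1 i) //= big1 ?addr0.
  by rewrite !mxE (ord1 j) !eqxx mulr1.
by move=> k ki; rewrite !mxE eq_sym (negPf ki) mulr0.
Qed.

Lemma linear_ebase (f h : V -> R) : (forall k u v, f (k *: u + v) = k * f u + f v) ->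
  (forall k u v, h (k *: u + v) = k * h u + h v) -> (forall i, f (ebase i) = h (ebase i)) ->
  forall u, f u = h u.
Proof.
move=> fl hl fh u.
have f0 : f 0 = 0 by have := fl (-1) 0 0; rewrite scaler0 addr0 mulN1r addNr.
have h0 : h 0 = 0 by have := hl (-1) 0 0; rewrite scaler0 addr0 mulN1r addNr.
rewrite (ebase_decomp u); apply: (big_ind (fun v => f v = h v)) => [|a b Ea Eb|i _].
- by rewrite f0 h0.
- by have := fl 1 a b; have := hl 1 a b; rewrite !scale1r !mul1r => -> ->; rewrite Ea Eb.
- have := fl (u i 0) (ebase i) 0; have := hl (u i 0) (ebase i) 0.
  by rewrite !addr0 f0 h0 !addr0 fh => -> ->.
Qed.

Lemma bform_inj A u v : A^T = A -> A \in unitmx -> (forall w, bform A u w = bform A v w) -> u = v.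
Proof.
move=> sA uA h; rewrite -[u]mul1mx -[v]mul1mx -(mulVmx uA) -!mulmxA; congr (_ *m _).
apply/matrixP => i j; have := h (ebase i); rewrite !(bformC _ (ebase i)) // (ord1 j).
by rewrite /bform /ebase trmx_delta -!mulmxA -!rowE !mxE.
Qed.

Lemma mulmx_inj A B : (forall v : V, A *m v = B *m v) -> A = B.
Proof.
move=> h; apply/matrixP => i j; have := congr1 (fun w : V => w i 0) (h (ebase j)).
by rewrite /ebase -!colE !mxE.
Qed.

(** Unlike [mxE], this and the next two leave matrix products closed, so that their entries serve as
    atoms for [ring] and [lra]. *)
Lemma addmxE {p q} (A B : 'M[R]_(p, q)) i j : (A + B) i j = A i j + B i j.
Proof. by rewrite mxE. Qed.
Lemma oppmxE {p q} (A : 'M[R]_(p, q)) i j : (- A) i j = - A i j.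
Proof. by rewrite mxE. Qed.
Lemma zeromxE {p q} i j : (0 : 'M[R]_(p, q)) i j = 0.
Proof. by rewrite mxE. Qed.
End Bform.

Section LeviCivita.
Context {R : realType} {m : nat}.
Notation V := 'cV[R]_m.
Variables (D : set V) (G : V -> 'M[R]_m).
Hypothesis oD : open D.
Hypothesis sG : smooth_on D G.
Hypothesis symG : forall x, D x -> (G x)^T = G x.
Hypothesis unitG : forall x, D x -> G x \in unitmx.
Notation Gam := (levi_civita G).

Lemma smooth_bform (a b : V -> V) : smooth_on D a -> smooth_on D b ->
  smooth_on D (fun y => bform (G y) (a y) (b y)).
Proof.
move=> sa sb; have st := smooth_trmx oD sa.
by have /(smooth_mxP oD)/(_ 0 0) := smooth_mulmx oD (smooth_mulmx oD st sG) sb.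
Qed.

Lemma pder_bform (a b : V -> V) x u : smooth_on D a -> smooth_on D b -> D x ->
  pder u (fun y => bform (G y) (a y) (b y)) x = bform (pder u G x) (a x) (b x)
    + bform (G x) (pder u a x) (b x) + bform (G x) (a x) (pder u b x).
Proof.
move=> sa sb Dx; have st := smooth_trmx oD sa; have sag := smooth_mulmx oD st sG.
have := pder_mxE oD u 0 0 (smooth_mulmx oD sag sb) Dx.
rewrite (pderM oD u sag sb Dx) (pderM oD u st sG Dx) (pder_trmx oD u sa Dx).
rewrite /bform => <-; rewrite mulmxDl !addmxE; ring.
Qed.

Let cst_smooth (v : V) : smooth_on D (fun=> v).
Proof. exact: smooth_cst. Qed.

Lemma pder_bform_cst x u v w : D x ->
  pder u (fun y => bform (G y) v w) x = bform (pder u G x) v w.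
Proof.
move=> Dx; rewrite (pder_bform u (cst_smooth v) (cst_smooth w) Dx).
by rewrite !pder_cst bform0l bform0r !addr0.
Qed.

Lemma sym_pder x u : D x -> (pder u G x)^T = pder u G x.
Proof.
move=> Dx; rewrite -(pder_trmx oD u sG Dx).
by apply: (pder_ext oD u _ Dx) => y Dy; apply: symG.
Qed.

Lemma levi_civita_bform x u v w : D x -> bform (G x) (Gam x u *m v) w = 2^-1 *
  (bform (pder u G x) v w + bform (pder v G x) u w - bform (pder w G x) u v).
Proof.
move=> Dx; rewrite /levi_civita -mulmxA bform_mulmx trmx_inv symG // mulVmx ?unitG //.
set M := \matrix_(k, j) _; rewrite bform_mulmx mulmx1.
move: v; apply: linear_ebase => [k a b|k a b|j].
- exact: bformPl.
- rewrite (pder_lin oD k a b sG Dx) bformD_mx bformZ_mx bformPl bformPr; ring.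
move: w; apply: linear_ebase => [k a b|k a b|k].
- exact: bformPr.
- rewrite (pder_lin oD k a b sG Dx) bformD_mx bformZ_mx !bformPr; ring.
by rewrite bform_ebase !mxE !pderE !pder_bform_cst.
Qed.

Lemma levi_civita_sym x u v : D x -> Gam x u *m v = Gam x v *m u.
Proof.
move=> Dx; apply: (bform_inj (symG Dx) (unitG Dx)) => w.
rewrite !levi_civita_bform // (bformC u v (sym_pder w Dx)); ring.
Qed.

Lemma levi_civita_metric x u v w : D x -> bform (pder u G x) v w
  = bform (G x) (Gam x u *m v) w + bform (G x) v (Gam x u *m w).
Proof.
move=> Dx; rewrite (bformC v _ (symG Dx)) !levi_civita_bform //.
by rewrite (bformC w v (sym_pder u Dx)); field.
Qed.

Lemma smooth_levi_civita u : smooth_on D (fun y => Gam y u).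
Proof.
apply: smooth_mulmx => //; first exact: smooth_invmx.
apply/(smooth_mxP oD) => k j.
have E : forall y, D y -> 2^-1 * (bform (pder u G y) (ebase j) (ebase k)
   + bform (pder (ebase j) G y) u (ebase k) - bform (pder (ebase k) G y) u (ebase j)) =
  (\matrix_(k, j) (2^-1 *
    ('D_u (fun y => bform (G y) (ebase j) (ebase k)) y
     + 'D_(ebase j) (fun y => bform (G y) u (ebase k)) y
     - 'D_(ebase k) (fun y => bform (G y) u (ebase j)) y))) k j.
  by move=> y Dy; rewrite mxE !pderE !pder_bform_cst.
have sb a v w : smooth_on D (fun y => bform (pder a G y) v w).
  have := smooth_derive oD a (smooth_bform (cst_smooth v) (cst_smooth w)).
  by apply: (smooth_ext oD _) => y Dy; rewrite pderE pder_bform_cst.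
apply: (smooth_ext oD E); apply: smoothZ => //; apply: smoothB => //.
exact: smoothD.
Qed.
End LeviCivita.

(** * Curvature of a torsion-free metric connection *)

Section MetricConnection.
Context {R : realType} {m : nat}.
Notation V := 'cV[R]_m.
Variables (D : set V) (G : V -> 'M[R]_m) (Gam : V -> V -> 'M[R]_m).
Hypothesis oD : open D.
Hypothesis sG : smooth_on D G.
Hypothesis symG : forall x, D x -> (G x)^T = G x.
Hypothesis Gam_smooth : forall u, smooth_on D (fun y => Gam y u).
Hypothesis Gam_sym : forall x u v, D x -> Gam x u *m v = Gam x v *m u.
Hypothesis Gam_metric : forall x u v w, D x -> bform (pder u G x) v w
  = bform (G x) (Gam x u *m v) w + bform (G x) v (Gam x u *m w).

(** Torsion-freeness exchanges the direction with the argument, in which a matrix acts linearly. *)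
Lemma connection_lin x k u v : D x -> Gam x (k *: u + v) = k *: Gam x u + Gam x v.
Proof.
move=> Dx; apply: mulmx_inj => w.
by rewrite (Gam_sym _ w Dx) mulmxDr mulmxDl -scalemxAr -scalemxAl !(Gam_sym w _ Dx).
Qed.

Lemma connection0 x : D x -> Gam x 0 = 0.
Proof.
by move=> Dx; have := connection_lin (-1) 0 0 Dx; rewrite scaler0 addr0 scaleN1r addNr.
Qed.

(** The endomorphism $R_{uv} = \nabla_{[u,v]} - [\nabla_u,\nabla_v]$ for constant fields, whose
    bracket is zero; the sign convention fixes the order of the terms. *)
Definition curv_mx (x u v : V) : 'M[R]_m :=
  pder v (fun y => Gam y u) x - pder u (fun y => Gam y v) x
  + Gam x v *m Gam x u - Gam x u *m Gam x v.

Lemma curvE (Z : V -> V) x u v : smooth_on D Z -> D x ->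
  curv Gam (cst u) (cst v) Z x = curv_mx x u v *m Z x.
Proof.
move=> sZ Dx; rewrite /curv.
have l0 : lie (cst u) (cst v) x = 0 by rewrite /lie /= !pderE !pder_cst subr0.
have -> : nabla Gam (lie (cst u) (cst v)) Z x = 0.
  by rewrite /nabla l0 connection0 // mul0mx derive0 addr0.
have E a b : nabla Gam (cst a) (nabla Gam (cst b) Z) x = pder a (pder b Z) x
    + (pder a (fun y => Gam y b) x *m Z x + Gam x b *m pder a Z x)
   + (Gam x a *m pder b Z x + Gam x a *m (Gam x b *m Z x)).
  rewrite -(pderM oD a (Gam_smooth b) sZ Dx) -mulmxDr.
  rewrite -(pderD oD a (smooth_pder oD b sZ) (smooth_mulmx oD (Gam_smooth b) sZ) Dx).
  by rewrite /nabla /= !pderE pder.unlock.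
rewrite !E (pderC oD v u sZ Dx) sub0r /curv_mx !mulmxDl !mulNmx !mulmxA.
apply/matrixP => i j; rewrite !(addmxE, oppmxE); ring.
Qed.

Lemma curv_mx_skew x u v : curv_mx x u v = - curv_mx x v u.
Proof. by apply/matrixP => i j; rewrite /curv_mx !(addmxE, oppmxE); ring. Qed.

Lemma curv_mx_lin x k u v w : D x -> curv_mx x (k *: u + v) w = k *: curv_mx x u w + curv_mx x v w.
Proof.
move=> Dx; rewrite /curv_mx (pder_lin oD k u v (Gam_smooth w) Dx) !connection_lin //.
have -> : pder w (fun y => Gam y (k *: u + v)) x
   = pder w (fun y => (k%:M *m Gam y u) + Gam y v) x.
  by apply: (pder_ext oD w _ Dx) => y Dy; rewrite connection_lin // mul_scalar_mx.
have sk := smooth_mulmx oD (smooth_mx_cst oD k%:M) (Gam_smooth u).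
rewrite (pderD oD w sk (Gam_smooth v) Dx) (pderM oD w (smooth_mx_cst oD k%:M) (Gam_smooth u) Dx).
rewrite pder_cst mul0mx add0r mul_scalar_mx mulmxDr mulmxDl -scalemxAr -scalemxAl.
rewrite !scalerDr !scalerN; apply/matrixP => i j; rewrite !(addmxE, oppmxE); ring.
Qed.

Lemma pder_connection_mul x a u (v : V) : D x ->
  pder a (fun y => Gam y u *m v) x = pder a (fun y => Gam y u) x *m v.
Proof.
by move=> Dx; rewrite (pderM oD a (Gam_smooth u) (smooth_mx_cst oD v) Dx) pder_cst mulmx0 addr0.
Qed.

Lemma pder_connection_sym x a u (v : V) : D x ->
  pder a (fun y => Gam y u) x *m v = pder a (fun y => Gam y v) x *m u.
Proof.
move=> Dx; rewrite -!pder_connection_mul //.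
by apply: (pder_ext oD a _ Dx) => y Dy; apply: Gam_sym.
Qed.

Lemma curv_mx_bianchi1 x u v w : D x ->
  curv_mx x u v *m w + curv_mx x v w *m u + curv_mx x w u *m v = 0.
Proof.
move=> Dx; rewrite /curv_mx !mulmxDl !mulNmx -!mulmxA.
rewrite (pder_connection_sym v u w Dx) (pder_connection_sym w v u Dx).
rewrite (pder_connection_sym u w v Dx) (Gam_sym u w Dx) (Gam_sym v w Dx) (Gam_sym v u Dx).
apply/matrixP => i j; rewrite !(addmxE, oppmxE, zeromxE); ring.
Qed.

Lemma pder_bform_connection (a b : V -> V) x u : smooth_on D a -> smooth_on D b -> D x ->
  pder u (fun y => bform (G y) (a y) (b y)) x =
    bform (G x) (pder u a x + Gam x u *m a x) (b x)
    + bform (G x) (a x) (pder u b x + Gam x u *m b x).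
Proof.
move=> sa sb Dx; rewrite (pder_bform oD sG u sa sb Dx) Gam_metric //.
rewrite bformDl bformDr; ring.
Qed.

(** Metricity turns the second derivatives of $g(w,z)$ into connection terms, and their symmetry in
    the two directions is the claim. *)
Lemma curv_mx_metric x u v w z : D x ->
  bform (G x) (curv_mx x u v *m w) z = - bform (G x) w (curv_mx x u v *m z).
Proof.
move=> Dx; have sw := smooth_mx_cst oD w; have sz := smooth_mx_cst oD z.
have sgw a : smooth_on D (fun y => Gam y a *m w) := smooth_mulmx oD (Gam_smooth a) sw.
have sgz a : smooth_on D (fun y => Gam y a *m z) := smooth_mulmx oD (Gam_smooth a) sz.
have E a y : D y -> pder a (fun y => bform (G y) w z) y
   = bform (G y) (Gam y a *m w) z + bform (G y) w (Gam y a *m z).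
  by move=> Dy; rewrite (pder_bform_connection a sw sz Dy) !pder_cst !add0r.
have E2 a b : pder b (pder a (fun y => bform (G y) w z)) x =
   bform (G x) (pder b (fun y => Gam y a) x *m w + Gam x b *m (Gam x a *m w)) z
   + bform (G x) (Gam x a *m w) (Gam x b *m z)
   + (bform (G x) (Gam x b *m w) (Gam x a *m z)
   + bform (G x) w (pder b (fun y => Gam y a) x *m z + Gam x b *m (Gam x a *m z))).
  rewrite (pder_ext oD b (E a) Dx).
  have s1 := smooth_bform oD sG (sgw a) sz; have s2 := smooth_bform oD sG sw (sgz a).
  rewrite (spderD oD b s1 s2 Dx).
  rewrite (pder_bform_connection b (sgw a) sz Dx) (pder_bform_connection b sw (sgz a) Dx).
  by rewrite !pder_connection_mul // !pder_cst !add0r.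
have := spderC oD u v (smooth_bform oD sG sw sz) Dx.
rewrite !E2 /curv_mx !mulmxDl !mulNmx -!mulmxA !(bformDl, bformDr, bformNl, bformNr) => E3; lra.
Qed.

(** Purely algebraic: the four first Bianchi identities for the cyclic rotations of $(u,v,w,z)$,
    combined with both skew symmetries. *)
Lemma curv_mx_pair x u v w z : D x ->
  bform (G x) (curv_mx x u v *m w) z = bform (G x) (curv_mx x w z *m u) v.
Proof.
move=> Dx; pose r a b c d := bform (G x) (curv_mx x a b *m c) d.
have r12 a b c d : r a b c d = - r b a c d by rewrite /r curv_mx_skew mulNmx bformNl.
have r34 a b c d : r a b c d = - r a b d c.
  by rewrite /r curv_mx_metric // (bformC _ _ (symG Dx)).
have rB a b c d : r a b c d + r b c a d + r c a b d = 0.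
  by rewrite /r -!bformDl curv_mx_bianchi1 // bform0l.
rewrite -/(r u v w z) -/(r w z u v).
have B1 := rB u v w z; have B2 := rB v w z u; have B3 := rB w z u v; have B4 := rB z u v w.
move: B1 B2 B3 B4; rewrite (r34 v w u z) (r12 w u v z) (r34 u w v z) .
rewrite (r34 v w z u) (r12 z v w u) (r34 v z w u) (r34 w z v u).
rewrite (r12 z u w v) (r34 u z w v) (r12 u w z v).
rewrite (r12 z u v w) (r12 v z u w) .
rewrite (r34 u v z w).
lra.
Qed.

(** The identity in its exterior form: only the endomorphism value is differentiated covariantly,
    and no terms such as $R_{\nabla_w u,v}$ appear. Third-order cancellation is the symmetry of
    second derivatives of [Gam]. *)
Lemma curv_mx_bianchi2 x u v w : D x ->
  (pder w (fun y => curv_mx y u v) x + Gam x w *m curv_mx x u v - curv_mx x u v *m Gam x w)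
  + (pder u (fun y => curv_mx y v w) x + Gam x u *m curv_mx x v w - curv_mx x v w *m Gam x u)
  + (pder v (fun y => curv_mx y w u) x + Gam x v *m curv_mx x w u - curv_mx x w u *m Gam x v) = 0.
Proof.
move=> Dx; have sM a b : smooth_on D (fun y => Gam y a *m Gam y b) := smooth_mulmx oD (Gam_smooth a) (Gam_smooth b).
have sp a b : smooth_on D (pder a (fun y => Gam y b)) := smooth_pder oD a (Gam_smooth b).
have E a b c : pder c (fun y => curv_mx y a b) x =
   pder c (pder b (fun y => Gam y a)) x - pder c (pder a (fun y => Gam y b)) x
   + (pder c (fun y => Gam y b) x *m Gam x a + Gam x b *m pder c (fun y => Gam y a) x)
   - (pder c (fun y => Gam y a) x *m Gam x b + Gam x a *m pder c (fun y => Gam y b) x).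
  rewrite /curv_mx.
  have s1 := smoothD oD (sp b a) (smooth_mx_cst oD 0).
  have sN1 := smooth_mxN oD (sp a b); have sN2 := smooth_mxN oD (sM a b).
  have s2 := smoothD oD (sp b a) sN1; have s3 := smoothD oD s2 (sM b a).
  rewrite (pderD oD c s3 sN2 Dx) (pderD oD c s2 (sM b a) Dx) (pderD oD c (sp b a) sN1 Dx).
  rewrite (pderN oD c (sp a b) Dx) (pderN oD c (sM a b) Dx).
  by rewrite (pderM oD c (Gam_smooth b) (Gam_smooth a) Dx) (pderM oD c (Gam_smooth a) (Gam_smooth b) Dx).
rewrite !E (pderC oD v w (Gam_smooth u) Dx) (pderC oD u w (Gam_smooth v) Dx) (pderC oD u v (Gam_smooth w) Dx).
rewrite /curv_mx !mulmxDl !mulmxDr !mulNmx !mulmxN !mulmxA.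
apply/matrixP => i j; rewrite !(addmxE, oppmxE, zeromxE); ring.
Qed.

Lemma smooth_curv_mx u v : smooth_on D (fun y => curv_mx y u v).
Proof.
have sM a b : smooth_on D (fun y => Gam y a *m Gam y b) := smooth_mulmx oD (Gam_smooth a) (Gam_smooth b).
have sp a b : smooth_on D (pder a (fun y => Gam y b)) := smooth_pder oD a (Gam_smooth b).
rewrite /curv_mx; apply: smoothD => //; last exact: smooth_mxN.
by apply: smoothD => //; apply: smoothD => //; exact: smooth_mxN.
Qed.

End MetricConnection.

(** * Structures of linear type in a chart *)

Section LocalStructure.
Context {R : realType} {m : nat}.
Notation V := 'cV[R]_m.
Variables (D : set V) (G : V -> 'M[R]_m) (Gam S : V -> V -> 'M[R]_m) (e : R).
Variables (J1 J2 J3 : V -> 'M[R]_m) (xi z1 z2 z3 : V -> V).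
Hypothesis oD : open D.
Hypothesis sG : smooth_on D G.
Hypothesis symG : forall x, D x -> (G x)^T = G x.
Hypothesis Gam_smooth : forall u, smooth_on D (fun y => Gam y u).
Hypothesis Gam_sym : forall x u v, D x -> Gam x u *m v = Gam x v *m u.
Hypothesis Gam_metric : forall x u v w, D x -> bform (pder u G x) v w
  = bform (G x) (Gam x u *m v) w + bform (G x) v (Gam x u *m w).
Hypothesis S_smooth : forall u, smooth_on D (fun y => S y u).
Hypothesis S_lin : forall x k u v, D x -> S x (k *: u + v) = k *: S x u + S x v.
Hypothesis J1_smooth : smooth_on D J1.
Hypothesis J2_smooth : smooth_on D J2.
Hypothesis J3_smooth : smooth_on D J3.
Hypothesis HQ : forall x, D x ->
  quaternionic_space (bform (G x)) e (mulmx (J1 x)) (mulmx (J2 x)) (mulmx (J3 x)).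
Definition in_span x (A : 'M[R]_m) :=
  exists k1 k2 k3, A = k1 *: J1 x + k2 *: J2 x + k3 *: J3 x.
Hypothesis parallelQ : forall A x u, smooth_on D A -> (forall y, D y -> in_span y (A y)) -> D x ->
  in_span x (pder u A x + Gam x u *m A x - A x *m Gam x u).
Hypothesis xi_smooth : smooth_on D xi.
Hypothesis z1_smooth : smooth_on D z1.
Hypothesis z2_smooth : smooth_on D z2.
Hypothesis z3_smooth : smooth_on D z3.
Hypothesis SE : forall x, D x -> forall X Y, S x X *m Y =
  lin_str (bform (G x)) e (mulmx (J1 x)) (mulmx (J2 x)) (mulmx (J3 x)) (xi x)
    (fun X => bform (G x) X (z1 x)) (fun X => bform (G x) X (z2 x))
    (fun X => bform (G x) X (z3 x)) X Y.
Notation Gt := (fun x u => Gam x u - S x u).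
Hypothesis tmetric : forall x u v w, D x -> bform (pder u G x) v w
  = bform (G x) (Gt x u *m v) w + bform (G x) v (Gt x u *m w).
Hypothesis tS : forall x u v, D x ->
  pder u (fun y => S y v) x + Gt x u *m S x v - S x v *m Gt x u = S x (Gt x u *m v).
Definition rm x u v w z := bform (G x) (curv_mx Gam x u v *m w) z.
Hypothesis tR : forall x u v1 v2 v3 v4, D x ->
  pder u (fun y => rm y v1 v2 v3 v4) x = rm x (Gt x u *m v1) v2 v3 v4
   + rm x v1 (Gt x u *m v2) v3 v4 + rm x v1 v2 (Gt x u *m v3) v4 + rm x v1 v2 v3 (Gt x u *m v4).
Hypothesis xi_nonnull : forall x, D x -> bform (G x) (xi x) (xi x) != 0.
Hypothesis exists_orth : forall x w, D x -> exists2 v : V, v <> 0 &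
  orth (bform (G x)) (mulmx (J1 x)) (mulmx (J2 x)) (mulmx (J3 x)) w v.

Lemma in_spanD x A B : in_span x A -> in_span x B -> in_span x (A + B).
Proof.
move=> [a1 [a2 [a3 ->]]] [b1 [b2 [b3 ->]]]; exists (a1 + b1), (a2 + b2), (a3 + b3).
by rewrite !scalerDl addrACA; congr (_ + _); rewrite addrACA.
Qed.
Lemma in_spanN x A : in_span x A -> in_span x (- A).
Proof.
move=> [a1 [a2 [a3 ->]]]; exists (- a1), (- a2), (- a3).
by rewrite !opprD !scaleNr.
Qed.

(** * Differentiation by nabla~ at a point *)

Section AtPoint.
Variables (x u : V).
Hypothesis Dx : D x.
Let g := bform (G x).
Notation gt := (Gam x u - S x u).

(* In has_tder, P is the value of the covariant derivative nabla~_u at x. *)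
Definition has_pder (f : V -> R) d := smooth_on D f /\ pder u f x = d.
Definition has_tder (p : V -> V) P := smooth_on D p /\ pder u p x + gt *m p x = P.

Lemma has_pder_add f h a b : has_pder f a -> has_pder h b -> has_pder (fun y => f y + h y) (a + b).
Proof. by move=> [sf <-] [sh <-]; split; [exact: smoothD | exact: (spderD oD u sf sh Dx)]. Qed.
Lemma has_pder_opp f a : has_pder f a -> has_pder (fun y => - f y) (- a).
Proof. by move=> [sf <-]; split; [exact: smoothN | exact: (spderN oD u sf Dx)]. Qed.
Lemma has_pder_mul f h a b : has_pder f a -> has_pder h b -> has_pder (fun y => f y * h y) (a * h x + f x * b).
Proof. by move=> [sf <-] [sh <-]; split; [exact: smoothM | exact: (spderM oD u sf sh Dx)]. Qed.
Lemma has_pder_cst c : has_pder (fun=> c) 0.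
Proof. by split; [exact: smooth_cst | exact: pder_cst]. Qed.
Lemma has_tder_cst c : has_tder (fun=> c) (gt *m c).
Proof. by split; [exact: smooth_cst | rewrite pder_cst add0r]. Qed.
Lemma has_pder_bform p q P Q : has_tder p P -> has_tder q Q ->
  has_pder (fun y => bform (G y) (p y) (q y)) (g P (q x) + g (p x) Q).
Proof.
move=> [sp <-] [sq <-]; split; first exact: smooth_bform.
by rewrite (pder_bform oD sG u sp sq Dx) tmetric // /g bformDl bformDr; ring.
Qed.
Lemma has_tder_mul A p P : smooth_on D A -> has_tder p P -> has_tder (fun y => A y *m p y)
  ((pder u A x + gt *m A x - A x *m gt) *m p x + A x *m P).
Proof.
move=> sA [sp <-]; split; first exact: smooth_mulmx.
rewrite (pderM oD u sA sp Dx); move: (Gam x u - S x u) => T.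
rewrite mulmxDr !mulmxDl mulNmx !mulmxA.
apply/matrixP => i j; rewrite !(addmxE, oppmxE); ring.
Qed.

(* nabla~ preserves Q because S_u = sigma_u + sum_a zeta^a(u) J_a with sigma_u
   in sp(n). *)
Lemma tilde_span : [/\ in_span x (pder u J1 x + gt *m J1 x - J1 x *m gt),
  in_span x (pder u J2 x + gt *m J2 x - J2 x *m gt)
  & in_span x (pder u J3 x + gt *m J3 x - J3 x *m gt)].
Proof.
have E (A : 'M[R]_m) P : P + gt *m A - A *m gt
   = (P + Gam x u *m A - A *m Gam x u) + - (S x u *m A - A *m S x u).
  rewrite mulmxBl mulmxBr; apply/matrixP => i j; rewrite !(addmxE, oppmxE); ring.
have sp1 y : D y -> in_span y (J1 y).
  by move=> _; exists 1, 0, 0; rewrite scale1r !scale0r !addr0.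
have sp2 y : D y -> in_span y (J2 y).
  by move=> _; exists 0, 1, 0; rewrite scale1r !scale0r addr0 add0r.
have sp3 y : D y -> in_span y (J3 y).
  by move=> _; exists 0, 0, 1; rewrite scale1r !scale0r !add0r.
have comm v := lin_str_commutator (HQ Dx) (SE Dx) u v.
split; rewrite E; apply: in_spanD; try exact: parallelQ; apply: in_spanN.
- exists 0, (2 * bform (G x) u (z3 x)), (- 2 * bform (G x) u (z2 x)); apply: mulmx_inj => v.
  have [c _ _] := comm v.
  by rewrite mulmxBl -!mulmxA c scale0r add0r mulmxDl -!scalemxAl addrC.
- exists (2 * e * bform (G x) u (z3 x)), 0, (2 * bform (G x) u (z1 x)); apply: mulmx_inj => v.
  have [_ c _] := comm v.
  by rewrite mulmxBl -!mulmxA c scale0r addr0 mulmxDl -!scalemxAl addrC.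
- exists (- 2 * e * bform (G x) u (z2 x)), (- 2 * bform (G x) u (z1 x)), 0; apply: mulmx_inj => v.
  have [_ _ c] := comm v.
  by rewrite mulmxBl -!mulmxA c scale0r addr0 mulmxDl -!scalemxAl addrC.
Qed.

Let xi' := pder u xi x + gt *m xi x.

(** The identity [E] for $g(S_XY,X)$ is differentiated by nabla~. Derivatives of $J_a$ stay in $Q$
    and meet $g(X,J_bY) = 0$, derivatives of $\zeta^a$ are multiplied by $g(J_aY,X) = 0$, and the
    terms in nabla~ X and nabla~ Y cancel against the left side because nabla~ S = 0. What survives
    is $g(Y,\tilde\nabla\xi)\,g(X,X) = 0$. *)
Lemma xi_test X Y : g X X != 0 ->
  orth g (mulmx (J1 x)) (mulmx (J2 x)) (mulmx (J3 x)) X Y -> g Y xi' = 0.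
Proof.
move=> X0 YX.
(* The constant fields [X] and [Y] are orthogonal in the required sense at [x] only, so the products
   with $g(X,Y)$ and $g(X,J_aY)$ have to be kept until after differentiation. *)
have E y : D y -> bform (G y) (S y X *m Y) X =
  bform (G y) X Y * bform (G y) (xi y) X + - (bform (G y) Y (xi y) * bform (G y) X X)
  + (bform (G y) X (J1 y *m Y) * bform (G y) (xi y) (J1 y *m X)
  + (- (e * (bform (G y) X (J2 y *m Y) * bform (G y) (xi y) (J2 y *m X))
  + e * (bform (G y) X (J3 y *m Y) * bform (G y) (xi y) (J3 y *m X)))))
  + (bform (G y) X (z1 y) * bform (G y) (J1 y *m Y) X + bform (G y) X (z2 y) * bform (G y) (J2 y *m Y) X
  + bform (G y) X (z3 y) * bform (G y) (J3 y *m Y) X).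
  move=> Dy; rewrite (g_lin_str (HQ Dy) (SE Dy)) !(self1 (HQ Dy), self2 (HQ Dy), self3 (HQ Dy)); ring.
have iX := has_tder_cst X; have iY := has_tder_cst Y.
have ixi : has_tder xi xi' by [].
have iz1 : has_tder z1 (pder u z1 x + gt *m z1 x) by [].
have iz2 : has_tder z2 (pder u z2 x + gt *m z2 x) by [].
have iz3 : has_tder z3 (pder u z3 x + gt *m z3 x) by [].
have iL := has_pder_bform (has_tder_mul (S_smooth X) iY) iX.
have b := has_pder_bform.
have j1 p P := @has_tder_mul J1 p P J1_smooth.
have j2 p P := @has_tder_mul J2 p P J2_smooth.
have j3 p P := @has_tder_mul J3 p P J3_smooth.
have ie := has_pder_cst e.
have iR := has_pder_add (has_pder_add
  (has_pder_add (has_pder_mul (b _ _ _ _ iX iY) (b _ _ _ _ ixi iX))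
    (has_pder_opp (has_pder_mul (b _ _ _ _ iY ixi) (b _ _ _ _ iX iX))))
  (has_pder_add (has_pder_mul (b _ _ _ _ iX (j1 _ _ iY)) (b _ _ _ _ ixi (j1 _ _ iX)))
   (has_pder_opp (has_pder_add
    (has_pder_mul ie (has_pder_mul (b _ _ _ _ iX (j2 _ _ iY)) (b _ _ _ _ ixi (j2 _ _ iX))))
    (has_pder_mul ie (has_pder_mul (b _ _ _ _ iX (j3 _ _ iY)) (b _ _ _ _ ixi (j3 _ _ iX))))))))
  (has_pder_add (has_pder_add
    (has_pder_mul (b _ _ _ _ iX iz1) (b _ _ _ _ (j1 _ _ iY) iX))
    (has_pder_mul (b _ _ _ _ iX iz2) (b _ _ _ _ (j2 _ _ iY) iX)))
    (has_pder_mul (b _ _ _ _ iX iz3) (b _ _ _ _ (j3 _ _ iY) iX))).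
have [_ dL] := iL; have [_ dR] := iR.
have := etrans (esym dL) (etrans (pder_ext oD u E Dx) dR).
(* The derivative of $S_X$ becomes $S$ along nabla~ X; all remaining covariant derivatives can then
   be generalized to arbitrary vectors. *)
rewrite tS // {iL iR dL dR E b}.
have [[a1 [a2 [a3 ->]]] [b1 [b2 [b3 ->]]] [c1 [c2 [c3 ->]]]] := tilde_span.
move: (gt *m X) (gt *m Y) xi' (pder u z1 x + gt *m z1 x) (pder u z2 x + gt *m z2 x) (pder u z3 x + gt *m z3 x).
move=> a b x' w1 w2 w3; rewrite -/g {iX iY ixi iz1 iz2 iz3 ie j1 j2 j3}.
have q := HQ Dx; rewrite -/g in q.
have [h0 h1 h2 h3] := YX.
have d1 p r : g p (J1 x *m r) = - g r (J1 x *m p) by rewrite (qs_gC q) (qs_sk1 q).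
have d2 p r : g p (J2 x *m r) = - g r (J2 x *m p) by rewrite (qs_gC q) (qs_sk2 q).
have d3 p r : g p (J3 x *m r) = - g r (J3 x *m p) by rewrite (qs_gC q) (qs_sk3 q).
have f0 : g X Y = 0 by rewrite (qs_gC q).
have f1 : g X (J1 x *m Y) = 0 by rewrite d1 h1 oppr0.
have f2 : g X (J2 x *m Y) = 0 by rewrite d2 h2 oppr0.
have f3 : g X (J3 x *m Y) = 0 by rewrite d3 h3 oppr0.
have gDl := qs_gDl q; have gZl := qs_gZl q; have gDr := gDr q; have gZr := gZr q.
rewrite !mulmxDl -!scalemxAl !(gDl, gZl, gDr, gZr) !(g_lin_str q (SE Dx)).
rewrite !(qs_sk1 q, qs_sk2 q, qs_sk3 q) !(f0, f1, f2, f3, h0, h1, h2, h3).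
rewrite !(self1 q, self2 q, self3 q).
rewrite !(d1 X a, d1 X b, d2 X a, d2 X b, d3 X a, d3 X b, d1 Y a, d2 Y a, d3 Y a).
rewrite !(qs_gC q X a, qs_gC q X b, qs_gC q Y a).
rewrite -/g !(mulr0, mul0r, oppr0, addr0, add0r, subr0) => E.
by apply: (mulIf X0); rewrite mul0r; lra.
Qed.
End AtPoint.


Lemma exists_orth_nonnull_xi x : D x -> exists2 v,
  orth (bform (G x)) (mulmx (J1 x)) (mulmx (J2 x)) (mulmx (J3 x)) (xi x) v & bform (G x) v v != 0.
Proof.
move=> Dx; have [w w0 wo] := exists_orth (xi x) Dx.
exact: (exists_orth_nonnull (HQ Dx) (xi_nonnull Dx) w0 wo).
Qed.

Lemma tilde_xi x u : D x -> pder u xi x + Gt x u *m xi x = 0.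
Proof.
move=> Dx; have [v vo v0] := exists_orth_nonnull_xi Dx.
apply: (test_vector_zero (HQ Dx) (xi_nonnull Dx) vo v0).
by move=> X Y X0 XY; apply: (xi_test u Dx X0 XY).
Qed.

Lemma pder_xi_norm x u : D x -> pder u (fun y => bform (G y) (xi y) (xi y)) x = 0.
Proof.
move=> Dx; have h : has_tder x u xi 0 by split; [exact: xi_smooth | exact: tilde_xi].
have [_ ->] := has_pder_bform Dx h h.
by rewrite bform0l bform0r addr0.
Qed.

Lemma S_sub x u v : D x -> S x (u - v) = S x u - S x v.
Proof.
move=> Dx; have := S_lin (-1) v u Dx; rewrite !scaleN1r addrC => ->.
by rewrite addrC.
Qed.

(* Differentiating nabla_v xi = S_v xi once more, with nabla~ S = 0, gives
   R_{uv} xi without any derivative of the zeta^a. *)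
Lemma curv_xi x u v : D x -> curv_mx Gam x u v *m xi x =
  - (S x u *m (S x v *m xi x)) + S x v *m (S x u *m xi x) + S x (S x u *m v - S x v *m u) *m xi x.
Proof.
move=> Dx.
have dxi a y : D y -> pder a xi y = S y a *m xi y - Gam y a *m xi y.
  move=> Dy; apply/eqP; rewrite -subr_eq0; apply/eqP; rewrite -(tilde_xi a Dy) mulmxBl.
  by apply/matrixP => i j; rewrite !(addmxE, oppmxE); ring.
have sS a : smooth_on D (fun y => S y a *m xi y) := smooth_mulmx oD (S_smooth a) xi_smooth.
have sGm a : smooth_on D (fun y => Gam y a *m xi y) := smooth_mulmx oD (Gam_smooth a) xi_smooth.
have E a b : pder a (pder b xi) x = S x (Gt x a *m b) *m xi x - Gt x a *m (S x b *m xi x)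
    - pder a (fun y => Gam y b) x *m xi x + Gam x b *m (Gt x a *m xi x).
  rewrite (pder_ext oD a (fun y Dy => dxi b y Dy) Dx).
  rewrite (pderD oD a (sS b) (smooth_mxN oD (sGm b)) Dx) (pderN oD a (sGm b) Dx).
  rewrite (pderM oD a (S_smooth b) xi_smooth Dx) (pderM oD a (Gam_smooth b) xi_smooth Dx).
  have -> : pder a xi x = - (Gt x a *m xi x).
    by apply/eqP; rewrite -addr_eq0 tilde_xi.
  rewrite -tS //; move: (Gt x a) (pder a _ x) (pder a _ x) => T P P'.
  rewrite !mulmxN !mulmxDl !mulNmx !mulmxA.
  by apply/matrixP => i j; rewrite !(addmxE, oppmxE); ring.
have := pderC oD u v xi_smooth Dx; rewrite !E /curv_mx !mulmxBl !mulmxBr !S_sub // (Gam_sym v u Dx).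
move: (pder u _ x) (pder v _ x) => P P'.
rewrite !mulmxDl ?mulmxBl !mulNmx !mulmxA => E2.
apply/matrixP => i j; have := congr1 (fun A : V => A i j) E2.
by rewrite !(addmxE, oppmxE); lra.
Qed.

(** Ricci identity: $[R_{uv},J] = \nabla_v\nabla_uJ - \nabla_u\nabla_vJ$, and each second derivative
    stays in $Q$ because [parallelQ] applies again to the local section $\nabla_aJ$. *)
Lemma curv_mx_span x u v : D x ->
  [/\ in_span x (curv_mx Gam x u v *m J1 x - J1 x *m curv_mx Gam x u v),
      in_span x (curv_mx Gam x u v *m J2 x - J2 x *m curv_mx Gam x u v)
    & in_span x (curv_mx Gam x u v *m J3 x - J3 x *m curv_mx Gam x u v)].
Proof.
move=> Dx.
suff H (J : V -> 'M[R]_m) : smooth_on D J -> (forall y, D y -> in_span y (J y)) ->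
    in_span x (curv_mx Gam x u v *m J x - J x *m curv_mx Gam x u v).
  split; apply: H => // y Dy.
  - by exists 1, 0, 0; rewrite scale1r !scale0r !addr0.
  - by exists 0, 1, 0; rewrite scale1r !scale0r addr0 add0r.
  - by exists 0, 0, 1; rewrite scale1r !scale0r !add0r.
move=> sJ spJ.
pose K a y := pder a J y + Gam y a *m J y - J y *m Gam y a.
have sGJ a : smooth_on D (fun y => Gam y a *m J y) := smooth_mulmx oD (Gam_smooth a) sJ.
have sJG a : smooth_on D (fun y => J y *m Gam y a) := smooth_mulmx oD sJ (Gam_smooth a).
have sd a : smooth_on D (pder a J) := smooth_pder oD a sJ.
have sK a : smooth_on D (K a).
  exact (smoothD oD (smoothD oD (sd a) (sGJ a)) (smooth_mxN oD (sJG a))).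
have spK a y : D y -> in_span y (K a y) by move=> Dy; apply: parallelQ.
have dK a b : pder a (K b) x = pder a (pder b J) x
   + (pder a (fun y => Gam y b) x *m J x + Gam x b *m pder a J x)
   - (pder a J x *m Gam x b + J x *m pder a (fun y => Gam y b) x).
  rewrite (pderD oD a (smoothD oD (sd b) (sGJ b)) (smooth_mxN oD (sJG b)) Dx).
  rewrite (pderD oD a (sd b) (sGJ b) Dx) (pderN oD a (sJG b) Dx).
  by rewrite (pderM oD a (Gam_smooth b) sJ Dx) (pderM oD a sJ (Gam_smooth b) Dx).
have := in_spanD (parallelQ v (sK u) (spK u) Dx) (in_spanN (parallelQ u (sK v) (spK v) Dx)).
rewrite !dK (pderC oD u v sJ Dx) /K; congr in_span; rewrite /curv_mx.
move: (pder u (pder v J) x) (pder u J x) (pder v J x) (pder u _ x) (pder v _ x) => A B C P Q.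
rewrite !mulmxBl !mulmxBr !mulmxDl !mulmxDr !mulNmx !mulmxN ?mulmxBl ?mulmxBr !mulmxA.
by apply/matrixP => i j; rewrite !(addmxE, oppmxE); ring.
Qed.

Lemma rm_lin x k u v w z t : D x ->
  rm x (k *: u + v) w z t = k * rm x u w z t + rm x v w z t.
Proof. by move=> Dx; rewrite /rm (curv_mx_lin oD Gam_smooth Gam_sym) // mulmxDl -scalemxAl bformPl. Qed.

Lemma rm_curvature x : D x ->
  quaternionic_curvature (bform (G x)) (mulmx (J1 x)) (mulmx (J2 x)) (mulmx (J3 x)) (rm x).
Proof.
move=> Dx; have q := HQ Dx.
have N A B (J : V -> V) (J' : 'M[R]_m) : (forall z, J z = J' *m z) -> 
  (forall y z, bform (G x) (J y) z = - bform (G x) y (J z)) ->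
  in_span x (curv_mx Gam x A B *m J' - J' *m curv_mx Gam x A B) ->
  exists m1 m2 m3, forall z w, rm x A B (J z) w + rm x A B z (J w) =
    m1 * bform (G x) (J1 x *m z) w + m2 * bform (G x) (J2 x *m z) w + m3 * bform (G x) (J3 x *m z) w.
  move=> JE sk [k1 [k2 [k3 E]]]; exists k1, k2, k3 => z w.
  have -> : rm x A B z (J w) = - bform (G x) (J (curv_mx Gam x A B *m z)) w by rewrite sk opprK.
  rewrite /rm !JE -bformNl -bformDl !mulmxA -mulNmx -mulmxDl E !mulmxDl -!scalemxAl.
  by rewrite !bformDl !bformZl.
split.
- by move=> k a b c d t; apply: rm_lin.
- by move=> a b c d; rewrite /rm curv_mx_skew mulNmx bformNl.
- move=> a b c d; rewrite /rm (curv_mx_metric oD sG Gam_smooth Gam_metric) //.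
  by rewrite (bformC _ _ (symG Dx)).
- by move=> a b c d; exact: (curv_mx_pair oD sG symG Gam_smooth Gam_sym Gam_metric).
- by move=> a b c d; rewrite /rm -!bformDl (curv_mx_bianchi1 oD Gam_smooth Gam_sym) // bform0l.
- by move=> a b; have [h _ _] := curv_mx_span a b Dx; apply: N h => //; exact: qs_sk1 q.
- by move=> a b; have [_ h _] := curv_mx_span a b Dx; apply: N h => //; exact: qs_sk2 q.
- by move=> a b; have [_ _ h] := curv_mx_span a b Dx; apply: N h => //; exact: qs_sk3 q.
Qed.

(** nabla~ R = 0 says that $\nabla_wR$ is $S_w$ acting on $R$, that is minus [deriv_curv]. The two
    connection terms on the right arise because the left side differentiates only the endomorphism,
    with [a] and [b] constant. *)
Lemma rm_tilde_bianchi2 x w a b c d : D x ->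
  bform (G x) ((pder w (fun y => curv_mx Gam y a b) x + Gam x w *m curv_mx Gam x a b
    - curv_mx Gam x a b *m Gam x w) *m c) d
  = rm x (Gam x w *m a) b c d + rm x a (Gam x w *m b) c d
    - deriv_curv (rm x) (fun u v => S x u *m v) w a b c d.
Proof.
move=> Dx; have sR := smooth_curv_mx oD Gam_smooth a b.
have sc := smooth_mx_cst oD c; have sd := smooth_mx_cst oD d.
have := tR w a b c d Dx.
rewrite (pder_bform_connection oD sG Gam_metric w (smooth_mulmx oD sR sc) sd Dx).
rewrite (pderM oD w sR sc Dx) !pder_cst mulmx0 addr0 add0r /deriv_curv.
have rl u v y z t : rm x (u - v) y z t = rm x u y z t - rm x v y z t.
  by have := rm_lin (-1) v u y z t Dx; rewrite scaleN1r addrC => ->; ring.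
have r12 u v y z : rm x u v y z = - rm x v u y z by rewrite /rm curv_mx_skew mulNmx bformNl.
have rl2 u v y z t : rm x y (u - v) z t = rm x y u z t - rm x y v z t.
  by rewrite r12 rl (r12 y u) (r12 y v); ring.
have rl3 y z u v t : rm x y z (u - v) t = rm x y z u t - rm x y z v t.
  by rewrite /rm mulmxBr bformDl bformNl.
have rl4 y z t u v : rm x y z t (u - v) = rm x y z t u - rm x y z t v.
  by rewrite /rm bformDr bformNr.
rewrite !(mulmxBl (Gam x w)) rl rl2 rl3 rl4 {rl rl2 rl3 rl4 r12}.
rewrite [in X in _ -> X]mulmxBl [in X in _ -> X]mulmxDl !(bformDl, bformNl) -!mulmxA.
rewrite -[bform (G x) (curv_mx Gam x a b *m (Gam x w *m c)) d]/(rm x a b (Gam x w *m c) d).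
rewrite -[bform (G x) (curv_mx Gam x a b *m c) (Gam x w *m d)]/(rm x a b c (Gam x w *m d)).
lra.
Qed.

Lemma rm_bianchi2 x w a b c d : D x ->
  deriv_curv (rm x) (fun u v => S x u *m v) w a b c d
  + deriv_curv (rm x) (fun u v => S x u *m v) a b w c d
  + deriv_curv (rm x) (fun u v => S x u *m v) b w a c d = 0.
Proof.
move=> Dx; have E1 := rm_tilde_bianchi2 w a b c d Dx; have E2 := rm_tilde_bianchi2 a b w c d Dx.
have E3 := rm_tilde_bianchi2 b w a c d Dx.
have gen (A B C : 'M[R]_m) : A + B + C = 0 ->
    bform (G x) (A *m c) d + bform (G x) (B *m c) d + bform (G x) (C *m c) d = 0.
  by move=> h; rewrite -!bformDl -!mulmxDl h mul0mx bform0l.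
have := gen _ _ _ (curv_mx_bianchi2 oD Gam_smooth a b w Dx); rewrite E1 E2 E3.
have r12 u v y z : rm x u v y z = - rm x v u y z by rewrite /rm curv_mx_skew mulNmx bformNl.
(* Torsion-freeness and skewness cancel the connection terms in pairs. *)
rewrite (Gam_sym b w Dx) (Gam_sym a w Dx) (Gam_sym b a Dx).
rewrite (r12 a (Gam x w *m b)) (r12 b (Gam x w *m a)) (r12 w (Gam x a *m b)); lra.
Qed.

Theorem linear_type_curvature x : D x ->
  (forall X Y, S x X *m Y = lin_str (bform (G x)) e (mulmx (J1 x)) (mulmx (J2 x)) (mulmx (J3 x))
     (xi x) (fun=> 0) (fun=> 0) (fun=> 0) X Y) /\
  (forall X Y Z W, rm x X Y Z W = - (bform (G x) (xi x) (xi x) *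
     R0 (bform (G x)) e (mulmx (J1 x)) (mulmx (J2 x)) (mulmx (J3 x)) X Y Z W)).
Proof.
move=> Dx; have [v vo v0] := exists_orth_nonnull_xi Dx.
have q := HQ Dx; have N0 := xi_nonnull Dx; have qc := rm_curvature Dx.
have zl z : forall k X Y, bform (G x) (k *: X + Y) z = k * bform (G x) X z + bform (G x) Y z.
  by move=> k X Y; rewrite bformPl.
have Rxi X Y Z : rm x X Y (xi x) Z = bform (G x) (- (S x X *m (S x Y *m xi x))
    + S x Y *m (S x X *m xi x) + S x (S x X *m Y - S x Y *m X) *m xi x) Z.
  by rewrite /rm curv_xi.
split.
  exact: (lin_strE q N0 vo v0 qc (zl (z1 x)) (zl (z2 x)) (zl (z3 x)) (SE Dx) Rxi).
exact: (curvature_lin_str q N0 vo v0 qc (zl (z1 x)) (zl (z2 x)) (zl (z3 x)) (SE Dx) Rxi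
  (fun w a b c d => rm_bianchi2 w a b c d Dx)).
Qed.
End LocalStructure.

(** * From charts to the manifold *)

Section Auxiliary.
Context {R : realType} {m : nat}.
Notation V := 'cV[R]_m.

Lemma smooth_subset {W : normedModType R} (D D' : set V) (f : V -> W) : D' `<=` D ->
  smooth_on D f -> smooth_on D' f.
Proof.
move=> sub sf k; move: (sf k); elim: k f {sf} => [|k IH] f [cf df]; split=> //.
- by move=> x /sub /cf.
- by move=> x /sub /cf.
- by move=> i; have [d1 d2] := df i; split; [move=> x /sub /d1 | exact: IH].
Qed.

Lemma locally_constant (D : set V) (f : V -> R) x : open D -> smooth_on D f ->
  (forall u y, D y -> pder u f y = 0) -> D x -> \forall y \near x, D y /\ f y = f x.
Proof.
move=> oD sf df Dx.
have /nbhs_ballP[d /= d0 Hd] := open_nbhs_nbhs (conj oD Dx).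
apply/nbhs_ballP; exists d => //= y xy; split; first exact: Hd.
have inb (s : R) : `|s| <= `|1 : R| -> D (x + s *: (y - x)).
  rewrite normr1 => s1; apply: Hd; move: xy; rewrite -ball_normE /ball_ /= => xy.
  rewrite opprD addrA subrr sub0r normrN normrZ distrC.
  by apply: le_lt_trans xy; rewrite ler_piMl.
have [|s s1] := @MVT_dir R V f x (y - x) 1.
  by move=> s /inb; exact: smooth_derivable sf.
rewrite scale1r [x + _]addrC subrK mul1r pderE df; last exact: inb.
by move/eqP; rewrite subr_eq0 => /eqP.
Qed.

Lemma sum3 {W : zmodType} (F : 'I_3 -> W) : \sum_a F a = F i1 + F i2 + F i3.
Proof.
rewrite !big_ord_recl big_ord0 addr0 addrA.
by congr (F _ + F _ + F _); apply: val_inj.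
Qed.

(** Four linear equations in more than four unknowns; this is where the dimension bound enters. *)
Lemma exists_orth_vector (G J1 J2 J3 : 'M[R]_m) (w : V) : (4 < m)%N ->
  exists2 v : V, v <> 0 & orth (bform G) (mulmx J1) (mulmx J2) (mulmx J3) w v.
Proof.
move=> m4; pose K : 'M[R]_(m, 1 + (1 + (1 + 1))) :=
  G *m row_mx w (row_mx (J1 *m w) (row_mx (J2 *m w) (J3 *m w))).
have k0 : kermx K != 0.
  rewrite -mxrank_eq0 mxrank_ker subn_eq0 -ltnNge.
  exact: leq_ltn_trans (rank_leq_col K) m4.
have /rowV0Pn[v /sub_kermxP vK v0] := k0.
exists v^T; first by move=> h; case/negP: v0; rewrite -[v]trmxK h trmx0.
have E (y : V) : bform G v^T y = (v *m (G *m y)) 0 0 by rewrite /bform trmxK mulmxA.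
move: vK; rewrite /K mulmxA !mul_mx_row -!mulmxA => vK.
have [e0 [e1 [e2 e3]]] : v *m (G *m w) = 0 /\ v *m (G *m (J1 *m w)) = 0 /\
    v *m (G *m (J2 *m w)) = 0 /\ v *m (G *m (J3 *m w)) = 0.
  by move: vK; rewrite -!row_mx0 => /eq_row_mx[-> /eq_row_mx[-> /eq_row_mx[-> ->]]].
by split; rewrite E ?e0 ?e1 ?e2 ?e3 mxE.
Qed.
End Auxiliary.

(** * Change of adapted basis of Q *)

Section AdaptedBases.
Context {R : realType} {m : nat}.
Notation V := 'cV[R]_m.
Hypothesis m0 : (0 < m)%N.
Variables (G : 'M[R]_m) (eps : 'I_3 -> R) (J J' : 'I_3 -> 'M[R]_m).
Hypothesis eps1 : eps i1 = -1.
Hypothesis eps23 : eps i3 = eps i2.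
Hypothesis q : quaternionic_space (bform G) (eps i2) (mulmx (J i1)) (mulmx (J i2)) (mulmx (J i3)).
Hypothesis q' : quaternionic_space (bform G) (eps i2) (mulmx (J' i1)) (mulmx (J' i2)) (mulmx (J' i3)).
Variable k : 'I_3 -> 'I_3 -> R.
Hypothesis JJ' : forall a, J a = \sum_b k a b *: J' b.

Lemma ord3P (P : 'I_3 -> Prop) : P i1 -> P i2 -> P i3 -> forall a, P a.
Proof.
by move=> h1 h2 h3 [[|[|[|//]]] a3]; [move: h1|move: h2|move: h3]; congr P; apply: val_inj.
Qed.

Lemma ord3_neq : [/\ (i1 == i2) = false, (i1 == i3) = false, (i2 == i3) = false,
  (i2 == i1) = false & (i3 == i1) = false] /\ (i3 == i2) = false.
Proof. by []. Qed.

Lemma anticommutator (K : 'I_3 -> 'M[R]_m) :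
  quaternionic_space (bform G) (eps i2) (mulmx (K i1)) (mulmx (K i2)) (mulmx (K i3)) ->
  forall a b, K a *m K b + K b *m K a = (2 * eps a * (a == b)%:R)%:M.
Proof.
move=> p; have [[n12 n13 n23 n21 n31] n32] := ord3_neq.
apply: ord3P; apply: ord3P;
  apply: mulmx_inj => v; rewrite mulmxDl mul_scalar_mx -!mulmxA ?(qs_j11 p) ?(qs_j22 p) ?(qs_j33 p) ?(qs_j12 p)
   ?(j13 p) ?(j21 p) ?(j23 p) ?(j31 p) ?(j32 p) ?(n12, n13, n21, n31, n23, n32) ?eqxx ?eps1 ?eps23;
   apply/matrixP => i j; rewrite !mxE /= ?mulr1n ?mulr0n; ring.
Qed.

Let E : 'M[R]_3 := \matrix_(a, b) (eps a * (a == b)%:R).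
Let K : 'M[R]_3 := \matrix_(a, b) k a b.

(** Both bases satisfy $J_aJ_b + J_bJ_a = 2\epsilon_a\delta_{ab}$. Expanding one in the other gives
    $KEK^T = E$: the change of basis is an isometry of the form $\mathrm{diag}(\epsilon)$ on $Q$. *)
Lemma adapted_bases_orthogonal : K^T *m E *m K = E.
Proof.
have E2 : E *m E = 1%:M.
  apply/matrixP => a b; rewrite mxE sum3 !mxE; move: a b.
  have [[n12 n13 n23 n21 n31] n32] := ord3_neq.
  by apply: ord3P; apply: ord3P; rewrite ?(n12, n13, n21, n31, n23, n32) ?eqxx ?eps1 ?eps23 /=;
    case: (qs_he q) => ->; ring.
have KE : K *m E *m K^T = E.
  apply/matrixP => a b; have := anticommutator q a b.
  (* A diagonal entry recovers the scalar of a scalar matrix, which requires $m > 0$. *)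
  pose i0 := Ordinal m0; rewrite !JJ' => /(congr1 (fun A : 'M[R]_m => A i0 i0)).
  have h c d : (k a c *: J' c) *m (k b d *: J' d) + (k b d *: J' d) *m (k a c *: J' c)
     = (k a c * k b d * (2 * eps c * (c == d)%:R))%:M.
    rewrite -!scalemxAl -!scalemxAr !scalerA (mulrC (k b d)) -scalerDr (anticommutator q').
    by rewrite scale_scalar_mx.
  have -> : (\sum_c k a c *: J' c) *m (\sum_c k b c *: J' c)
     + (\sum_c k b c *: J' c) *m (\sum_c k a c *: J' c)
     = \sum_c \sum_d (k a c * k b d * (2 * eps c * (c == d)%:R))%:M.
    rewrite !mulmx_suml; under eq_bigr do rewrite mulmx_sumr.
    under [X in _ + X]eq_bigr do rewrite mulmx_sumr.
    rewrite [X in _ + X]exchange_big /= -big_split; apply: eq_bigr => c _.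
    by rewrite -big_split; apply: eq_bigr => d _; apply: h.
  rewrite !sum3 !mxE !sum3 !mxE !sum3 !mxE eqxx !mulr1n => hh.
  apply: (mulfI (x := 2)); first by rewrite pnatr_eq0.
  by rewrite [RHS]mulrA -hh; ring.
(* A right inverse of a square matrix is a left inverse, which moves the transpose to the other side
   of the identity. *)
have : (K *m E) *m (K^T *m E) = 1%:M by rewrite mulmxA KE E2.
move/mulmx1C; rewrite mulmxA => h; rewrite -[RHS]mul1mx -h -!mulmxA E2 mulmx1 //.
Qed.

(** The sum is the trace of the bilinear form [F] on $Q$ with respect to $\mathrm{diag}(\epsilon)$,
    hence invariant under the isometry [K]. *)
Lemma adapted_bases_sum (F : 'M[R]_m -> 'M[R]_m -> R) :
  (forall c A B C, F (c *: A + B) C = c * F A C + F B C) ->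
  (forall c A B C, F A (c *: B + C) = c * F A B + F A C) ->
  \sum_a eps a * F (J a) (J a) = \sum_a eps a * F (J' a) (J' a).
Proof.
move=> Fl Fr.
have Fl0 C : F 0 C = 0 by have := Fl (-1) 0 0 C; rewrite scaler0 addr0 mulN1r addNr.
have Fr0 A : F A 0 = 0 by have := Fr (-1) A 0 0; rewrite scaler0 addr0 mulN1r addNr.
have Fs (a b : 'I_3) : F (J a) (J b) = \sum_c \sum_d k a c * k b d * F (J' c) (J' d).
  rewrite !JJ' !sum3 -!addrA !Fl -[k a i3 *: J' i3]addr0 !Fl Fl0.
  rewrite -[k b i3 *: J' i3]addr0 !Fr !Fr0; ring.
have h b c : \sum_a eps a * (k a b * k a c) = eps b * (b == c)%:R.
  have := congr1 (fun A : 'M[R]_3 => A b c) adapted_bases_orthogonal; rewrite !mxE => <-.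
  apply: eq_bigr => a _; rewrite !mxE (bigD1 a) //= big1 ?addr0 => [|d da]; rewrite !mxE ?eqxx.
    by rewrite mulr1; ring.
  by rewrite (negPf da) !mulr0.
transitivity (\sum_b \sum_c (\sum_a eps a * (k a b * k a c)) * F (J' b) (J' c)).
  by rewrite !sum3 !Fs !sum3; ring.
under eq_bigr do under eq_bigr do rewrite h.
apply: eq_bigr => b _; rewrite (bigD1 b) //= big1 ?addr0 ?eqxx ?mulr1 // => c cb.
by rewrite eq_sym (negPf cb) mulr0 mul0r.
Qed.
End AdaptedBases.

(** * Independence of xi and N from the chart and the local expression *)

Section Transfer.
Context {R : realType} {m : nat}.
Notation V := 'cV[R]_m.
Variables (P G G' J1 J2 J3 J1' J2' J3' : 'M[R]_m) (e : R) (xi xi' : V) (z1 z2 z3 z1' z2' z3' : V -> R).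
Variables (S S' : V -> 'M[R]_m).
Hypothesis uP : P \in unitmx.
Hypothesis GP : G = P^T *m G' *m P.
Hypothesis q : quaternionic_space (bform G) e (mulmx J1) (mulmx J2) (mulmx J3).
Hypothesis q' : quaternionic_space (bform G') e (mulmx J1') (mulmx J2') (mulmx J3').
Let span' (A : 'M[R]_m) := exists k1 k2 k3, A = k1 *: J1' + k2 *: J2' + k3 *: J3'.
Hypothesis span1 : span' (P *m J1 *m invmx P).
Hypothesis span2 : span' (P *m J2 *m invmx P).
Hypothesis span3 : span' (P *m J3 *m invmx P).
Hypothesis SP : forall u, S' (P *m u) *m P = P *m S u.
Hypothesis SE : forall X Y, S X *m Y =
  lin_str (bform G) e (mulmx J1) (mulmx J2) (mulmx J3) xi z1 z2 z3 X Y.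
Hypothesis SE' : forall X Y, S' X *m Y =
  lin_str (bform G') e (mulmx J1') (mulmx J2') (mulmx J3') xi' z1' z2' z3' X Y.
Hypothesis xi'0 : bform G' xi' xi' != 0.
Hypothesis m4 : (4 < m)%N.

Lemma bform_transfer u v : bform G u v = bform G' (P *m u) (P *m v).
Proof. by rewrite /bform GP trmx_mul !mulmxA. Qed.

(* S determines xi: g(S_Z Y, Z) = - g(Y, xi) g(Z, Z) whenever Y is orthogonal
   to Z and to QZ. *)
Lemma xi_transfer : P *m xi = xi'.
Proof.
have [w w0 wo] := @exists_orth_vector R m G' J1' J2' J3' xi' m4.
have [v vo v0] := exists_orth_nonnull q' xi'0 w0 wo.
apply/eqP; rewrite -subr_eq0; apply/eqP.
apply: (test_vector_zero q' xi'0 vo v0) => z y z0 zy.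
have EZ : P *m (invmx P *m z) = z by rewrite mulmxA mulmxV // mul1mx.
have EY : P *m (invmx P *m y) = y by rewrite mulmxA mulmxV // mul1mx.
set Z := invmx P *m z in EZ; set Y := invmx P *m y in EY.
have [h0 h1 h2 h3] := zy.
have oJ J : span' (P *m J *m invmx P) -> bform G Y (J *m Z) = 0.
  move=> [k1 [k2 [k3 E]]]; rewrite bform_transfer EY /Z !mulmxA E !mulmxDl -!scalemxAl.
  by rewrite !bformDr !bformZr h1 h2 h3 !mulr0 !addr0.
have ZY : orth (bform G) (mulmx J1) (mulmx J2) (mulmx J3) Z Y.
  by split; [rewrite bform_transfer EY EZ | exact: oJ | exact: oJ | exact: oJ].
have t := lin_str_test q xi z1 z2 z3 ZY; have t' := lin_str_test q' xi' z1' z2' z3' zy.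
rewrite -SE bform_transfer mulmxA -SP -mulmxA EY EZ SE' t' in t.
have gZ : bform G Z Z = bform G' z z by rewrite bform_transfer EZ.
have gY : bform G Y xi = bform G' y (P *m xi) by rewrite bform_transfer EY.
rewrite gZ gY in t.
rewrite bformDr bformNr; apply/eqP; rewrite subr_eq0; apply/eqP/(mulIf z0).
by apply: oppr_inj; rewrite t.
Qed.

Lemma norm_transfer : bform G xi xi = bform G' xi' xi'.
Proof. by rewrite bform_transfer xi_transfer. Qed.
End Transfer.

(** * The structure on the manifold *)

Section Main.
Context {R : realType} {n : nat}.
Local Notation m := (4 * n)%N.
Notation V := 'cV[R]_m.
Hypothesis hn : (2 <= n)%N.
Variable eps : 'I_3 -> R.
Hypothesis heps : eps = triple (-1) (-1) (-1) \/ eps = triple (-1) 1 1.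
Variable M : smoothManifold R m.
Variable g : mchart M -> V -> 'M[R]_m.
Hypothesis hg : pseudo_riemannian g.
Variable Q : mchart M -> V -> set 'M[R]_m.
Hypothesis hQ : quaternion_kahler eps g Q.
Variable S : mchart M -> V -> V -> 'M[R]_m.
Hypothesis hS : homogeneous_structure eps g Q S.
Hypothesis hnd : nondegenerate_structure eps g Q S.

Lemma epsE : [/\ eps i1 = -1, eps i3 = eps i2 & eps i2 = 1 \/ eps i2 = -1].
Proof. by case: heps => ->; split=> //; [right | left]. Qed.

Lemma dim_gt4 : (4 < m)%N.
Proof. by rewrite -[X in (X < _)%N]muln1 ltn_pmul2l. Qed.

Lemma local_basis_space c U J x : local_basis eps g Q c U J -> U x ->
  quaternionic_space (bform (g c x)) (eps i2) (mulmx (J i1 x)) (mulmx (J i2 x)) (mulmx (J i3 x)).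
Proof.
move=> [oU Uc sJ lb] Ux; have [sk sq j12 _] := lb x Ux; have [e1 e3 e2] := epsE.
have [_ sG uG _] := hg; have cx := Uc _ Ux.
have jl (A : 'M[R]_m) k (u v : V) : A *m (k *: u + v) = k *: (A *m u) + A *m v.
  by rewrite mulmxDr -scalemxAr.
split => //; try exact: sk; try exact: jl.
- by move=> u v; apply: bformC; apply: sG.
- by move=> u v w; exact: bformDl.
- by move=> k u w; exact: bformZl.
- by move=> u v h; apply: (bform_inj (sG _ _ cx) (uG _ _ cx)) => w; exact: h.
- by move=> u; rewrite mulmxA sq e1 mul_scalar_mx scaleN1r.
- by move=> u; rewrite mulmxA sq mul_scalar_mx.
- by move=> u; rewrite mulmxA sq e3 mul_scalar_mx.
- by move=> u; rewrite mulmxA j12.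
Qed.

Lemma local_basis_span c U J x A : local_basis eps g Q c U J -> U x ->
  Q c x A <-> in_span (J i1) (J i2) (J i3) x A.
Proof.
move=> [_ _ _ lb] Ux; have [_ _ _ ->] := lb x Ux; split.
  by move=> [k ->]; exists (k i1), (k i2), (k i3); rewrite sum3.
move=> [k1 [k2 [k3 ->]]]; exists (triple k1 k2 k3); by rewrite sum3.
Qed.

Lemma linear_expression_lin_str c U J xi zeta x : linear_expression eps g Q S c U J xi zeta ->
  U x -> forall X Y, S c x X *m Y =
  lin_str (bform (g c x)) (eps i2) (mulmx (J i1 x)) (mulmx (J i2 x)) (mulmx (J i3 x)) (xi x)
    (fun X => bform (g c x) X (zeta i1 x)) (fun X => bform (g c x) X (zeta i2 x))
    (fun X => bform (g c x) X (zeta i3 x)) X Y.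
Proof.
move=> [_ _ _ h] Ux X Y; have [e1 e3 _] := epsE.
by rewrite h // !sum3 e1 e3.
Qed.

Section LinearExpression.
Variables (c : mchart M) (U : set V) (J : 'I_3 -> V -> 'M[R]_m) (xi : V -> V) (zeta : 'I_3 -> V -> V).
Hypothesis le : linear_expression eps g Q S c U J xi zeta.
Let lb : local_basis eps g Q c U J. Proof. by case: le. Qed.
Let oU : open U. Proof. by case: lb. Qed.
Let Uc : U `<=` chran c. Proof. by case: lb. Qed.
Let Gam := levi_civita (g c).
Let sG : smooth_on U (g c). Proof. by case: hg => h _ _ _; exact: smooth_subset (h c). Qed.
Let symG x : U x -> (g c x)^T = g c x. Proof. by case: hg => _ h _ _ /Uc; exact: h. Qed.
Let unitG x : U x -> g c x \in unitmx. Proof. by case: hg => _ _ h _ /Uc; exact: h. Qed.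
Let Gam_smooth u : smooth_on U (fun y => Gam y u).
Proof. exact: smooth_levi_civita. Qed.
Let Gam_sym x u v : U x -> Gam x u *m v = Gam x v *m u.
Proof. exact: levi_civita_sym. Qed.
Let Gam_metric x u v w : U x -> bform (pder u (g c) x) v w
  = bform (g c x) (Gam x u *m v) w + bform (g c x) v (Gam x u *m w).
Proof. exact: levi_civita_metric. Qed.
Let S_smooth u : smooth_on U (fun y => S c y u).
Proof. by case: hS => -[h _ _] _ _ _ _; exact: smooth_subset (h c u). Qed.
Let S_lin x k u v : U x -> S c x (k *: u + v) = k *: S c x u + S c x v.
Proof. by case: hS => -[_ h _] _ _ _ _ /Uc; move/h. Qed.
Let J_smooth a : smooth_on U (J a). Proof. by case: lb. Qed.
Let HQ x (Ux : U x) := local_basis_space lb Ux.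
Let parallelQ A x u : smooth_on U A -> (forall y, U y -> in_span (J i1) (J i2) (J i3) y (A y)) ->
  U x -> in_span (J i1) (J i2) (J i3) x (pder u A x + Gam x u *m A x - A x *m Gam x u).
Proof.
move=> sA spA Ux; apply/(local_basis_span _ lb Ux); rewrite -pderE.
case: hQ => _ _ par; apply: (par c U A oU Uc sA _ x u Ux) => y Uy.
by apply/(local_basis_span _ lb Uy); exact: spA.
Qed.
Let xi_smooth : smooth_on U xi. Proof. by case: le. Qed.
Let zeta_smooth a : smooth_on U (zeta a). Proof. by case: le. Qed.
Let SE x (Ux : U x) := linear_expression_lin_str le Ux.
Notation Gt := (fun x u => Gam x u - S c x u).
Let tmetric x u v w : U x -> bform (pder u (g c) x) v w
  = bform (g c x) (Gt x u *m v) w + bform (g c x) v (Gt x u *m w).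
Proof.
move=> Ux; case: hS => _ h _ _ _; have := h c x (Uc Ux) u v w.
rewrite /nabla_metric pderE (pder_bform_cst oU sG) //.
by move/eqP; rewrite -addrA -opprD subr_eq0 => /eqP.
Qed.
Let tS x u v : U x ->
  pder u (fun y => S c y v) x + Gt x u *m S c x v - S c x v *m Gt x u = S c x (Gt x u *m v).
Proof.
move=> Ux; case: hS => _ _ _ h _; have := h c x (Uc Ux) u v.
by rewrite /nabla_tensor12 /nabla_end pderE => /eqP; rewrite subr_eq0 => /eqP.
Qed.

Lemma riemE x u v w z : U x -> riem (g c) x u v w z = rm (g c) Gam x u v w z.
Proof.
move=> Ux; rewrite /riem /rm.
by rewrite (curvE oU Gam_smooth Gam_sym u v (smooth_mx_cst oU w) Ux).
Qed.

Let tR x u v1 v2 v3 v4 : U x ->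
  pder u (fun y => rm (g c) Gam y v1 v2 v3 v4) x = rm (g c) Gam x (Gt x u *m v1) v2 v3 v4
   + rm (g c) Gam x v1 (Gt x u *m v2) v3 v4 + rm (g c) Gam x v1 v2 (Gt x u *m v3) v4
   + rm (g c) Gam x v1 v2 v3 (Gt x u *m v4).
Proof.
move=> Ux; case: hS => _ _ h _ _; have := h c x (Uc Ux) u v1 v2 v3 v4.
rewrite /nabla_tensor04 pderE !riemE //.
rewrite (pder_ext oU u (fun y Uy => riemE v1 v2 v3 v4 Uy) Ux) => E.
by apply/eqP; rewrite -subr_eq0 !opprD !addrA; apply/eqP.
Qed.
Let xi_nonnull x : U x -> bform (g c x) (xi x) (xi x) != 0.
Proof. exact: hnd le x. Qed.
Let exists_orth x w : U x -> exists2 v : V, v <> 0 &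
  orth (bform (g c x)) (mulmx (J i1 x)) (mulmx (J i2 x)) (mulmx (J i3 x)) w v.
Proof. by move=> _; exact: exists_orth_vector dim_gt4. Qed.

Lemma linear_expression_curvature x : U x ->
  (forall X Y, S c x X *m Y = lin_str (bform (g c x)) (eps i2)
     (mulmx (J i1 x)) (mulmx (J i2 x)) (mulmx (J i3 x))
     (xi x) (fun=> 0) (fun=> 0) (fun=> 0) X Y) /\
  (forall X Y Z W, riem (g c) x X Y Z W = - (bform (g c x) (xi x) (xi x) *
     R0 (bform (g c x)) (eps i2) (mulmx (J i1 x)) (mulmx (J i2 x)) (mulmx (J i3 x)) X Y Z W)).
Proof.
move=> Ux; have [h1 h2] := linear_type_curvature oU sG symG Gam_smooth Gam_sym Gam_metric
  S_smooth S_lin (J_smooth i1) (J_smooth i2) (J_smooth i3) HQ parallelQ xi_smooth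
  (zeta_smooth i1) (zeta_smooth i2) (zeta_smooth i3) SE tmetric tS tR xi_nonnull exists_orth Ux.
by split=> // X Y Z W; rewrite riemE.
Qed.

Lemma norm_locally_constant x : U x -> \forall y \near x,
  U y /\ bform (g c y) (xi y) (xi y) = bform (g c x) (xi x) (xi x).
Proof.
move=> Ux; apply: (locally_constant oU (f := fun y => bform (g c y) (xi y) (xi y))) => //.
  exact: smooth_bform.
by move=> u y Uy; exact: (pder_xi_norm oU sG S_smooth (J_smooth i1) (J_smooth i2) (J_smooth i3)
  HQ parallelQ xi_smooth (zeta_smooth i1) (zeta_smooth i2) (zeta_smooth i3) SE tmetric tS
  xi_nonnull exists_orth u Uy).
Qed.

End LinearExpression.

(** The Jacobian is a factor of the invertible Gram matrix [g c x] in the transformation law of the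
    metric. *)
Lemma jac_unit (c d : mchart M) (x : V) : overlap c d x -> jac c d x \in unitmx.
Proof.
move=> o; have [cx _] := o; have [_ _ uG tr] := hg; have := uG c x cx.
by rewrite (tr c d x o) unitmx_mul => /andP[_ ->].
Qed.

Lemma norm_chart_invariant (c d : mchart M) U J xi zeta U' J' xi' zeta' x :
  linear_expression eps g Q S c U J xi zeta -> linear_expression eps g Q S d U' J' xi' zeta' ->
  overlap c d x -> U x -> U' (trans c d x) ->
  bform (g c x) (xi x) (xi x)
    = bform (g d (trans c d x)) (xi' (trans c d x)) (xi' (trans c d x)).
Proof.
move=> le le' o Ux Ux'; have [lb _ _ _] := le; have [lb' _ _ _] := le'.
have [[hQ1 _] _ _] := hQ; have [_ _ _ gtr] := hg; have [[_ _ Str] _ _ _ _] := hS.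
have sp a : in_span (J' i1) (J' i2) (J' i3) (trans c d x) (jac c d x *m J a x *m invmx (jac c d x)).
  apply/(local_basis_span _ lb' Ux')/(hQ1 c d x o); apply/(local_basis_span _ lb Ux).
  move: a; apply: ord3P; [exists 1, 0, 0 | exists 0, 1, 0 | exists 0, 0, 1];
    by rewrite scale1r !scale0r ?addr0 ?add0r.
apply: (norm_transfer (jac_unit o) (gtr c d x o) (local_basis_space lb Ux) (local_basis_space lb' Ux')
  (sp i1) (sp i2) (sp i3) (Str c d x o) (linear_expression_lin_str le Ux)
  (linear_expression_lin_str le' Ux') (hnd le' Ux') dim_gt4).
Qed.

Lemma adapted_bases_invariant c U J U' J' x (F : 'M[R]_m -> 'M[R]_m -> R) :
  local_basis eps g Q c U J -> local_basis eps g Q c U' J' -> U x -> U' x ->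
  (forall k A B C, F (k *: A + B) C = k * F A C + F B C) ->
  (forall k A B C, F A (k *: B + C) = k * F A B + F A C) ->
  \sum_a eps a * F (J a x) (J a x) = \sum_a eps a * F (J' a x) (J' a x).
Proof.
move=> lb lb' Ux Ux' Fl Fr; have [e1 e3 _] := epsE.
have /choice[k kE] : forall a, exists k : 'I_3 -> R, J a x = \sum_b k b *: J' b x.
  move=> a; have [_ _ _ /(_ x Ux')[_ _ _ QE]] := lb'.
  suff : Q c x (J a x) by rewrite QE.
  apply/(local_basis_span _ lb Ux).
  move: a; apply: ord3P; [exists 1, 0, 0 | exists 0, 1, 0 | exists 0, 0, 1];
    by rewrite scale1r !scale0r ?addr0 ?add0r.
have m0 : (0 < m)%N by apply: leq_trans dim_gt4.
exact: (adapted_bases_sum m0 (G := g c x) (J := fun a => J a x) (J' := fun a => J' a x) e1 e3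
  (local_basis_space lb Ux) (local_basis_space lb' Ux') kE Fl Fr).
Qed.

Hypothesis hlin : linear_type eps g Q S.

Lemma linear_type_QK3 : in_QK3 eps g Q S.
Proof.
move=> c U J lb x Ux; have [_ Uc _ _] := lb.
have [U' [J' [xi [zeta [le Ux']]]]] := hlin (Uc x Ux); have [lb' _ _ _] := le.
(* The covector is $\theta = g(\xi,\cdot)$. *)
exists ((xi x)^T *m g c x) => th b X Y Z.
have thE W : th W = bform (g c x) (xi x) W by [].
(* Bilinear in two endomorphisms, so that its trace over [J] can be replaced by the trace over the
   basis [J'] of the linear expression. *)
pose F A B := b X (A *m Y) * th (B *m Z) - b X (A *m Z) * th (B *m Y).
rewrite -[X in _ - X]/(\sum_a eps a * F (J a x) (J a x)).
rewrite (adapted_bases_invariant lb lb' Ux Ux' (F := F)); last first.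
- move=> k A B C; rewrite /F /b !thE !mulmxDl -!scalemxAl !bformDr !bformZr; ring.
- move=> k A B C; rewrite /F /b !thE !mulmxDl -!scalemxAl !bformDr !bformZr; ring.
have [e1 e3 _] := epsE; have q := local_basis_space lb' Ux'.
have [SE _] := linear_expression_curvature le Ux'.
rewrite sum3 /F /b !thE e1 e3 (g_lin_str q SE) (qs_gC q Y (xi x)).
rewrite !(qs_gC q Y (_ *m xi x)) (qs_sk1 q) (qs_sk2 q) (qs_sk3 q); ring.
Qed.

Lemma linear_type_riem c U J U' J' xi zeta x : local_basis eps g Q c U J ->
  linear_expression eps g Q S c U' J' xi zeta -> U x -> U' x -> forall X Y Z W,
  riem (g c) x X Y Z W = - (bform (g c x) (xi x) (xi x) * riem0 eps (g c x) (fun a => J a x) X Y Z W).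
Proof.
move=> lb le Ux Ux' X Y Z W; have [lb' _ _ _] := le.
have [_ ->] := linear_expression_curvature le Ux'; congr (- (_ * _)).
pose b := bform (g c x).
pose F A B := b (A *m X) Z * b (B *m Y) W - b (A *m Y) Z * b (B *m X) W
  + 2 * b X (A *m Y) * b Z (B *m W).
rewrite /riem0 -/b -[X in _ = _ - X]/(\sum_a eps a * F (J a x) (J a x)).
rewrite (adapted_bases_invariant lb lb' Ux Ux' (F := F)); last first.
- move=> k A B C; rewrite /F /b !mulmxDl -!scalemxAl !bformDr !bformZr !bformDl !bformZl; ring.
- move=> k A B C; rewrite /F /b !mulmxDl -!scalemxAl !bformDr !bformZr !bformDl !bformZl; ring.
have [e1 e3 _] := epsE; rewrite sum3 /F /R0 /b e1 e3; ring.
Qed.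

(** $N$ as a function on $M$, encoded by its graph: $\xi$ is available only through local
    expressions, and existence and uniqueness of the value are proved separately. *)
Definition norm_at (p : M) (r : R) := exists c U J xi zeta,
  [/\ linear_expression eps g Q S c U J xi zeta, chdom c p, U (chmap c p)
    & r = bform (g c (chmap c p)) (xi (chmap c p)) (xi (chmap c p))].

Lemma norm_at_exists p : exists r, norm_at p r.
Proof.
have [c cp] := chart_cover p; have [U [J [xi [zeta [le Ux]]]]] := hlin (chmap_ran cp).
by exists (bform (g c (chmap c p)) (xi (chmap c p)) (xi (chmap c p))), c, U, J, xi, zeta.
Qed.

Lemma norm_at_unique p r r' : norm_at p r -> norm_at p r' -> r = r'.
Proof.
move=> [c [U [J [xi [zeta [le cp Ux ->]]]]]] [d [U' [J' [xi' [zeta' [le' dp Ux' ->]]]]]].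
have E : trans c d (chmap c p) = chmap d p by rewrite /trans chmapK.
have o : overlap c d (chmap c p) by split; [exact: chmap_ran | rewrite chmapK].
by rewrite -E in Ux' *; exact: norm_chart_invariant le le' o Ux Ux'.
Qed.

Lemma norm_at_near p r : norm_at p r -> \forall p' \near p, norm_at p' r.
Proof.
move=> [c [U [J [xi [zeta [le cp Ux rE]]]]]].
have near1 : \forall p' \near p, U (chmap c p') /\
    bform (g c (chmap c p')) (xi (chmap c p')) (xi (chmap c p')) = r.
  by rewrite rE; exact: chmap_continuous cp _ (norm_locally_constant le Ux).
have near2 : \forall p' \near p, chdom c p' by apply: open_nbhs_nbhs; split=> //; exact: chdom_open.
apply: (@filterS2 _ (nbhs p) _ _ _ _ _ near1 near2) => p' [Up' E] cp'.
by exists c, U, J, xi, zeta; split=> //; rewrite E.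
Qed.

Lemma norm_at_const : connected [set: M] -> forall p p' r, norm_at p r -> norm_at p' r.
Proof.
move=> hM p p' r pr.
have E : [set q | norm_at q r] = [set: M].
  apply: (hM [set q | norm_at q r]); first by exists p.
  - exists [set q | norm_at q r]; last by rewrite setTI.
    by rewrite openE => q /norm_at_near.
  (* Closedness: near a point outside the level set the value taken there persists, and uniqueness
     keeps it different from [r]. *)
  - exists [set q | norm_at q r]; last by rewrite setTI.
    rewrite -openC openE => q nq; have [r' qr'] := norm_at_exists q.
    apply: filterS (norm_at_near qr') => q' q'r' q'r.
    by apply: nq; rewrite /= (norm_at_unique q'r q'r').
have : [set: M] p' by [].
by rewrite -E.
Qed.

End Main.

Theorem theorem4p4 (R : realType) (n : nat) (hn : (2 <= n)%N)
  (eps : 'I_3 -> R)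
  (heps : eps = triple (-1) (-1) (-1) \/ eps = triple (-1) 1 1)
  (M : smoothManifold R (4 * n)%N)
  (hM : connected [set: M])
  (g : mchart M -> 'cV[R]_(4 * n) -> 'M[R]_(4 * n))
  (hg : pseudo_riemannian g)
  (Q : mchart M -> 'cV[R]_(4 * n) -> set 'M[R]_(4 * n))
  (hQ : quaternion_kahler eps g Q)
  (S : mchart M -> 'cV[R]_(4 * n) -> 'cV[R]_(4 * n) -> 'M[R]_(4 * n))
  (hS : homogeneous_structure eps g Q S)
  (hlin : linear_type eps g Q S)
  (hnd : nondegenerate_structure eps g Q S) :
  in_QK3 eps g Q S /\
  exists k : R,
    (forall c U J xi zeta, linear_expression eps g Q S c U J xi zeta ->
       forall x, U x -> k = - 4 * bform (g c x) (xi x) (xi x)) /\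
    constant_curvature eps g Q k.
Proof.
split; first exact: linear_type_QK3.
have [r rE] : exists r, forall c U J xi zeta, linear_expression eps g Q S c U J xi zeta ->
    forall x, U x -> r = bform (g c x) (xi x) (xi x).
  (* Connectedness of the whole space does not exclude an empty $M$, for which the constant is
     arbitrary and set to 0. *)
  have [[p _]|np] := pselect (exists p : M, True).
    have [r pr] := norm_at_exists hlin p; exists r => c U J xi zeta le x Ux.
    have [[_ Uc _ _] _ _ _] := le; have cx := Uc x Ux.
    have E := chinvK cx.
    have := norm_at_const hn heps hg hQ hS hnd hlin hM (chinv c x) pr.
    move/(norm_at_unique hn heps hg hQ hS hnd); apply.
    by exists c, U, J, xi, zeta; rewrite E; split=> //; exact: chinv_dom.
  exists 0 => c U J xi zeta [[_ Uc _ _] _ _ _] x Ux.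
  by case: np; exists (chinv c x).
(* $R = -N R^0$ is to be read as $(k/4) R^0$. *)
exists (- 4 * r); split=> [c U J xi zeta le x Ux|c U J lb x Ux X Y Z W].
  by rewrite (rE _ _ _ _ _ le x Ux).
have [_ Uc _ _] := lb; have [U' [J' [xi [zeta [le Ux']]]]] := hlin c x (Uc x Ux).
rewrite (linear_type_riem hn heps hg hQ hS hnd lb le Ux Ux') -(rE _ _ _ _ _ le x Ux').
by field.
Qed.
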